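(* Let $(G,\Omega)$ be an oligomorphic group and let $m$ be a positive integer. Suppose: $\mathtt{Ind}(m)$: for every finite $A\subset\Omega$, the index of $G(A)$ in $G[A]$ divides a power of $m$; and $\mathtt{Gen}(m)$: $\Theta_{\le 1}(G,\Omega)[1/m]$ is a finitely generated $\mathbf{Z}[1/m]$-module. Then: (a) There is a ring isomorphism $\Theta(G,\Omega)[1/m]\cong\mathbf{Z}[1/m]^n$ for some $n$. (b) Let $f\colon Y\to X$ be a map of transitive $\mathscr{E}(\Omega)$-smooth $G$-sets, and let $(a_1,\ldots,a_n)$ be the element of $\mathbf{Z}[1/m]^n$ corresponding to $[f]$ under the isomorphism in (a). Then each $a_i$ is either $0$ or a unit of $\mathbf{Z}[1/m]$. (c) If $\Theta_{\le 1}(G,\Omega)[1/m]$ is generated by $r$ elements as a $\mathbf{Z}[1/m]$-module and $p$ is the smallest prime not dividing $m$, then $n\le p^r$.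
   Context: An oligomorphic group $(G,\Omega)$ is a permutation group $G$ on a set $\Omega$ with finitely many orbits on $\Omega^n$ for all $n$. For a finite subset $A\subset\Omega$, $G(A)$ is the subgroup fixing every element of $A$, and $G[A]$ the subgroup of $g$ with $gA=A$. $G$ is topologized so that the $G(A)$ form a neighborhood basis of the identity. A $G$-set is a set with a $G$-action having open stabilizers and finitely many orbits; maps of $G$-sets are $G$-equivariant. Let $\mathscr{E}(\Omega)=\{G(A): A\subset\Omega \text{ finite}\}$. A $G$-set is $\mathscr{E}(\Omega)$-smooth if all its point stabilizers lie in $\mathscr{E}(\Omega)$ (a transitive $G$-set is so if and only if it is isomorphic to an orbit on some $\Omega^n$). $\Theta(G,\Omega)$ is the commutative ring generated by symbols $[f]$ for all maps $f\colon Y\to X$ of $\mathscr{E}(\Omega)$-smooth $G$-sets with $X$ transitive, subject to: (i) $[f]=1$ if $f$ is an isomorphism; (ii) if $Y=Y_1\sqcup Y_2$ as $G$-sets and $f_i=f|_{Y_i}$ then $[f]=[f_1]+[f_2]$; (iii) $[f\circ g]=[f][g]$ for maps $g\colon Z\to Y$, $f\colon Y\to X$ of transitive $\mathscr{E}(\Omega)$-smooth $G$-sets; (iv) if $f\colon Y\to X$ and $X'\to X$ are maps of $\mathscr{E}(\Omega)$-smooth $G$-sets with $X,X'$ transitive and $f'\colon Y\times_XX'\to X'$ is the base change then $[f]=[f']$. A map $f\colon Y\to X$ is basic if, for some $\ell\ge0$, $Y$ is a $G$-orbit on $\Omega^{\ell+1}$, $X$ is a $G$-orbit on $\Omega^\ell$,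 and $f$ is the restriction of the projection onto the first $\ell$ coordinates; then $[f]$ is called a basic class. $\Theta_{\le 1}(G,\Omega)$ is the additive subgroup of $\Theta(G,\Omega)$ generated by basic classes. *)

(* Defs.v *)
From HB Require Import structures.
From mathcomp Require Import all_boot all_algebra zify.
From mathcomp Require Import boolp classical_sets functions cardinality.

Set Implicit Arguments.
Unset Strict Implicit.
Unset Printing Implicit Defensive.

Import GRing.Theory.
Local Open Scope classical_set_scope.
Local Open Scope quotient_scope.
Local Open Scope ring_scope.

(* M[1/m] for an abelian group M: fractions x / m^i, where x / m^i = y / m^j  *)
(* iff x m^(k+j) = y m^(k+i) for some k.  The same type carries the ring      *)
(* structure of R[1/m] when M is a commutative ring R, and is in general a    *)
(* module over Z[1/m] = loc m int.                                            *)
Section Localization.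
Variables (m : nat) (M : zmodType).
Implicit Types a b c : M * nat.

Definition loc_rel a b : Prop :=
  exists k, a.1 *+ m ^ (k + b.2) = b.1 *+ m ^ (k + a.2).

Definition loc_relb a b : bool := `[< loc_rel a b >].

Lemma loc_rel_refl : reflexive loc_relb.
Proof. by move=> a; apply/asboolP; exists 0. Qed.

Lemma loc_rel_sym : symmetric loc_relb.
Proof. by move=> a b; apply/asboolP/asboolP => -[k e]; exists k. Qed.

Lemma loc_rel_trans : transitive loc_relb.
Proof.
move=> b a c /asboolP[k e] /asboolP[l e']; apply/asboolP; exists (k + l + b.2)%N.
have -> : (k + l + b.2 + c.2 = (k + b.2) + (l + c.2))%N by lia.
rewrite expnD mulrnA e mulrnAC e' -mulrnA -expnD; congr (_ *+ _ ^ _).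
by lia.
Qed.

Definition loc_equiv :=
  EquivRel loc_relb loc_rel_refl loc_rel_sym loc_rel_trans.

Definition loc : Type := {eq_quot loc_equiv}.
HB.instance Definition _ := Choice.on loc.
HB.instance Definition _ := EqQuotient.on loc.

Definition loc_frac (x : M) (i : nat) : loc := \pi_loc (x, i).

Lemma loc_fracP x i y j : loc_frac x i = loc_frac y j <-> loc_rel (x, i) (y, j).
Proof. by split=> [/eqmodP/asboolP|h] //; apply/eqmodP/asboolP. Qed.

Lemma loc_fracE (u : loc) : u = loc_frac (repr u).1 (repr u).2.
Proof. by rewrite /loc_frac -surjective_pairing reprK. Qed.

Lemma loc_frac_ind (Q : loc -> Prop) :
  (forall x i, Q (loc_frac x i)) -> forall u, Q u.
Proof. by move=> h u; rewrite (loc_fracE u). Qed.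

Lemma loc_frac_repr x i : loc_rel (repr (loc_frac x i)) (x, i).
Proof.
by rewrite [repr _]surjective_pairing; apply/loc_fracP; rewrite -loc_fracE.
Qed.

Lemma loc_frac_eq x i y j :
  x *+ m ^ j = y *+ m ^ i -> loc_frac x i = loc_frac y j.
Proof. by move=> e; apply/loc_fracP; exists 0. Qed.

Definition loc_add (u v : loc) : loc :=
  loc_frac ((repr u).1 *+ m ^ (repr v).2 + (repr v).1 *+ m ^ (repr u).2)
           ((repr u).2 + (repr v).2).
Definition loc_opp (u : loc) : loc := loc_frac (- (repr u).1) (repr u).2.

Lemma loc_addE x i y j :
  loc_add (loc_frac x i) (loc_frac y j) =
  loc_frac (x *+ m ^ j + y *+ m ^ i) (i + j).
Proof.
rewrite /loc_add; move: (loc_frac_repr x i) (loc_frac_repr y j).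
move: (repr (loc_frac x i)) (repr (loc_frac y j)).
move=> [x' i'] [y' j'] [k e] [l e']; rewrite /= in e e'.
apply/loc_fracP; exists (k + l)%N => /=.
rewrite !mulrnDl -!mulrnA -!expnD; congr (_ + _).
  have -> : (j' + (k + l + (i + j)) = (k + i) + (j' + l + j))%N by lia.
  by rewrite expnD mulrnA e -mulrnA -expnD; congr (_ *+ _ ^ _); lia.
have -> : (i' + (k + l + (i + j)) = (l + j) + (i' + k + i))%N by lia.
by rewrite expnD mulrnA e' -mulrnA -expnD; congr (_ *+ _ ^ _); lia.
Qed.

Lemma loc_oppE x i : loc_opp (loc_frac x i) = loc_frac (- x) i.
Proof.
rewrite /loc_opp; case: (loc_frac_repr x i); move: (repr _) => [x' i'] /= k e.
by apply/loc_fracP; exists k; rewrite /= !mulNrn e.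
Qed.

Lemma loc_addA : associative loc_add.
Proof.
elim/loc_frac_ind=> x i; elim/loc_frac_ind=> y j; elim/loc_frac_ind=> z k.
rewrite !loc_addE addnA; congr loc_frac.
rewrite !mulrnDl -!mulrnA -!expnD addrA.
by congr (_ *+ _ ^ _ + _ *+ _ ^ _ + _ *+ _ ^ _); lia.
Qed.

Lemma loc_addC : commutative loc_add.
Proof.
elim/loc_frac_ind=> x i; elim/loc_frac_ind=> y j.
by rewrite !loc_addE addrC addnC.
Qed.

Lemma loc_add0 : left_id (loc_frac 0 0) loc_add.
Proof. by elim/loc_frac_ind=> x i; rewrite loc_addE mul0rn add0r. Qed.

Lemma loc_addN : left_inverse (loc_frac 0 0) loc_opp loc_add.
Proof.
elim/loc_frac_ind=> x i; rewrite loc_oppE loc_addE; apply: loc_frac_eq.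
by rewrite mulNrn addNr !mul0rn.
Qed.

HB.instance Definition _ :=
  GRing.isZmodule.Build loc loc_addA loc_addC loc_add0 loc_addN.

End Localization.

(* B(x / m^i, y / m^j) = B(x, y) / m^(i+j) *)
Definition loc_bil (m : nat) (M N L : zmodType) (B : M -> N -> L)
    (u : loc m M) (v : loc m N) : loc m L :=
  loc_frac m (B (repr u).1 (repr v).1) ((repr u).2 + (repr v).2).

Lemma loc_bilE (m : nat) (M N L : zmodType) (B : M -> N -> L) :
    (forall n x y, B (x *+ n) y = B x y *+ n) ->
    (forall n x y, B x (y *+ n) = B x y *+ n) ->
  forall x i y j, loc_bil B (loc_frac m x i) (loc_frac m y j) =
    loc_frac m (B x y) (i + j).
Proof.
move=> Bl Br x i y j.
rewrite /loc_bil; move: (loc_frac_repr m x i) (loc_frac_repr m y j).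
move: (repr (loc_frac m x i)) (repr (loc_frac m y j)).
move=> [x' i'] [y' j'] [k e] [l e']; rewrite /= in e e'.
apply/loc_fracP; exists (k + l)%N => /=.
have -> : (k + l + (i + j) = (k + i) + (l + j))%N by lia.
rewrite expnD mulrnA -(Bl _ x') e -(Br _ _ y') e' Bl Br -mulrnA -expnD.
by congr (_ *+ _ ^ _); lia.
Qed.

Lemma loc_addfrac (m : nat) (M : zmodType) (x y : M) i j :
  loc_frac m x i + loc_frac m y j = loc_frac m (x *+ m ^ j + y *+ m ^ i) (i + j).
Proof. exact: loc_addE. Qed.

Section LocalizationRing.
Variables (m : nat) (R : comPzRingType).
Local Notation RL := (loc m R).

Definition loc_mul : RL -> RL -> RL := loc_bil (fun x y : R => x * y).

Lemma loc_mulE x i y j :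
  loc_mul (loc_frac m x i) (loc_frac m y j) = loc_frac m (x * y) (i + j).
Proof. by apply: loc_bilE => n z t; rewrite ?mulrnAl ?mulrnAr. Qed.

Lemma loc_mulA : associative loc_mul.
Proof.
elim/loc_frac_ind=> x i; elim/loc_frac_ind=> y j; elim/loc_frac_ind=> z k.
by rewrite !loc_mulE mulrA addnA.
Qed.

Lemma loc_mulC : commutative loc_mul.
Proof.
elim/loc_frac_ind=> x i; elim/loc_frac_ind=> y j.
by rewrite !loc_mulE mulrC addnC.
Qed.

Lemma loc_mul1 : left_id (loc_frac m 1 0) loc_mul.
Proof. by elim/loc_frac_ind=> x i; rewrite loc_mulE mul1r. Qed.

Lemma loc_mulD : left_distributive loc_mul +%R.
Proof.
elim/loc_frac_ind=> x i; elim/loc_frac_ind=> y j; elim/loc_frac_ind=> z k.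
rewrite !(loc_addfrac, loc_mulE); apply: loc_frac_eq.
rewrite mulrDl !mulrnAl !mulrnDl -!mulrnA -!expnD.
by congr (_ *+ _ ^ _ + _ *+ _ ^ _); lia.
Qed.

HB.instance Definition _ :=
  GRing.Zmodule_isComPzRing.Build RL loc_mulA loc_mulC loc_mul1 loc_mulD.

End LocalizationRing.

Section LocalizationModule.
Variables (m : nat) (M : zmodType).

Definition loc_scale : loc m int -> loc m M -> loc m M :=
  loc_bil (fun (a : int) (x : M) => x *~ a).

Lemma mulrz_natr (x : M) (a : int) n : x *~ (a *+ n) = x *~ a *+ n.
Proof. by rewrite (pmulrn a) mulrzz mulrzA -pmulrn. Qed.

Lemma mulrz_natl (x : M) (a : int) n : (x *+ n) *~ a = x *~ a *+ n.
Proof. by rewrite !pmulrn mulrzAC. Qed.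

Lemma loc_scaleE (a : int) i (x : M) j :
  loc_scale (loc_frac m a i) (loc_frac m x j) = loc_frac m (x *~ a) (i + j).
Proof.
by apply: loc_bilE => n b y; rewrite ?mulrz_natr ?mulrz_natl.
Qed.

Lemma loc_scaleA (a b : loc m int) (u : loc m M) :
  loc_scale a (loc_scale b u) = loc_scale (a * b) u.
Proof.
elim/loc_frac_ind: a => a i; elim/loc_frac_ind: b => b j.
elim/loc_frac_ind: u => x k.
rewrite (loc_scaleE b) (loc_scaleE a) [_ * _]loc_mulE loc_scaleE.
by rewrite addnA mulrzA_C.
Qed.

Lemma loc_scale1 : left_id 1 loc_scale.
Proof. by elim/loc_frac_ind=> x i; rewrite loc_scaleE. Qed.

Lemma loc_scaleDr : right_distributive loc_scale +%R.
Proof.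
elim/loc_frac_ind=> a i; elim/loc_frac_ind=> x j; elim/loc_frac_ind=> y k.
rewrite loc_addfrac !(loc_scaleE a) loc_addfrac; apply: loc_frac_eq.
rewrite mulrzDl !mulrz_natl !mulrnDl -!mulrnA -!expnD.
by congr (_ *+ _ ^ _ + _ *+ _ ^ _); lia.
Qed.

Lemma loc_scaleDl (u : loc m M) : {morph loc_scale^~ u : a b / a + b}.
Proof.
elim/loc_frac_ind=> a i; elim/loc_frac_ind=> b j.
elim/loc_frac_ind: u => x k.
rewrite loc_addfrac loc_scaleE (loc_scaleE a) (loc_scaleE b) loc_addfrac.
apply: loc_frac_eq.
rewrite mulrzDr !mulrz_natr !mulrnDl -!mulrnA -!expnD.
by congr (_ *+ _ ^ _ + _ *+ _ ^ _); lia.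
Qed.

HB.instance Definition _ := GRing.Zmodule_isLmodule.Build (loc m int) (loc m M)
  loc_scaleA loc_scale1 loc_scaleDr loc_scaleDl.
End LocalizationModule.

(* The commutative ring presented by generators S and relations rel: terms    *)
(* in the ring operations, modulo the congruence generated by rel and the     *)
(* axioms of commutative rings.                                               *)
Inductive cring_term (S : Type) : Type :=
| TGen of S
| TZero
| TOne
| TAdd of cring_term S & cring_term S
| TOpp of cring_term S
| TMul of cring_term S & cring_term S.

Arguments TZero {S}.
Arguments TOne {S}.

HB.instance Definition _ S := gen_eqMixin (cring_term S).
HB.instance Definition _ S := gen_choiceMixin (cring_term S).

Section Presentation.
Variables (S : Type) (rel : cring_term S -> cring_term S -> Prop).
Local Notation term := (cring_term S).

Inductive cring_cong : term -> term -> Prop :=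
| cong_rel s t : rel s t -> cring_cong s t
| cong_refl t : cring_cong t t
| cong_sym s t : cring_cong s t -> cring_cong t s
| cong_trans s t u : cring_cong s t -> cring_cong t u -> cring_cong s u
| cong_add s s' t t' : cring_cong s s' -> cring_cong t t' ->
    cring_cong (TAdd s t) (TAdd s' t')
| cong_opp t t' : cring_cong t t' -> cring_cong (TOpp t) (TOpp t')
| cong_mul s s' t t' : cring_cong s s' -> cring_cong t t' ->
    cring_cong (TMul s t) (TMul s' t')
| cong_addA s t u : cring_cong (TAdd s (TAdd t u)) (TAdd (TAdd s t) u)
| cong_addC s t : cring_cong (TAdd s t) (TAdd t s)
| cong_add0 t : cring_cong (TAdd TZero t) t
| cong_addN t : cring_cong (TAdd (TOpp t) t) TZero
| cong_mulA s t u : cring_cong (TMul s (TMul t u)) (TMul (TMul s t) u)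
| cong_mulC s t : cring_cong (TMul s t) (TMul t s)
| cong_mul1 t : cring_cong (TMul TOne t) t
| cong_mulD s t u :
    cring_cong (TMul (TAdd s t) u) (TAdd (TMul s u) (TMul t u)).

Definition cring_congb (s t : term) : bool := `[< cring_cong s t >].

Lemma cring_cong_refl : reflexive cring_congb.
Proof. by move=> t; apply/asboolP/cong_refl. Qed.

Lemma cring_cong_sym : symmetric cring_congb.
Proof. by move=> s t; apply/asboolP/asboolP; apply: cong_sym. Qed.

Lemma cring_cong_trans : transitive cring_congb.
Proof. by move=> t s u /asboolP h /asboolP h'; apply/asboolP/cong_trans/h'. Qed.

Definition cring_equiv :=
  EquivRel cring_congb cring_cong_refl cring_cong_sym cring_cong_trans.

Definition presented_ring : Type := {eq_quot cring_equiv}.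
HB.instance Definition _ := Choice.on presented_ring.
HB.instance Definition _ := EqQuotient.on presented_ring.

Local Notation cl := (\pi_presented_ring).

Lemma clP s t : cl s = cl t <-> cring_cong s t.
Proof. by split=> [/eqmodP/asboolP|h] //; apply/eqmodP/asboolP. Qed.

Lemma cl_ind (Q : presented_ring -> Prop) : (forall t, Q (cl t)) -> forall u, Q u.
Proof. by move=> h u; rewrite -(reprK u). Qed.

Lemma cong_repr t : cring_cong (repr (cl t)) t.
Proof. by apply/clP; rewrite reprK. Qed.

Definition pres_add (u v : presented_ring) : presented_ring :=
  cl (TAdd (repr u) (repr v)).
Definition pres_opp (u : presented_ring) : presented_ring :=
  cl (TOpp (repr u)).
Definition pres_mul (u v : presented_ring) : presented_ring :=
  cl (TMul (repr u) (repr v)).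

Lemma pres_addE s t : pres_add (cl s) (cl t) = cl (TAdd s t).
Proof. by apply/clP/cong_add; apply: cong_repr. Qed.

Lemma pres_oppE t : pres_opp (cl t) = cl (TOpp t).
Proof. by apply/clP/cong_opp/cong_repr. Qed.

Lemma pres_mulE s t : pres_mul (cl s) (cl t) = cl (TMul s t).
Proof. by apply/clP/cong_mul; apply: cong_repr. Qed.

Lemma pres_addA : associative pres_add.
Proof.
elim/cl_ind=> s; elim/cl_ind=> t; elim/cl_ind=> u.
by rewrite !pres_addE; apply/clP/cong_addA.
Qed.

Lemma pres_addC : commutative pres_add.
Proof.
by elim/cl_ind=> s; elim/cl_ind=> t; rewrite !pres_addE; apply/clP/cong_addC.
Qed.

Lemma pres_add0 : left_id (cl TZero) pres_add.
Proof. by elim/cl_ind=> t; rewrite pres_addE; apply/clP/cong_add0. Qed.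

Lemma pres_addN : left_inverse (cl TZero) pres_opp pres_add.
Proof.
by elim/cl_ind=> t; rewrite pres_oppE pres_addE; apply/clP/cong_addN.
Qed.

HB.instance Definition _ := GRing.isZmodule.Build presented_ring
  pres_addA pres_addC pres_add0 pres_addN.

Lemma pres_mulA : associative pres_mul.
Proof.
elim/cl_ind=> s; elim/cl_ind=> t; elim/cl_ind=> u.
by rewrite !pres_mulE; apply/clP/cong_mulA.
Qed.

Lemma pres_mulC : commutative pres_mul.
Proof.
by elim/cl_ind=> s; elim/cl_ind=> t; rewrite !pres_mulE; apply/clP/cong_mulC.
Qed.

Lemma pres_mul1 : left_id (cl TOne) pres_mul.
Proof. by elim/cl_ind=> t; rewrite pres_mulE; apply/clP/cong_mul1. Qed.

Lemma pres_mulD : left_distributive pres_mul +%R.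
Proof.
elim/cl_ind=> s; elim/cl_ind=> t; elim/cl_ind=> u.
rewrite [cl s + cl t]pres_addE !pres_mulE [RHS]pres_addE.
exact/clP/cong_mulD.
Qed.

HB.instance Definition _ := GRing.Zmodule_isComPzRing.Build presented_ring
  pres_mulA pres_mulC pres_mul1 pres_mulD.

Definition pres_gen (s : S) : presented_ring := cl (TGen s).

End Presentation.

Section Actions.
Variables (G : groupType) (T : Type) (act : G -> T -> T).

Definition orbit (x : T) : set T := range (act^~ x).
Definition stab (x : T) : set G := [set g | act g x = x].
Definition finitely_many_orbits : Prop := finite_set (range orbit).
Definition transitive_action : Prop := exists x, orbit x = setT.

End Actions.

(* A subgroup of Sym(Omega), given as a group acting faithfully on Omega.     *)
Record perm_group := PermGroup {
  grp :> groupType;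
  pts : Type;
  pact : grp -> pts -> pts;
  pact1 : forall x, pact 1%g x = x;
  pactM : forall g h x, pact (g * h)%g x = pact g (pact h x);
  pact_faithful : forall g, (forall x, pact g x = x) -> g = 1%g
}.

Section PermGroups.
Variable P : perm_group.

(* Omega^n is the set of sequences of length n.  (Sequences rather than       *)
(* 'I_n -> Omega or n.-tuple Omega: orbits on Omega^n have to be carriers of  *)
(* G-sets, whose universe must be strictly below that of MathComp structures  *)
(* such as the ring Theta, and the types 'I_n and n.-tuple T are too large.)  *)
Definition tuple_act (g : P) (x : seq (pts P)) : seq (pts P) :=
  [seq pact g a | a <- x].

Definition oligomorphic : Prop :=
  forall n, finite_set [set orbit tuple_act x | x in [set x | size x = n]].

Definition fixer (A : set (pts P)) : set P :=
  [set g | forall a, A a -> pact g a = a].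

Definition setwise_stab (A : set (pts P)) : set P :=
  [set g | pact g @` A = A].

(* The group topology in which the subgroups fixer A, A finite, form a        *)
(* neighborhood basis of the identity.                                        *)
Definition gopen (U : set P) : Prop :=
  forall g, U g -> exists2 A : set (pts P), finite_set A &
    forall h, fixer A h -> U (g * h)%g.

(* The index of H in K is finite, equal to d, counting left cosets.           *)
Definition has_index (H K : set P) (d : nat) : Prop :=
  ([set [set (g * h)%g | h in H] | g in K] #= `I_d)%card.

Definition Ind (m : nat) : Prop :=
  forall A : set (pts P), finite_set A ->
    exists2 d, has_index (fixer A) (setwise_stab A) d & exists k, (d %| m ^ k)%N.

Record gset := GSet {
  carrier :> Type;
  gact : P -> carrier -> carrier;
  gact1 : forall x, gact 1%g x = x;
  gactM : forall g h x, gact (g * h)%g x = gact g (gact h x);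
  gstab_open : forall x, gopen (stab gact x);
  gorbits_finite : finitely_many_orbits gact
}.

Record smooth_gset := SmoothGSet {
  sgset :> gset;
  sgset_smooth : forall x : sgset, exists2 A : set (pts P), finite_set A &
    stab (@gact sgset) x = fixer A
}.

Definition gtransitive (X : gset) : Prop := transitive_action (@gact X).

Record gmap (Y X : gset) := GMap {
  gfun :> Y -> X;
  gfunE : forall g y, gfun (gact g y) = gact g (gfun y)
}.

Lemma gcomp_subproof (Z Y X : gset) (f : gmap Y X) (h : gmap Z Y) g z :
  f (h (gact g z)) = gact g (f (h z)).
Proof. by rewrite !gfunE. Qed.

Definition gcomp (Z Y X : gset) (f : gmap Y X) (h : gmap Z Y) : gmap Z X :=
  GMap (gcomp_subproof f h).

Definition giso (Y X : gset) (f : gmap Y X) : Prop :=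
  exists f' : gmap X Y, cancel f f' /\ cancel f' f.

(* Y = Y1 |_| Y2, the inclusions of the two invariant subsets being given as  *)
(* arbitrary embeddings i1 and i2.                                            *)
Definition gdisjoint_union (Y1 Y2 Y : gset)
    (i1 : gmap Y1 Y) (i2 : gmap Y2 Y) : Prop :=
  [/\ injective i1, injective i2, range i1 `&` range i2 = set0
    & range i1 `|` range i2 = setT].

(* The square of q : Y' -> Y, f' : Y' -> X', f : Y -> X, b : X' -> X          *)
(* identifies Y' with the fiber product of Y and X' over X.                   *)
Definition gcartesian (Y' Y X' X : gset) (q : gmap Y' Y) (f' : gmap Y' X')
    (f : gmap Y X) (b : gmap X' X) : Prop :=
  (forall y', f (q y') = b (f' y')) /\
  (forall y x', f y = b x' -> exists! y', q y' = y /\ f' y' = x').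

Record symbol := Symbol {
  sym_dom : smooth_gset;
  sym_cod : smooth_gset;
  sym_map : gmap sym_dom sym_cod;
  sym_cod_transitive : gtransitive sym_cod
}.

Arguments Symbol {sym_dom sym_cod} sym_map sym_cod_transitive.

Inductive theta_rel : cring_term symbol -> cring_term symbol -> Prop :=
| theta_iso (Y X : smooth_gset) (f : gmap Y X) (tX : gtransitive X) :
    giso f -> theta_rel (TGen (Symbol f tX)) TOne
| theta_union (Y1 Y2 Y X : smooth_gset) (i1 : gmap Y1 Y) (i2 : gmap Y2 Y)
      (f : gmap Y X) (tX : gtransitive X) :
    gdisjoint_union i1 i2 ->
    theta_rel (TGen (Symbol f tX))
      (TAdd (TGen (Symbol (gcomp f i1) tX)) (TGen (Symbol (gcomp f i2) tX)))
| theta_comp (Z Y X : smooth_gset) (f : gmap Y X) (h : gmap Z Y)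
      (tX : gtransitive X) (tY : gtransitive Y) :
    gtransitive Z ->
    theta_rel (TGen (Symbol (gcomp f h) tX))
      (TMul (TGen (Symbol f tX)) (TGen (Symbol h tY)))
| theta_base_change (Y' Y X' X : smooth_gset) (q : gmap Y' Y)
      (f' : gmap Y' X') (f : gmap Y X) (b : gmap X' X)
      (tX : gtransitive X) (tX' : gtransitive X') :
    gcartesian q f' f b ->
    theta_rel (TGen (Symbol f tX)) (TGen (Symbol f' tX')).

Definition Theta : comPzRingType := presented_ring theta_rel.

Definition theta_class (Y X : smooth_gset) (f : gmap Y X) (tX : gtransitive X) :
  Theta := pres_gen theta_rel (Symbol f tX).

Lemma tuple_act1 x : tuple_act 1%g x = x.
Proof. by rewrite /tuple_act (eq_map (@pact1 P)) map_id. Qed.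

Lemma tuple_actM g h x : tuple_act (g * h)%g x = tuple_act g (tuple_act h x).
Proof. by rewrite /tuple_act -map_comp (eq_map (pactM g h)). Qed.

Lemma tuple_act_fixer x :
  exists2 A : set (pts P), finite_set A & stab tuple_act x = fixer A.
Proof.
elim: x => [|a x [A fA eA]].
  exists set0; first exact: finite_set0.
  by apply/seteqP; split=> g /= _.
exists (a |` A); first by rewrite finite_setU; split=> //; apply: finite_set1.
apply/seteqP; split=> g /=.
  case=> ga gx b [-> //|Ab].
  by have : stab tuple_act x g by []; rewrite eA; apply.
move=> gA; congr cons; first by apply: gA; left.
have : fixer A g by move=> b Ab; apply: gA; right.
by rewrite -eA.
Qed.

Section TupleOrbit.
Variable x : seq (pts P).

Definition tuple_orbit := {y | orbit tuple_act x y}.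

Lemma tuple_orbit_eq (y z : tuple_orbit) : sval y = sval z -> y = z.
Proof.
case: y z => [y hy] [z hz] /= e; move: hy hz; rewrite e => hy hz.
by congr exist; apply: Prop_irrelevance.
Qed.

Lemma tuple_orbit_act_subproof (g : P) (y : tuple_orbit) :
  orbit tuple_act x (tuple_act g (sval y)).
Proof.
by case: (svalP y) => h _ e; exists (g * h)%g => //; rewrite tuple_actM e.
Qed.

Definition tuple_orbit_act (g : P) (y : tuple_orbit) : tuple_orbit :=
  exist _ (tuple_act g (sval y)) (tuple_orbit_act_subproof g y).

Lemma tuple_orbit_act1 y : tuple_orbit_act 1%g y = y.
Proof. exact/tuple_orbit_eq/tuple_act1. Qed.

Lemma tuple_orbit_actM g h y :
  tuple_orbit_act (g * h)%g y = tuple_orbit_act g (tuple_orbit_act h y).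
Proof. exact/tuple_orbit_eq/tuple_actM. Qed.

Lemma tuple_orbit_smooth y : exists2 A : set (pts P), finite_set A &
  stab tuple_orbit_act y = fixer A.
Proof.
have [A fA e] := tuple_act_fixer (sval y); exists A => //; rewrite -{}e.
apply/seteqP; split=> g /=; first by move=> /(congr1 sval).
by move=> e; apply: tuple_orbit_eq.
Qed.

Lemma tuple_orbit_open y : gopen (stab tuple_orbit_act y).
Proof.
have [A fA e] := tuple_orbit_smooth y; rewrite /gopen e.
move=> g gA; exists A => // h hA a Aa.
by rewrite pactM hA // gA.
Qed.

Lemma tuple_orbit_transitive : transitive_action tuple_orbit_act.
Proof.
have x_in : orbit tuple_act x x by exists 1%g => //; apply: tuple_act1.
exists (exist _ x x_in); apply/seteqP; split=> // y _.
by case: (svalP y) => g _ e; exists g => //; apply: tuple_orbit_eq.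
Qed.

Lemma tuple_orbit_finite : finitely_many_orbits tuple_orbit_act.
Proof.
have [x0 x0T] := tuple_orbit_transitive.
apply: (@sub_finite_set _ _ [set setT]); last exact: finite_set1.
move=> _ [y _ <-]; apply/seteqP; split=> // z _ /=.
have [g _ gE] : orbit tuple_orbit_act x0 y by rewrite x0T.
have [h _ hE] : orbit tuple_orbit_act x0 z by rewrite x0T.
exists (h * g^-1)%g => //.
by rewrite -gE -hE -tuple_orbit_actM mulgVK.
Qed.

Definition tuple_orbit_gset : smooth_gset :=
  @SmoothGSet (GSet tuple_orbit_act1 tuple_orbit_actM tuple_orbit_open
                 tuple_orbit_finite)
    tuple_orbit_smooth.

End TupleOrbit.

(* For x in Omega^(l+1), the projection onto the first l coordinates from the *)
(* orbit of x to that of take l x; every basic map is of this form.           *)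
Section Basic.
Variables (l : nat) (x : seq (pts P)).

Lemma basic_map_subproof (y : tuple_orbit_gset x) :
  orbit tuple_act (take l x) (take l (sval y)).
Proof. by case: (svalP y) => g _ <-; exists g => //; rewrite /tuple_act map_take. Qed.

Definition basic_map_fun (y : tuple_orbit_gset x) :
    tuple_orbit_gset (take l x) :=
  exist _ (take l (sval y)) (basic_map_subproof y).

Lemma basic_map_equivariant g y :
  basic_map_fun (gact g y) = gact g (basic_map_fun y).
Proof. by apply: tuple_orbit_eq; rewrite /= /tuple_act map_take. Qed.

Definition basic_map :
    gmap (tuple_orbit_gset x) (tuple_orbit_gset (take l x)) :=
  GMap basic_map_equivariant.

Definition basic_map_class : Theta :=
  theta_class basic_map (tuple_orbit_transitive (take l x)).

End Basic.

Definition basic_class (a : Theta) : Prop :=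
  exists l (x : seq (pts P)), size x = l.+1 /\ a = basic_map_class l x.

Inductive theta_le1_spec : Theta -> Prop :=
| theta_le1_basic a : basic_class a -> theta_le1_spec a
| theta_le1_0 : theta_le1_spec 0
| theta_le1_sub a b :
    theta_le1_spec a -> theta_le1_spec b -> theta_le1_spec (a - b).

Definition theta_le1 : {pred Theta} := fun a => `[< theta_le1_spec a >].

Lemma theta_le1_zmod_closed : zmod_closed theta_le1.
Proof.
split; first exact/asboolP/theta_le1_0.
by move=> a b /asboolP ha /asboolP hb; apply/asboolP/theta_le1_sub.
Qed.

HB.instance Definition _ :=
  GRing.isZmodClosed.Build Theta theta_le1 theta_le1_zmod_closed.

Record Theta_le1 := MkTheta_le1 {
  theta_le1_val :> Theta;
  theta_le1_valP : theta_le1_val \in theta_le1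
}.

HB.instance Definition _ := [isSub for theta_le1_val].
HB.instance Definition _ := [Choice of Theta_le1 by <:].
HB.instance Definition _ := [SubChoice_isSubZmodule of Theta_le1 by <:].

End PermGroups.

Definition generated_by (R : pzRingType) (V : lmodType R) (r : nat) : Prop :=
  exists v : 'I_r -> V, forall u, exists c : 'I_r -> R, u = \sum_i c i *: v i.

Definition finitely_generated (R : pzRingType) (V : lmodType R) : Prop :=
  exists r, generated_by V r.

Definition Gen (P : perm_group) (m : nat) : Prop :=
  finitely_generated (loc m (Theta_le1 P) : lmodType (loc m int)).

(* Stated by hand because 1 <> 0 is not assumed in R.                         *)
Definition is_unit (R : pzRingType) (a : R) : Prop :=
  exists b, a * b = 1 /\ b * a = 1.

Definition least_prime_not_dividing (m p : nat) : Prop :=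
  [/\ prime p, ~~ (p %| m)%N &
    forall q, prime q -> ~~ (q %| m)%N -> (p <= q)%N].

(* Main.v *)
From HB Require Import structures.
From mathcomp Require Import all_fingroup cyclic pgroup sylow.
From mathcomp Require Import all_boot all_order all_algebra all_field zify ring.
From mathcomp Require Import boolp classical_sets cardinality.
Require Import Defs.

(* For a prime q not dividing m, Ind m makes the cyclic group of order q act  *)
(* freely on the orbits in the off-diagonal part of the q-fold fiber power of *)
(* f : Y -> X.  The class D(f) of the quotient of this part satisfies         *)
(* [f]^q = [f] + q D(f), and D is compatible with the relations of Theta, so  *)
(* it extends to a delta-structure: Theta has no q-torsion and x^q = x mod q. *)
(* For f basic, D(f) is in the span of the products of q basic classes;       *)
(* hence, by Nakayama, Gen m makes Theta[1/m] a finite Z[1/m]-module.  It is  *)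
(* reduced and splits into orders of number fields in which all primes not    *)
(* dividing m are totally split.  An elementary count of elements of small    *)
(* height shows that only the field Q is possible, whence (a).                *)
(* If Y is transitive then D(f) is a multiple of [f], so the coordinates a of *)
(* [f] satisfy a^q = a mod q a for all such q: this is (b).  For (c), modulo  *)
(* p the n coordinates are determined by their values on r generators, as     *)
(* these generate all products of basic classes, and they are distinct.       *)

Set Implicit Arguments.
Unset Strict Implicit.
Unset Printing Implicit Defensive.

Import Order.TTheory GRing.Theory Num.Theory.
Local Open Scope quotient_scope.
Local Open Scope ring_scope.

(** The engine is a Frobenius lift at each prime q not dividing m. The q-fold fiber power of f : Y
    -> X consists of the diagonal, a copy of Y, and of the non-constant sequences, on which rotation
    acts. If some g in G turned such a sequence into a proper rotation of itself, g would preserve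
    the finite fixed set B of the stabilizer of the sequence, and multiplication by g would permute
    G[B] / G(B) freely with order q, against Ind(m) ([rotation_free]). So rotation is free on
    orbits, the non-constant part is q copies of a transversal, and [f]^q = [f] + q D(f)
    ([theta_class_pow]). D vanishes on isomorphisms, is stable under base change, is additive up to
    the Witt polynomial ([class_on_union_delta]) and obeys a product rule on composites
    ([class_on_comp_delta]). Hence it descends to all of Theta ([term_delta_cong]), so that x^q = x
    mod q for every x and there is no q-torsion.

    Theta is spanned by products of basic classes, and for a basic class b the element D(b) is a
    combination of products of at most q of them ([basic_frobenius]). With r generators, a product
    of more than r (q - 1) of them contains a q-th power and drops in degree modulo q. Nakayama
    yields an integer e multiplying each large degree into the preceding one; reduction modulo e
    then makes the degree filtration stationary ([prod_span_stable]), and Theta[1/m] is a finite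
    Z[1/m]-module.

    Such a ring is reduced and is cut into pieces by primitive idempotents. If an irreducible monic
    g kills a nonzero element z, in the sense that g(x) z = 0, then the congruences force g to
    divide T^q - T modulo almost every prime q ([irreducible_annihilator_linear]). Degree n >= 2 is
    excluded by counting ([totally_split_size]). Such a g has, modulo any Q prime to some M', two
    roots r and s with r - s a unit. Each pair (a, b) with ab about X admits a short u with a | u(r)
    and b | u(s); the norm of u is O(X), so the cofactors of a and b in gcd(u(r), Q) and gcd(u(s),
    Q) are bounded, and u together with them determines (a, b). But there are O(X) vectors u and
    more than O(X) pairs. So x acts on each piece by a scalar, which is (a).

    For (b), when Y is transitive the first entry of a sequence exhibits D(f) as a multiple of [f]
    ([transitive_frobenius]), so a nonzero coordinate a satisfies a^(q-1) = 1 + q z and is divisible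
    by no prime outside m. For (c), two coordinates that agree modulo p on the r generators agree
    modulo p everywhere, which the idempotents forbid ([card_bound]). *)

Local Notation pZtoQ := (map_poly (intr : int -> rat)).

(** * Primes that are not totally split *)

Lemma horner_taylor2 (g : {poly int}) (r h : int) :
  exists k, g.[r + h] = g.[r] + g^`().[r] * h + h ^+ 2 * k.
Proof.
elim/poly_ind: g => [|p c [k IH]].
  by exists 0; rewrite deriv0 !horner0; ring.
exists (k * (r + h) + p^`().[r]).
by rewrite !derivE !hornerE /= IH; ring.
Qed.

Lemma horner_cong (g : {poly int}) (d r s : int) :
  (d %| r - s)%Z -> (d %| g.[r] - g.[s])%Z.
Proof.
have [k] := horner_taylor2 g s (r - s); rewrite addrC subrK => ->.
move=> /dvdzP[l ->]; apply/dvdzP.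
by exists (g^`().[s] * l + l ^+ 2 * d * k); ring.
Qed.

Lemma int_bezout (g h : {poly int}) :
  coprimep (pZtoQ g) (pZtoQ h) ->
  exists N a b, [/\ N != 0 & a * g + b * h = N%:P].
Proof.
case/Bezout_eq1_coprimepP=> -[u v] /= e.
have [a [A A0 ua]] := rat_poly_scale u; have [b [B B0 vb]] := rat_poly_scale v.
exists (A * B), (B *: a), (A *: b); split; first by rewrite mulf_neq0.
have AQ : A%:~R != 0 :> rat by rewrite intr_eq0.
have BQ : B%:~R != 0 :> rat by rewrite intr_eq0.
have {}ua : pZtoQ a = A%:~R *: u by rewrite ua scalerA mulfV // scale1r.
have {}vb : pZtoQ b = B%:~R *: v by rewrite vb scalerA mulfV // scale1r.
apply: (map_inj_poly (@intr_inj rat) (mulr0z 1)).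
rewrite rmorphD !rmorphM /= !map_polyZ /= map_polyC /= ua vb !scalerA.
by rewrite -!scalerAl [_ * A%:~R]mulrC -scalerDr e alg_polyC map_polyC polyCM.
Qed.

(** Since T^q - T is the product of the T - x over F_q, a divisor of degree at least 2 is a product
    of at least two distinct linear factors. *)
Lemma two_roots_mod_prime (g : {poly int}) (q : nat) :
  prime q -> g \is monic -> (2 < size g)%N ->
  map_poly (intr : int -> 'F_q) g %| 'X^q - 'X ->
  exists r s : int,
    [/\ (q %| g.[r])%Z, (q %| g.[s])%Z & ~~ (q %| r - s)%Z].
Proof.
move=> pq gm sg; set gq := map_poly _ g.
have cq : q \in [pchar 'F_q] by apply: pchar_Fp.
have rootE (x : 'F_q) : root gq x -> (q %| g.[(val x)%:Z])%Z.
  move=> /rootP e; rewrite (dvdz_pcharf cq) /=.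
  by rewrite -horner_map /= -/gq -pmulrn natr_Zp e.
have -> : 'X^q - 'X = 'X^#|'F_q| - 'X :> {poly 'F_q} by rewrite card_Fp.
rewrite finField_genPoly => /dvdp_prod_XsubC[mk].
set s := mask _ _ => e.
have us : uniq s by apply: mask_uniq; apply: index_enum_uniq.
have : size gq = (size s).+1.
  by rewrite (eqp_size e) size_prod_XsubC.
rewrite size_map_poly_id0; last by rewrite (monicP gm) rmorph1 oner_neq0.
move=> ss.
have rs x : x \in s -> root gq x.
  by move=> xs; rewrite (eqp_root e) root_prod_XsubC.
move: ss us rs; case: s {e} => [|x [|y s]] //= ss; try by move: sg; rewrite ss.
rewrite inE negb_or => /andP[/andP[xy _] _] rs.
exists (val x)%:Z, (val y)%:Z; split.
- by apply/rootE/rs; rewrite inE eqxx.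
- by apply/rootE/rs; rewrite !inE eqxx orbT.
by rewrite (dvdz_pcharf cq) intrB -!pmulrn !natr_Zp subr_eq0.
Qed.

Lemma root_lift_CRT (g : {poly int}) (a b : nat) (r s : int) :
  coprime a b -> (a %| g.[r])%Z -> (b %| g.[s])%Z ->
  exists t, [/\ (a * b)%N %| g.[t], a %| t - r & b %| t - s]%Z.
Proof.
move=> cab ar bs; have cz : coprimez a b by [].
have ta : (a %| zchinese a b r s - r)%Z.
  by rewrite -eqz_mod_dvd; apply/eqP/zchinese_modl.
have tb : (b %| zchinese a b r s - s)%Z.
  by rewrite -eqz_mod_dvd; apply/eqP/zchinese_modr.
exists (zchinese a b r s); split=> //.
rewrite PoszM Gauss_dvdz //; apply/andP; split.
  by rewrite -(subrK g.[r] g.[_]) rpredD // horner_cong.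
by rewrite -(subrK g.[s] g.[_]) rpredD // horner_cong.
Qed.

(** One Newton step: with u inverse to g'(r) modulo b, replacing r by r - u g(r) leaves an error
    divisible by b^2, hence by ab since a divides b. *)
Lemma root_lift_Newton (g : {poly int}) (a b : nat) (r : int) :
  (a %| b)%N -> (b %| g.[r])%Z -> coprimez g^`().[r] b ->
  exists2 t, ((a * b)%N %| g.[t])%Z & (b %| t - r)%Z.
Proof.
move=> ab /dvdzP[c gr] /coprimezP[[u v] /= uv].
have [k] := horner_taylor2 g r (- (c * b * u)); rewrite gr => e.
exists (r - c * b * u); last by apply/dvdzP; exists (- (c * u)); ring.
have {ab} : (a%:Z %| b%:Z)%Z by [].
case/dvdzP=> d bd; apply/dvdzP.
exists (c * v * d + c ^+ 2 * u ^+ 2 * k * d); rewrite PoszM e.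
have -> : c * b + g^`().[r] * (- (c * b * u)) = c * b * (1 - u * g^`().[r]) by ring.
by rewrite -uv addrAC subrr add0r bd; ring.
Qed.

(** At a root r of g modulo a the Bezout identity reads v(r) g'(r) = D, so g'(r) is a unit modulo a
    and a Newton step applies when q divides a. Otherwise the roots modulo q and modulo a are glued
    by the Chinese remainder theorem. *)
Lemma root_lift (g : {poly int}) (D q a : nat) (u v : {poly int}) (r s : int) :
  u * g + v * g^`() = D%:Z%:P -> coprime D a -> prime q -> (0 < a)%N ->
  (q %| g.[s])%Z -> (a %| g.[r])%Z ->
  exists t, [/\ ((q * a)%N %| g.[t])%Z, (a %| t - r)%Z
    & ~~ (q %| a)%N -> (q %| t - s)%Z].
Proof.
move=> e cD pq a0 qs ar; have [qa|qa] := boolP (q %| a)%N.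
  have [|t t1 t2] := root_lift_Newton qa ar; last by exists t.
  rewrite /coprimez; have /(congr1 (fun p => p.[r])) := e.
  rewrite !hornerE => er; rewrite -/(coprimez _ _).
  have : coprimez D a by [].
  rewrite -er => /coprimezP[[x y] /= xy]; apply/coprimezP.
  case/dvdzP: ar => c gr; rewrite gr in xy.
  by exists (x * v.[r], y + x * u.[r] * c); rewrite /= -xy; ring.
have cqa : coprime q a by rewrite prime_coprime.
by have [t [t1 t2 t3]] := root_lift_CRT cqa qs ar; exists t.
Qed.

(** Q is built up one prime factor at a time by [root_lift]. The bad primes are those of M and those
    of D, a nonzero integer in the ideal (g, g'), which exists because g is separable over Q. *)
Lemma two_roots_mod (g : {poly int}) (M : nat) :
  g \is monic -> irreducible_poly (pZtoQ g) -> (2 < size g)%N -> (0 < M)%N ->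
  (forall q, prime q -> ~~ (q %| M)%N ->
     map_poly (intr : int -> 'F_q) g %| 'X^q - 'X) ->
  exists2 M', (0 < M')%N & forall Q, (0 < Q)%N -> coprime Q M' ->
    exists r s : int, [/\ (Q %| g.[r])%Z, (Q %| g.[s])%Z & coprimez (r - s) Q].
Proof.
move=> gm gi sg M0 split.
have szZ (h : {poly int}) : size (pZtoQ h) = size h.
  by rewrite size_map_inj_poly //; apply: intr_inj.
have cg : coprimep (pZtoQ g) (pZtoQ g^`()).
  rewrite irreducible_poly_coprime //; apply/negP => /dvdp_leq.
  have g'0 : pZtoQ g^`() != 0.
    rewrite -size_poly_gt0 szZ lt0n; apply/eqP => /eqP; rewrite size_poly_eq0.
    move/eqP/polyP/(_ (size g).-2); rewrite coef_deriv coef0.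
    have -> : (size g).-2.+1 = (size g).-1 by lia.
    by move: (monicP gm); rewrite lead_coefE => -> /eqP; rewrite pnatr_eq0; lia.
  by move=> /(_ g'0); rewrite !szZ leqNgt lt_size_deriv // -size_poly_gt0; lia.
have [N [u [v [N0 e]]]] := int_bezout cg.
have [D [D0 [u' [v' e']]]] : exists D, (0 < D)%N /\ exists u v, u * g + v * g^`() = D%:Z%:P.
  exists `|N|%N; split; first by rewrite absz_gt0.
  exists ((Num.sg N)%:P * u), ((Num.sg N)%:P * v).
  by rewrite -!mulrA -mulrDr e -polyCM abszE -normrEsg.
exists (M * D)%N => [|Q]; first by rewrite muln_gt0 M0.
have [n] := ubnP Q; elim: n Q => // n IH Q; rewrite ltnS => Qn Q0 cQ.
case: (leqP Q 1) => [Q1|Q1].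
  have -> : Q = 1%N by lia.
  by exists 0, 0; rewrite !dvd1z /coprimez gcdz1.
set q := pdiv Q; have pq : prime q by apply: pdiv_prime.
have /dvdnP[Q' QE] : (q %| Q)%N by apply: pdiv_dvd.
have q1 := prime_gt1 pq.
move: cQ; rewrite QE coprimeMl => /andP[cQ' cq].
have Q'0 : (0 < Q')%N by lia.
have [r [s [gr gs crs]]] : exists r s : int,
    [/\ (Q' %| g.[r])%Z, (Q' %| g.[s])%Z & coprimez (r - s) Q'].
  by apply: IH => //; nia.
have qM : ~~ (q %| M)%N.
  by rewrite -prime_coprime //; move: cq; rewrite coprimeMr => /andP[].
have cD : coprime D Q'.
  by rewrite coprime_sym; move: cQ'; rewrite coprimeMr => /andP[].
have [x [y [gx gy xy]]] := two_roots_mod_prime pq gm sg (split q pq qM).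
have [r' [r1 r2 r3]] := root_lift e' cD pq Q'0 gx gr.
have [s' [s1 s2 s3]] := root_lift e' cD pq Q'0 gy gs.
exists r', s'; rewrite mulnC; split=> //.
have cQr : coprimez (r' - s') Q'.
  case/coprimezP: crs => -[a b] /= ab; apply/coprimezP.
  case/dvdzP: r2 => c1 e1; case/dvdzP: s2 => c2 e2.
  exists (a, b + a * (c2 - c1)) => /=; rewrite -ab.
  have -> : r' = r + c1 * Q' by rewrite -e1; ring.
  have -> : s' = s + c2 * Q' by rewrite -e2; ring.
  by ring.
rewrite PoszM coprimezMr cQr andbT.
(* If q divides Q', being prime to Q' already means being prime to q. Otherwise r' and s' lift the
   roots x and y, which are distinct modulo q. *)
have [qQ|qQ] := boolP (q %| Q')%N.
  by move: cQr; rewrite /coprimez; case/dvdnP: qQ => d ->; rewrite PoszM -/(coprimez _ _) coprimezMr => /andP[].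
rewrite coprimez_sym /coprimez.
have : coprime q `|r' - s'|%N.
  rewrite prime_coprime //; apply: contra xy => h.
  have {}h : (q %| r' - s')%Z by [].
  have -> : x - y = (r' - s') - (r' - x) + (s' - y) by ring.
  by apply: rpredD; [apply: rpredB; [|exact: r3]|exact: s3].
by [].
Qed.

Lemma det_bound n (A : 'M[int]_n) (b : int) :
  (forall i j, `|A i j| <= b) -> `|\det A| <= n`!%:Z * b ^+ n.
Proof.
move=> h; rewrite (le_trans (ler_norm_sum _ _ _)) //.
rewrite (@le_trans _ _ (\sum_(s : 'S_n) b ^+ n)) //; last first.
  by rewrite sumr_const (eq_card (B := 'S_n)) ?card_Sn // -mulr_natl natz.
apply: ler_sum => s _; rewrite normrM normrX normrN1 expr1n mul1r normr_prod.
rewrite -[n in _ ^+ n]card_ord -prodr_const; apply: ler_prod => i _.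
by rewrite normr_ge0 h.
Qed.

(* Two column vectors killed modulo a and b contribute independent factors to *)
(* the determinant as soon as they start with (1, r) and (1, s), r - s a unit. *)
Lemma dvd_det_two_cols k (A : 'M[int]_(2 + k)) (W : 'M[int]_(2 + k, 2))
    (a b r s : int) :
  usubmx W = \matrix_(i, j) (if j == 0 then r else s) ^+ i ->
  (forall i, (a %| (A *m W) i 0%R)%Z) -> (forall i, (b %| (A *m W) i 1%R)%Z) ->
  (a * b %| \det A * (s - r))%Z.
Proof.
move=> WE ha hb; pose E : 'M[int]_(2 + k, k) := col_mx 0 1%:M.
pose d : 'rV[int]_2 := \row_j (if j == 0 then a else b).
pose X : 'M[int]_(2 + k, 2) :=
  \matrix_(i, j) ((A *m W) i j %/ d 0%R j)%Z.
have XE : A *m W = X *m diag_mx d.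
  apply/matrixP=> i j; rewrite mul_mx_diag [RHS]mxE [X _ _]mxE [d _ _]mxE.
  case: eqP => [-> |j0]; first by rewrite divzK.
  suff -> : j = 1 by rewrite divzK.
  by apply/val_inj; case: j j0 => -[|[|]] //= ?; case; apply/val_inj.
(* Completing W by the last k unit vectors gives a matrix of determinant s - r, and the first two
   columns of its product with A are multiples of a and b. *)
have e : A *m row_mx W E = row_mx X (A *m E) *m block_mx (diag_mx d) 0 0 1%:M.
  by rewrite mul_mx_row mul_row_block !mulmx0 mulmx1 addr0 add0r XE.
have dB : \det (row_mx W E) = s - r.
  rewrite -[W]vsubmxK -block_mxEh det_lblock det1 mulr1 WE.
  rewrite (expand_det_row _ 0) !big_ord_recl big_ord0 /cofactor !det_mx11 !mxE /=.
  rewrite /bump /= !addn0 !add0n; ring.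
have := congr1 determinant e; rewrite !det_mulmx dB => ->.
rewrite det_ublock det1 mulr1 det_diag !big_ord_recl big_ord0 !mxE mulr1 /=.
by rewrite dvdz_mull.
Qed.

(** * Norms from Z[T] / (g) *)

Section MulMatrix.
Variables (g : {poly int}) (k : nat).
Hypotheses (gm : g \is monic) (sg : size g = k.+3) (gi : irreducible_poly (pZtoQ g)).
Local Notation n := (2 + k)%N.

(* multiplication by u on Z[T] / (g) *)
Definition mul_mod (u : 'rV[int]_n) : 'M[int]_n :=
  \matrix_i poly_rV (Pdiv.Ring.rmodp ('X^i * rVpoly u) g).

Lemma mul_modE u i j :
  mul_mod u i j = (Pdiv.Ring.rmodp ('X^i * rVpoly u) g)`_j.
Proof. by rewrite !mxE. Qed.

Lemma size_rmodp_g p : (size (Pdiv.Ring.rmodp p g) <= n)%N.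
Proof.
by have := Pdiv.Ring.ltn_rmodpN0 p (monic_neq0 gm); rewrite sg.
Qed.

(** Evaluation at r is a ring morphism from Z[T] / (g) to Z / d, so the vector of the r^j is an
    eigenvector modulo d with eigenvalue u(r). *)
Lemma mul_mod_root u (d r : int) (i : 'I_n) : (d %| g.[r])%Z ->
  (d %| \sum_j mul_mod u i j * r ^+ j - r ^+ i * (rVpoly u).[r])%Z.
Proof.
move=> /dvdzP[c gr]; apply/dvdzP.
have := Pdiv.RingMonic.rdivp_eq gm ('X^i * rVpoly u).
move=> /(congr1 (fun p => p.[r])); rewrite !hornerE gr.
rewrite (horner_coef_wide _ (size_rmodp_g _)) => ->.
exists (- ((Pdiv.Ring.rdivp ('X^i * rVpoly u) g).[r] * c)).
rewrite (eq_bigr (fun j : 'I_n => (Pdiv.Ring.rmodp ('X^i * rVpoly u) g)`_j * r ^+ j)); first by ring.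
by move=> j _; rewrite mul_modE.
Qed.

(** The eigenvectors at r and s have eigenvalues divisible by a and by b; [dvd_det_two_cols]
    combines them, and the extra factor s - r is prime to d, hence to ab. *)
Lemma dvd_det_mul_mod u (d a b r s : int) :
  (d %| g.[r])%Z -> (d %| g.[s])%Z -> coprimez (r - s) d ->
  (a %| d)%Z -> (b %| d)%Z -> (a %| (rVpoly u).[r])%Z -> (b %| (rVpoly u).[s])%Z ->
  (a * b %| \det (mul_mod u))%Z.
Proof.
move=> dr ds crs ad bd au bu.
pose W : 'M[int]_(n, 2) := \matrix_(i, j) (if j == 0 then r else s) ^+ i.
have key (e t : int) i : (e %| d)%Z -> (d %| g.[t])%Z -> (e %| (rVpoly u).[t])%Z ->
    (e %| \sum_j mul_mod u i j * t ^+ j)%Z.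
  move=> ed dt eu; rewrite -(subrK (t ^+ i * (rVpoly u).[t]) (\sum_j _)).
  by rewrite rpredD ?dvdz_mull // (dvdz_trans ed) // mul_mod_root.
have : (a * b %| \det (mul_mod u) * (s - r))%Z.
  apply: (@dvd_det_two_cols _ _ W).
  - by apply/matrixP=> i j; rewrite !mxE.
  - move=> i; rewrite mxE (eq_bigr (fun j => mul_mod u i j * r ^+ j)) ?key //.
    by move=> j _; rewrite [W _ _]mxE.
  - move=> i; rewrite mxE (eq_bigr (fun j => mul_mod u i j * s ^+ j)) ?key //.
    by move=> j _; rewrite [W _ _]mxE.
have cpr e : (e %| d)%Z -> coprimez e (s - r).
  move=> ed; apply: (coprimez_dvdl ed).
  by rewrite -coprimezN opprB coprimez_sym.
by rewrite Gauss_dvdzl // coprimezMl !cpr.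
Qed.

(** A left kernel vector v over Q would make g divide v u, hence v or u, both nonzero of degree
    smaller than that of g. *)
Lemma det_mul_mod_neq0 u : u != 0 -> \det (mul_mod u) != 0.
Proof.
move=> u0; rewrite -(intr_eq0 rat) -det_map_mx; apply/det0P => -[v v0 vM].
have szZ (h : {poly int}) : size (pZtoQ h) = size h.
  by rewrite size_map_inj_poly //; apply: intr_inj.
have : pZtoQ g %| rVpoly v * pZtoQ (rVpoly u).
  apply/dvdpP; exists (\sum_i v 0 i *: pZtoQ (Pdiv.Ring.rdivp ('X^i * rVpoly u) g)).
  rewrite mulr_suml.
  have -> : rVpoly v = \sum_(i < n) v 0 i *: 'X^i.
    rewrite /rVpoly poly_def; apply: eq_bigr => i _.
    by rewrite insubT // => ?; congr (v 0 _ *: _); apply/val_inj.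
  have : \sum_i v 0 i *: pZtoQ (Pdiv.Ring.rmodp ('X^i * rVpoly u) g) = 0.
    apply/polyP => j; rewrite coef_sum coef0.
    case: (ltnP j n) => jn; last first.
      rewrite big1 // => i _; rewrite coefZ coef_map nth_default ?mulr0 //.
      exact: leq_trans (size_rmodp_g _) _.
    have /matrixP/(_ 0 (Ordinal jn)) := vM; rewrite !mxE => vj.
    rewrite -[RHS]vj; apply: eq_bigr => i _.
    by rewrite coefZ coef_map [map_mx _ _ _ _]mxE mul_modE.
  move=> e; rewrite mulr_suml -[RHS]addr0 -[X in _ = _ + X]e -big_split ; apply: eq_bigr => i _ /=.
  rewrite -!scalerAl -scalerDr -rmorphM -rmorphD /= -Pdiv.RingMonic.rdivp_eq //.
  by rewrite rmorphM /= map_polyXn.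
have rV0 (F : nzRingType) (w : 'rV[F]_n) : w != 0 -> rVpoly w != 0.
  by apply: contra => /eqP e; rewrite -[w]rVpolyK e linear0.
have [h|h] := boolP (pZtoQ g %| rVpoly v).
  move: (dvdp_leq (rV0 _ _ v0) h) => + _; rewrite szZ sg.
  have : (size (rVpoly v) <= n)%N := size_poly _ _.
  by move=> h1 /leq_trans/(_ h1); rewrite ltnn.
rewrite Gauss_dvdpr; last by rewrite irreducible_poly_coprime.
have u0' : pZtoQ (rVpoly u) != 0 by rewrite -size_poly_gt0 szZ size_poly_gt0 rV0.
move/dvdp_leq => /(_ u0'); rewrite !szZ sg.
have : (size (rVpoly u) <= n)%N := size_poly _ _.
by move=> h1 /leq_trans/(_ h1); rewrite ltnn.
Qed.

(** The entries of [mul_mod u] are linear in u, with coefficients depending only on g, so the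
    determinant is homogeneous of degree n. *)
Lemma det_mul_mod_bound : exists C : nat, forall (u : 'rV[int]_n) (H : nat),
  (forall i, `|u 0 i| <= H%:Z) -> (`|\det (mul_mod u)| <= C * H ^ n)%N.
Proof.
pose c (i j l : 'I_n) := (Pdiv.Ring.rmodp ('X^i * 'X^l) g)`_j.
pose K : int := \sum_i \sum_j \sum_l `|c i j l|.
have K0 : 0 <= K by do 3! apply: sumr_ge0 => ? _.
exists (n`! * `|K| ^ n)%N => u H uH.
suff h i j : `|mul_mod u i j| <= H%:Z * K.
  have := det_bound h; rewrite -(gez0_abs K0) -![_%:Z]natz -!natrM -!natrX -!natrM.
  by rewrite natz -abszE lez_nat natz expnMn [(H ^ _ * _)%N]mulnC mulnA.
have -> : mul_mod u i j = \sum_l u 0 l * c i j l.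
  rewrite mul_modE.
  have -> : rVpoly u = \sum_(i < n) u 0 i *: 'X^i.
    rewrite /rVpoly poly_def; apply: eq_bigr => l _.
    by rewrite insubT // => ?; congr (u 0 _ *: _); apply/val_inj.
  rewrite mulr_sumr Pdiv.RingMonic.rmodp_sum // coef_sum; apply: eq_bigr => l _.
  by rewrite -scalerAr Pdiv.RingMonic.rmodpZ // coefZ.
rewrite (le_trans (ler_norm_sum _ _ _)) //.
apply: (@le_trans _ _ (\sum_l H%:Z * `|c i j l|)).
  by apply: ler_sum => l _; rewrite normrM ler_wpM2r.
rewrite -mulr_sumr ler_wpM2l // /K [leRHS](bigD1 i) //=.
rewrite [X in _ <= X + _](bigD1 j) //= -addrA lerDl.
by apply: addr_ge0; do ?[apply: sumr_ge0 => ? _].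
Qed.

End MulMatrix.

(** Each dyadic block of 2^k terms contributes at least 1 / (4 M), its terms being at least 1 / (4 M
    2^k). *)
Lemma harmonic_unbounded (M k : nat) : (0 < M)%N ->
  k%:R / (4 * M)%:R <= \sum_(i < 2 ^ k) (1 + M * i)%:R^-1 :> rat.
Proof.
move=> M0; elim: k => [|k IH]; first by rewrite mul0r sumr_ge0 // => i _; rewrite invr_ge0.
rewrite expnS mul2n -addnn big_split_ord /= -natr1 mulrDl lerD //.
apply: (@le_trans _ _ (\sum_(i < 2 ^ k) (4 * M * 2 ^ k)%:R^-1)).
  have e : (4 * M * 2 ^ k)%:R^-1 = (4 * M)%:R^-1 * (2 ^ k)%:R^-1 :> rat.
    by rewrite [(_ * 2 ^ k)%:R]natrM invfM.
  rewrite sumr_const card_ord e -[leRHS]mulr_natr -mulrA mulVf ?mulr1 ?mul1r //.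
  by rewrite pnatr_eq0 expn_eq0.
apply: ler_sum => i _; rewrite lef_pV2 ?posrE ?ltr0n ?muln_gt0 ?expn_gt0 ?M0 //.
rewrite ler_nat; have := ltn_ord i; nia.
Qed.

(** Divergence with denominators cleared. The right-hand side will be the number of pairs (a, b),
    with a = 1 + M i and L / a choices of b, where L is the product. *)
Lemma harmonic_prod (M B : nat) : (0 < M)%N -> exists J,
  (B * \prod_(i < J) (1 + M * i) <
     \sum_(i < J) (\prod_(j < J) (1 + M * j)) %/ (1 + M * i))%N.
Proof.
move=> M0; exists (2 ^ (4 * M * B.+1))%N; set J := (2 ^ _)%N; set L := (\prod_(i < _) _)%N.
have L0 : (0 < L)%N by apply: prodn_gt0.
have h := @harmonic_unbounded M (4 * M * B.+1) M0.
rewrite -(ltr_nat rat) natr_sum.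
have -> : \sum_(i < J) (L %/ (1 + M * i))%:R = L%:R * \sum_(i < J) (1 + M * i)%:R^-1 :> rat.
  rewrite mulr_sumr; apply: eq_bigr => i _.
  by rewrite natf_div // /L (bigD1 i) //= dvdn_mulr.
rewrite natrM mulrC ltr_pM2l ?ltr0n //; apply: lt_le_trans h.
by rewrite natrM mulrAC mulfV ?mul1r ?ltr_nat // pnatr_eq0; lia.
Qed.

(** Pigeonhole: the H^n vectors with entries in [0, H) have fewer than H^n residues (u(r) mod a,
    u(s) mod b), and the difference of two vectors with the same residues is the short vector. *)
Lemma short_vector (n a b H : nat) (r s : int) :
  (0 < a)%N -> (0 < b)%N -> (a * b < H ^ n)%N ->
  exists u : 'rV[int]_n, [/\ u != 0, forall i, `|u 0 i| < H%:Z,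
    (a %| (rVpoly u).[r])%Z & (b %| (rVpoly u).[s])%Z].
Proof.
move=> a0 b0 abH.
have res (d : nat) (z : int) : (0 < d)%N -> (`|(z %% d)%Z| < d)%N.
  by move=> d0; rewrite -ltz_nat gez0_abs ?ltz_pmod // modz_ge0 // -lt0n.
pose v (w : {ffun 'I_n -> 'I_H}) : 'rV[int]_n := \row_i (w i)%:Z.
pose f w : 'I_a * 'I_b := (Ordinal (res a (rVpoly (v w)).[r] a0),
                           Ordinal (res b (rVpoly (v w)).[s] b0)).
have [fi|] := boolP (injectiveb f).
  have := leq_card _ (injectiveP _ fi).
  by rewrite card_prod card_ffun !card_ord leqNgt abH.
case/injectivePn=> w [w' ww' [e1 e2]].
have dv (d : nat) z z' : (0 < d)%N -> `|(z %% d)%Z|%N = `|(z' %% d)%Z|%N -> (d %| z - z')%Z.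
  move=> d0 e; rewrite -eqz_mod_dvd; apply/eqP.
  have h t : (t %% d)%Z = `|(t %% d)%Z|%N by rewrite gez0_abs // modz_ge0 // -lt0n.
  by rewrite h e -h.
exists (v w - v w'); split.
- rewrite subr_eq0; apply: contra ww' => /eqP/rowP e; apply/eqP/ffunP => i.
  by move: (e i); rewrite !mxE => -[] /val_inj.
- move=> i; rewrite !mxE; have := ltn_ord (w i); have := ltn_ord (w' i).
  by move: (nat_of_ord (w i)) (nat_of_ord (w' i)) => x y; lia.
- by rewrite raddfB /= hornerD hornerN dv.
- by rewrite raddfB /= hornerD hornerN dv.
Qed.

Lemma root_approx (n X : nat) : (0 < n)%N -> (0 < X)%N ->
  exists H, (X < H ^ n <= 2 ^ n * X)%N.
Proof.
move=> n0 X0; have ex : exists H, (X < H ^ n)%N.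
  exists X.+1; apply: leq_trans (ltnSn X) _.
  by rewrite -(prednK n0) expnS leq_pmulr // expn_gt0.
case: (ex_minnP ex) => -[|[|H]] h hm.
- by move: h; rewrite exp0n.
- by move: h; rewrite exp1n; lia.
exists H.+2; rewrite h /=; apply: (@leq_trans ((2 * H.+1) ^ n)%N).
  by rewrite leq_exp2r //; lia.
rewrite expnMn leq_mul2l; apply/orP; right; rewrite leqNgt; apply/negP => /hm.
by rewrite ltnn.
Qed.

(** The range of b is chosen so that every product ab lies within a factor 2 of X = 2 M L. *)
Lemma pair_size (M L c l t : nat) :
  (0 < c)%N -> (0 < M)%N -> (t < l)%N -> (c * l = L)%N ->
  (c * (1 + M * (l + t)) <= 2 * M * L < 2 * (c * (1 + M * (l + t))))%N.
Proof.
move=> c0 M0 tl <-; have h1 : (c * t + c <= c * l)%N.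
  by rewrite addnC -mulnS leq_mul2l tl orbT.
have h2 : (M * (c * t + c) <= M * (c * l))%N by rewrite leq_mul2l h1 orbT.
have h3 : (c <= M * c)%N by rewrite leq_pmull.
have -> : (c * (1 + M * (l + t)) = c + M * (c * l) + M * (c * t))%N by ring.
have -> : (2 * M * (c * l) = 2 * (M * (c * l)))%N by ring.
rewrite mulnDr in h2; lia.
Qed.

(* A degree n >= 2 number field has infinitely many primes that are not       *)
(* totally split: otherwise every coprime-to-M product a b of size about X    *)
(* would divide, through two different places, the norm of an element of      *)
(* height X^(1/n), and there are only O(X) such elements but more than O(X)   *)
(* pairs (a, b).                                                              *)
Theorem totally_split_size (g : {poly int}) (M : nat) :
  g \is monic -> irreducible_poly (pZtoQ g) -> (0 < M)%N ->
  (forall q, prime q -> ~~ (q %| M)%N ->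
     map_poly (intr : int -> 'F_q) g %| 'X^q - 'X) ->
  (size g <= 2)%N.
Proof.
move=> gm gi M0 split; rewrite leqNgt; apply/negP => sg.
have [M' M'0 roots] := two_roots_mod gm gi sg M0 split.
have [k sgk] : exists k, size g = k.+3 by exists (size g - 3)%N; lia.
pose n := (2 + k)%N.
have [C bound] := det_mul_mod_bound k gm.
pose C1 := (2 ^ n.+1 * C)%N.
(* This constant times L bounds the number of codes in [Cd], because (2 H)^n <= 4^n X and X = 2 M'
   L. *)
have [J] := harmonic_prod (4 ^ n * 2 * M' * C1.+1 ^ 2) M'0.
set L := (\prod_(i < J) _)%N => big.
pose a (i : 'I_J) := (1 + M' * i)%N; pose X := (2 * M' * L)%N.
have L0 : (0 < L)%N by apply: prodn_gt0.
have aL i : (a i * (L %/ a i) = L)%N.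
  by rewrite mulnC divnK // /L (bigD1 i) //= dvdn_mulr.
have X0 : (0 < X)%N by rewrite !muln_gt0 M'0.
have [H /andP[XH HX]] := @root_approx n X erefl X0.
(* Q is a multiple of every a and b in use, so a single pair of roots r, s modulo Q serves all
   pairs. *)
pose Q := (\prod_(c < X.+1 | (0 < c)%N && coprime c M') c)%N.
have dQ c : (0 < c)%N -> (c <= X)%N -> coprime c M' -> (c %| Q)%N.
  move=> c0 cX cM; rewrite -ltnS in cX.
  by rewrite /Q (bigD1 (Ordinal cX)) /= ?c0 // dvdn_mulr.
have Q0 : (0 < Q)%N by apply: prodn_cond_gt0 => c /andP[].
have cQ : coprime Q M'.
  apply: (big_ind (fun x => coprime x M')) => [|x y|c /andP[]] //.
    exact: coprime1n.
  by rewrite coprimeMl => -> ->.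
have [r [s [gr gs crs]]] := roots Q Q0 cQ.
pose T := {i : 'I_J & 'I_(L %/ a i)}.
pose b (p : T) := (1 + M' * (L %/ a (tag p) + tagged p))%N.
have ab p : (a (tag p) * b p <= X < 2 * (a (tag p) * b p))%N.
  by apply: pair_size; rewrite ?aL.
have cop c : coprime (1 + M' * c) M'.
  by rewrite coprime_sym /coprime addnC [(M' * c)%N]mulnC gcdnMDl gcdn1.
pose Cd := ({ffun 'I_n -> 'I_(2 * H)} * 'I_C1.+1 * 'I_C1.+1)%type.
(* A code records the coordinates of u, shifted by H to become natural numbers, and the cofactors of
   a and b in gcd(u(r), Q) and gcd(u(s), Q). *)
pose R (p : T) (c : Cd) := exists u : 'rV[int]_n,
  [/\ forall i, (c.1.1 i)%:Z = u 0 i + H%:Z,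
      gcdn `|(rVpoly u).[r]| Q = (c.1.2 * a (tag p))%N &
      gcdn `|(rVpoly u).[s]| Q = (c.2 * b p)%N].
have exR p : exists c, R p c.
  have /andP[abX Xab] := ab p.
  have b0 : (0 < b p)%N by [].
  have [u [u0 uH au bu]] := @short_vector n (a (tag p)) (b p) H r s isT b0 (leq_ltn_trans abX XH).
  have aQ : (a (tag p) %| Q)%N.
    by rewrite dQ ?cop //; apply: leq_trans abX; rewrite leq_pmulr.
  have bQ : (b p %| Q)%N.
    by rewrite dQ ?cop //; apply: leq_trans abX; rewrite leq_pmull.
  have /dvdnP[x xE] : (a (tag p) %| gcdn `|(rVpoly u).[r]| Q)%N by rewrite dvdn_gcd aQ andbT.
  have /dvdnP[y yE] : (b p %| gcdn `|(rVpoly u).[s]| Q)%N by rewrite dvdn_gcd bQ andbT.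
  have x0 : (0 < x)%N by rewrite lt0n; apply/eqP => x0; move: (gcdn_gt0 `|(rVpoly u).[r]| Q); rewrite xE x0 Q0 orbT.
  have y0 : (0 < y)%N by rewrite lt0n; apply/eqP => y0; move: (gcdn_gt0 `|(rVpoly u).[s]| Q); rewrite yE y0 Q0 orbT.
  have dd : (gcdn `|(rVpoly u).[r]| Q * gcdn `|(rVpoly u).[s]| Q %| `|\det (mul_mod g u)|)%N.
    rewrite -[X in (X %| _)%N]absz_nat -dvdzE PoszM.
    apply: (dvd_det_mul_mod gm sgk gr gs crs).
    - exact: dvdn_gcdr.
    - exact: dvdn_gcdr.
    - exact: dvdn_gcdl.
    - exact: dvdn_gcdl.
  have det0 : (0 < `|\det (mul_mod g u)|)%N by rewrite absz_gt0 det_mul_mod_neq0.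
  have uH' i : `|u 0 i| <= H%:Z by apply: ltW.
  (* The product of the two gcds divides the nonzero norm of u, of size at most C H^n <= C 2^n X,
     while 2ab exceeds X. *)
  have xyC : (x * y <= C1)%N.
    have h1 := dvdn_leq det0 dd; have h2 := bound u H uH'.
    move: h1; rewrite xE yE -/n.
    have h3 : (C * H ^ n <= C * (2 ^ n * X))%N by rewrite leq_mul2l HX orbT.
    move=> h1; have h4 := leq_trans h1 (leq_trans h2 h3).
    rewrite -(leq_pmul2r X0); apply: (@leq_trans (x * y * (2 * (a (tag p) * b p)))%N).
      by rewrite leq_mul2l (ltnW Xab) orbT.
    have -> : (x * y * (2 * (a (tag p) * b p)) = 2 * (x * a (tag p) * (y * b p)))%N by ring.
    by have -> : (C1 * X = 2 * (C * (2 ^ n * X)))%N; [rewrite /C1 expnS; ring|rewrite leq_mul2l].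
  have xC : (x < C1.+1)%N by rewrite ltnS; apply: leq_trans xyC; rewrite leq_pmulr.
  have yC : (y < C1.+1)%N by rewrite ltnS; apply: leq_trans xyC; rewrite leq_pmull.
  have uB i : (`|(u 0 i + H%:Z)%R| < 2 * H)%N by move: (uH i); move: (u 0 i) => z; clear; lia.
  exists ([ffun i => Ordinal (uB i)], Ordinal xC, Ordinal yC), u; split=> //= i.
  by rewrite ffunE /=; move: (uH i); move: (u 0 i) => z; clear; lia.
have [F FR] := fin_all_exists exR.
(* The code determines u, hence both gcds, and dividing these by the positive cofactors returns a
   and b. *)
have Finj : injective F.
  move=> p p' e; have [u [u1 u2 u3]] := FR p; have [v [v1 v2 v3]] := FR p'.
  have uv : u = v.
    by apply/rowP => i; apply: (addIr H%:Z); rewrite -u1 -v1 e.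
  rewrite -uv -e in v2 v3 => {uv v v1}.
  have x0 : (0 < (F p).1.2)%N by rewrite lt0n; apply/eqP => x0; move: (gcdn_gt0 `|(rVpoly u).[r]| Q); rewrite u2 x0 Q0 orbT.
  have y0 : (0 < (F p).2)%N by rewrite lt0n; apply/eqP => y0; move: (gcdn_gt0 `|(rVpoly u).[s]| Q); rewrite u3 y0 Q0 orbT.
  have ea : (a (tag p) = a (tag p'))%N.
    by apply/eqP; rewrite -(eqn_pmul2l x0) -u2 v2.
  have eb : b p = b p'.
    by apply/eqP; rewrite -(eqn_pmul2l y0) -u3 v3.
  move: ea eb; clear -M'0; case: p p' => [i t] [i' t'] /= ea eb.
  have ii : i = i'.
    by apply/val_inj/eqP; rewrite /= -(eqn_pmul2l M'0) -(eqn_add2l 1); apply/eqP.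
  move: t' eb ea; rewrite -ii => t' /eqP; rewrite /b /= eqn_add2l eqn_pmul2l //.
  by rewrite eqn_add2l => /eqP/val_inj ->.
have := leq_card F Finj.
rewrite card_tagged sumnE big_map big_enum /= (eq_bigr (fun i => L %/ a i)%N); last first.
  by move=> i _; rewrite card_ord.
rewrite !card_prod card_ffun !card_ord leqNgt => /negP; apply; apply: leq_trans big.
rewrite ltnS expnMn; apply: (@leq_trans (2 ^ n * (2 ^ n * X) * C1.+1 * C1.+1)%N).
  by rewrite !leq_mul2r leq_mul2l HX !orbT.
by rewrite mulnA -expnMn /X; apply: eq_leq; rewrite expnS expn1; ring.
Qed.

(** * Commutative rings with Frobenius congruences *)

Section IntegerCombinations.
Variable V : zmodType.
Implicit Types (ws zs : seq V) (c : nat -> int).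

Definition zcomb ws c : V := \sum_(i < size ws) ws`_i *~ c i.
Definition zspan ws (x : V) : Prop := exists c, x = zcomb ws c.
Definition zindep zs : Prop :=
  forall c, zcomb zs c = 0 -> forall i, (i < size zs)%N -> c i = 0.

Lemma zcomb_cons w ws c : zcomb (w :: ws) c = w *~ c 0%N + zcomb ws (c \o succn).
Proof. by rewrite /zcomb big_ord_recl. Qed.

Lemma eq_zcomb ws c c' :
  (forall i, (i < size ws)%N -> c i = c' i) -> zcomb ws c = zcomb ws c'.
Proof. by move=> e; apply: eq_bigr => i _; rewrite e. Qed.

Lemma zcombD ws c c' : zcomb ws c + zcomb ws c' = zcomb ws (fun i => c i + c' i).
Proof. by rewrite /zcomb -big_split; apply: eq_bigr => i _; rewrite mulrzDr. Qed.

Lemma zcombZ ws c (a : int) : zcomb ws c *~ a = zcomb ws (fun i => c i * a).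
Proof. by rewrite /zcomb mulrz_suml; apply: eq_bigr => i _; rewrite mulrzA. Qed.

Lemma zspan0 ws : zspan ws 0.
Proof. by exists (fun=> 0); rewrite /zcomb big1. Qed.

Lemma zspanD ws x y : zspan ws x -> zspan ws y -> zspan ws (x + y).
Proof. by move=> [c ->] [c' ->]; rewrite zcombD; eexists. Qed.

Lemma zspanZ ws x a : zspan ws x -> zspan ws (x *~ a).
Proof. by move=> [c ->]; rewrite zcombZ; eexists. Qed.

Lemma zspanMn ws x n : zspan ws x -> zspan ws (x *+ n).
Proof. by rewrite pmulrn; apply: zspanZ. Qed.

Lemma zspan_consP w ws x :
  zspan (w :: ws) x <-> exists a, zspan ws (x - w *~ a).
Proof.
split=> [[c ->]|[a [c e]]].
  by exists (c 0%N); rewrite zcomb_cons addrC addKr; eexists.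
exists (fun i => if i is j.+1 then c j else a).
by rewrite zcomb_cons -[LHS](subrK (w *~ a)) e addrC.
Qed.

Lemma zspan_mem ws w : w \in ws -> zspan ws w.
Proof.
elim: ws => // v ws IH; rewrite inE => /orP[/eqP ->|/IH h].
  by apply/zspan_consP; exists 1; rewrite subrr; apply: zspan0.
by apply/zspan_consP; exists 0; rewrite subr0.
Qed.

Lemma zspan_sub ws zs x :
  (forall w, w \in ws -> zspan zs w) -> zspan ws x -> zspan zs x.
Proof.
elim: ws x => [|w ws IH] x h.
  by move=> [c ->]; rewrite /zcomb big_ord0; apply: zspan0.
move=> /zspan_consP[a /IH] hx; rewrite -(subrK (w *~ a) x); apply: zspanD.
  by apply: hx => v vws; apply: h; rewrite inE vws orbT.
by apply/zspanZ/h; rewrite inE eqxx.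
Qed.

Lemma zspan_cat ws zs x : zspan (ws ++ zs) x ->
  exists s t, [/\ zspan ws s, zspan zs t & x = s + t].
Proof.
elim: ws x => [|w ws IH] x; first by exists 0, x; rewrite add0r; split=> //; apply: zspan0.
move=> /zspan_consP[a /IH[s [t [hs ht e]]]]; exists (s + w *~ a), t; split=> //.
  by apply/zspan_consP; exists a; rewrite addrK.
by rewrite addrAC -e subrK.
Qed.

(* In a group finitely generated by zs and ws, dividing a combination of the  *)
(* independent family zs by N can only be possible up to a bounded factor.    *)
Lemma bounded_denominator zs ws : zindep zs -> exists2 D : nat, (0 < D)%N &
  forall (y : V) b (N : int) c, zspan ws (y - zcomb zs b) ->
    y *~ N = zcomb zs c -> forall i, (i < size zs)%N -> (N %| D%:Z * c i)%Z.
Proof.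
elim: ws zs => [|w ws IH] zs zi.
  exists 1%N => // y b N c [d]; rewrite /zcomb big_ord0 => /eqP; rewrite subr_eq0.
  move=> /eqP -> e i iz; rewrite mul1r; apply/dvdzP; exists (b i).
  have z0 : zcomb zs (fun j => b j * N + c j * -1) = 0.
    by rewrite -zcombD -!zcombZ e mulrN1z subrr.
  by have /eqP := zi _ z0 i iz; rewrite mulrN1 subr_eq0 => /eqP.
have [wi|] := pselect (zindep (w :: zs)).
  have [D D0 h] := IH _ wi; exists D => // y b N c /zspan_consP[a hy] e i iz.
  pose b' j := if j is k.+1 then b k else a; pose c' j := if j is k.+1 then c k else 0.
  apply: (h y b' N c' _ _ i.+1) => //.
    by rewrite zcomb_cons opprD [- _ - _]addrC addrA.
  by rewrite zcomb_cons mulr0z add0r.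
(* Here w occurs in a relation with the independent family, necessarily with nonzero coefficient
   [c0 0]; multiplying by that coefficient eliminates w and costs one factor in D. *)
move=> /existsNP[c0 /not_implyP[/[1!zcomb_cons] c0E /existsNP[i /not_implyP[iz ci]]]].
have [D D0 h] := IH _ zi.
have c00 : c0 0%N != 0.
  apply/eqP => c00; case: i iz ci => [|i] //= iz; apply.
  by apply: (zi (c0 \o succn)) => //; move: c0E; rewrite c00 mulr0z add0r.
exists (`|c0 0%N| * D)%N => [|y b N c]; first by rewrite muln_gt0 absz_gt0 c00.
move=> /zspan_consP[a hy] e j jz.
have := h (y *~ c0 0%N) (fun i => b i * c0 0%N - c0 i.+1 * a) N (fun i => c i * c0 0%N).
move=> /(_ _ _ j jz); rewrite mulrA [_ * c0 0%N]mulrC => hD.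
have hN : (N %| c0 0%N * (D%:Z * c j))%Z.
  apply: hD; last by rewrite mulrzAC e zcombZ.
  have -> : y *~ c0 0%N - zcomb zs (fun i => b i * c0 0%N - c0 i.+1 * a) =
            (y - zcomb zs b - w *~ a) *~ c0 0%N.
    have -> : zcomb zs (fun i => b i * c0 0%N - c0 i.+1 * a) =
        zcomb zs b *~ c0 0%N - zcomb zs (c0 \o succn) *~ a.
      by rewrite -mulrNz !zcombZ zcombD; apply: eq_zcomb => k _ /=; ring.
    have -> : zcomb zs (c0 \o succn) = - (w *~ c0 0%N).
      by apply/eqP; rewrite -addr_eq0 addrC; apply/eqP.
    by rewrite mulNrz opprK opprD !mulrzBl mulrzAC addrA.
  exact: zspanZ.
by move: hN; rewrite !dvdzE PoszM -mulrA !abszM !absz_nat.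
Qed.

(** The matrix expressing zs in terms of ws would have a nonzero rational left kernel; clearing
    denominators there gives a relation between the zs. *)
Lemma zindep_size zs ws :
  zindep zs -> (forall z, z \in zs -> zspan ws z) -> (size zs <= size ws)%N.
Proof.
move=> zi zw; rewrite leqNgt; apply/negP => lt.
have /fin_all_exists[C CE] (i : 'I_(size zs)) : exists c, zs`_i = zcomb ws c.
  by apply: zw; rewrite mem_nth.
pose A : 'M[rat]_(size zs, size ws) := \matrix_(i, j) (C i j)%:~R.
have : kermx A != 0.
  by rewrite -mxrank_eq0 mxrank_ker subn_eq0 -ltnNge (leq_ltn_trans (rank_leq_col _)).
case/rowV0Pn=> v /sub_kermxP vA v0.
have [p [a a0 pE]] := rat_poly_scale (rVpoly v).
have pv (i : 'I_(size zs)) : v 0 i = a%:~R^-1 * (p`_i)%:~R.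
  by rewrite -coef_rVpoly_ord pE coefZ coef_map.
case/negP: v0; apply/eqP/rowP => i; rewrite mxE pv (zi (nth 0 p)) ?mulr0 //.
rewrite /zcomb (eq_bigr (fun i : 'I_(size zs) => \sum_(j < size ws) ws`_j *~ (C i j * p`_i))); last first.
  by move=> k _; rewrite CE /zcomb mulrz_suml; apply: eq_bigr => j _; rewrite mulrzA.
rewrite exchange_big big1 // => j _; rewrite -mulrz_sumr.
suff -> : \sum_i C i j * p`_i = 0 by rewrite mulr0z.
apply: (@intr_inj rat); rewrite rmorph_sum.
have /rowP/(_ j) := vA; rewrite !mxE => e.
apply: (mulfI (x := a%:~R^-1)); first by rewrite invr_eq0 intr_eq0.
rewrite mulr0 -[RHS]e mulr_sumr; apply: eq_bigr => k _.
by rewrite pv mxE rmorphM /= mulrCA mulrC.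
Qed.

End IntegerCombinations.

Lemma dvdn_exp_of_primes (m c : nat) : (0 < c)%N ->
  (forall q, prime q -> (q %| c)%N -> (q %| m)%N) -> exists k, (c %| m ^ k)%N.
Proof.
have [n] := ubnP c; elim: n c => // n IH c; rewrite ltnS => cn c0 h.
have [c1|c1] := leqP c 1; first by exists 0%N; rewrite dvdn1; apply/eqP; lia.
have pq := pdiv_prime c1; have /dvdnP[d cE] := pdiv_dvd c.
have q1 := prime_gt1 pq; have d0 : (0 < d)%N by lia.
have [||k dk] := IH d _ d0; first by nia.
  by move=> q qq qd; apply: h => //; rewrite cE dvdn_mulr.
by exists k.+1; rewrite cE expnSr dvdn_mul // h // pdiv_dvd.
Qed.

Lemma exists_large_prime (n : nat) : exists2 q, prime q & (n < q)%N.
Proof. by have [q] := prime_above n; exists q. Qed.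

(** * Rings with x^q = x mod q and no q-torsion for q not dividing m *)

Section BinomialLike.
Variables (R : comPzRingType) (m : nat).
Hypothesis m_gt0 : (0 < m)%N.
Hypothesis m_inv : exists u : R, u *+ m = 1.
Hypothesis tf : forall q, prime q -> ~~ (q %| m)%N -> forall x : R, x *+ q = 0 -> x = 0.
Hypothesis frob : forall q, prime q -> ~~ (q %| m)%N -> forall x : R,
  exists y, x ^+ q - x = y *+ q.

Lemma torsion_free (N : nat) (x : R) : (0 < N)%N -> x *+ N = 0 -> x = 0.
Proof.
have [n] := ubnP N; elim: n N x => // n IH N x; rewrite ltnS => Nn N0 xN.
have [N1|N1] := leqP N 1; first by move: xN; have -> : N = 1%N by lia.
have pq := pdiv_prime N1; have /dvdnP[d NE] := pdiv_dvd N.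
have q1 := prime_gt1 pq; have d0 : (0 < d)%N by lia.
apply: (IH d) => //; first by nia.
move: xN; rewrite NE mulrnA; have [qm|qm] := boolP (pdiv N %| m)%N; last exact: tf.
have [u um] := m_inv; case/dvdnP: qm => k mE xq.
by rewrite -[x *+ d]mulr1 -um mE mulnC mulrnA !mulrnAr -[_ * u *+ _]mulrnAl xq mul0r mul0rn.
Qed.

Lemma torsion_freez (N : int) (x : R) : N != 0 -> x *~ N = 0 -> x = 0.
Proof.
move=> N0 e; apply: (@torsion_free `|N|%N); first by rewrite absz_gt0.
case: N N0 e => k _ //=; rewrite NegzE mulrNz => /eqP.
by rewrite oppr_eq0 => /eqP.
Qed.

Lemma mulrzI_tf (N : int) (x y : R) : N != 0 -> x *~ N = y *~ N -> x = y.
Proof.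
by move=> N0 e; apply/eqP; rewrite -subr_eq0; apply/eqP/(torsion_freez N0); rewrite mulrzBl e subrr.
Qed.

Lemma mulmI (k : nat) (x y : R) : x *+ m ^ k = y *+ m ^ k -> x = y.
Proof.
move=> e; apply/eqP; rewrite -subr_eq0; apply/eqP/(@torsion_free (m ^ k)).
  by rewrite expn_gt0 m_gt0.
by rewrite mulrnBl e subrr.
Qed.

Section FinitelyGenerated.
Variable ws : seq R.
Hypothesis ws_gen : forall x, exists k, zspan ws (x *+ m ^ k).

Lemma bounded_denominator_gen zs : zindep zs -> exists2 D : nat, (0 < D)%N &
  forall (y : R) (N : int) c, y *~ N = zcomb zs c ->
    forall i, (i < size zs)%N -> exists l, (N %| (D * m ^ l)%N%:Z * c i)%Z.
Proof.
move=> /(bounded_denominator ws)[D D0 h]; exists D => // y N c e i iz.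
have [l hl] := ws_gen y; exists l; rewrite PoszM -mulrA.
apply: (h (y *+ m ^ l) (fun=> 0) N (fun i => (m ^ l)%N%:Z * c i)) => //.
  by rewrite [zcomb _ _]big1 ?subr0 // => j _; rewrite mulr0z.
rewrite [y *+ _]pmulrn mulrzAC e zcombZ; apply: eq_zcomb => j _; exact: mulrC.
Qed.

Lemma zindep1 (z : R) : z != 0 -> zindep [:: z].
Proof.
move=> z0 c; rewrite zcomb_cons [zcomb [::] _]big_ord0 addr0 => e [|i] // _.
by apply/eqP/negPn/negP => c0; move/eqP: z0; apply; apply: torsion_freez e.
Qed.

(** In a finite Z[1/m]-module without torsion a nonzero element is divisible, up to powers of m,
    only by divisors of a fixed integer. *)
Lemma bounded_divisor (z : R) : z != 0 -> exists2 D : nat, (0 < D)%N &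
  forall (y : R) (N : int), y *~ N = z -> exists l, (N %| (D * m ^ l)%N%:Z)%Z.
Proof.
move=> z0; have [D D0 h] := bounded_denominator_gen (zindep1 z0).
exists D => // y N e; have [|l] := h y N (fun=> 1) _ 0%N erefl.
  by rewrite e zcomb_cons [zcomb [::] _]big_ord0 addr0.
by rewrite mulr1; exists l.
Qed.

Lemma prime_ndvd_gt (q k l : nat) : prime q -> (0 < k)%N -> (k < q)%N -> (m < q)%N ->
  ~~ (q %| k * m ^ l)%N.
Proof.
move=> pq k0 kq mq; rewrite Euclid_dvdM // negb_or; apply/andP; split.
  by apply/negP => /dvdn_leq; lia.
by rewrite Euclid_dvdX // negb_and; apply/orP; left; apply/negP => /dvdn_leq; lia.
Qed.

(** As z^q = 0, the congruence makes z divisible by every prime q not dividing m, against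
    [bounded_divisor]. *)
Lemma reduced (z : R) : z ^+ 2 = 0 -> z = 0.
Proof.
move=> zz; apply/eqP/negPn/negP => z0; have [D D0 h] := bounded_divisor z0.
have [q pq qb] := exists_large_prime (maxn D m).
have qm : ~~ (q %| m)%N by apply/negP => /dvdn_leq; lia.
have [y] := frob pq qm z; have q2 : (2 <= q)%N by apply: prime_gt1.
rewrite -(subnKC q2) exprD zz mul0r sub0r subnKC // => e.
have [|l] := h (- y) q; first by rewrite mulNrz -pmulrn -e opprK.
by rewrite dvdzE !absz_nat => /negPn/negP; apply; apply: prime_ndvd_gt; lia.
Qed.

(* A prime q dividing c but not m can be divided out of y, since modulo q,    *)
(* y = y^q = c^(q-1) y = 0.                                                   *)
Lemma idempotent_of_scaled (y : R) (c : int) : y != 0 -> y ^+ 2 = y *~ c ->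
  exists (e : R) (d : int), [/\ e ^+ 2 = e, e != 0, d != 0 & y = e *~ d].
Proof.
have [n] := ubnP `|c|%N; elim: n c y => // n IH c y; rewrite ltnS => cn y0 yc.
have c0 : c != 0.
  by apply: contraNneq y0 => c0; apply/eqP/reduced; rewrite yc c0 mulr0z.
have [[q [pq qm qc]]|nq] := pselect (exists q, [/\ prime q, ~~ (q %| m)%N & (q %| `|c|)%N]).
  have /dvdzP[c1 cE] : (q %| c)%Z by rewrite dvdzE absz_nat.
  have [w e] := frob pq qm y; have q1 := prime_gt1 pq.
  have yq k : y ^+ k.+1 = y *~ c ^+ k.
    elim: k => [|k IHk]; first by rewrite mulr1z.
    by rewrite exprS IHk mulrzAr -expr2 yc -mulrzA exprS.
  have [y1 yE] : exists y1, y = y1 *~ q%:Z.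
    exists (y *~ (c ^+ q.-2 * c1) - w); rewrite mulrzBl -mulrzA -mulrA -cE -exprSr.
    have -> : q.-2.+1 = q.-1 by lia.
    rewrite -yq prednK; last by lia.
    by rewrite -[w *~ q]pmulrn -e opprB addrC subrK.
  have qz : q%:Z != 0 by case: (q) q1.
  have [|||f [d [f1 f2 f3 f4]]] := IH c1 y1.
  - move: cn c0; rewrite cE abszM absz_nat mulf_eq0 negb_or => + /andP[c10 _].
    by rewrite -absz_gt0 in c10; nia.
  - by apply: contraNneq y0 => y10; rewrite yE y10 mul0rz.
  - apply: (mulrzI_tf qz); apply: (mulrzI_tf qz).
    rewrite expr2 -mulrzAl -mulrzAr -yE -expr2 yc {1}yE cE -!mulrzA.
    by congr (_ *~ _); ring.
  by exists f, (d * q); split=> //; [rewrite mulf_neq0|rewrite mulrzA -f4].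
(* No prime is left to divide out: c divides a power of m, so y / c exists in R, and y^2 = c y makes
   it idempotent. *)
have [k ck] : exists k, (`|c| %| m ^ k)%N.
  apply: dvdn_exp_of_primes; first by rewrite absz_gt0.
  by move=> q pq qc; apply/negPn/negP => qm; apply: nq; exists q.
have /dvdzP[d dE] : (c %| (m ^ k)%N%:Z)%Z by rewrite dvdzE absz_nat.
have [u um] := m_inv.
have uk : u ^+ k *+ m ^ k = 1.
  by elim: (k) => [|j IHj]; rewrite ?expr0 // expnSr exprSr mulrnA -mulrnAl IHj mul1r um.
pose e := y * u ^+ k *~ d.
have ye : y = e *~ c.
  by rewrite /e -mulrzA -dE -mulrzAr -pmulrn uk mulr1.
exists e, c; split=> //; last by apply: contraNneq y0 => e0; rewrite ye e0 mul0rz.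
apply: (mulrzI_tf c0); apply: (mulrzI_tf c0).
by rewrite expr2 -mulrzAl -mulrzAr -ye -expr2 yc.
Qed.

Lemma zindep_orthogonal_idempotents (es : seq R) :
  (forall e, e \in es -> e != 0 /\ e ^+ 2 = e) ->
  (forall i j, (i < size es)%N -> (j < size es)%N -> i != j -> es`_i * es`_j = 0) ->
  zindep es.
Proof.
move=> idem orth c e i iz; have [e0 ei] := idem _ (mem_nth 0 iz).
apply/eqP/negPn/negP => ci; move/eqP: e0; apply; apply: (torsion_freez ci).
transitivity (es`_i * zcomb es c); last by rewrite e mulr0.
rewrite /zcomb mulr_sumr (bigD1 (Ordinal iz)) //= big1 ?addr0.
  by rewrite mulrzAr -expr2 ei.
move=> j ji; rewrite mulrzAr orth ?mul0rz // eq_sym.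
by apply: contraNneq ji => ji; apply/eqP/val_inj.
Qed.

End FinitelyGenerated.
End BinomialLike.

Section IntegerEvaluation.
Variable R : comNzRingType.
Implicit Types (x z : R) (p q : {poly int}).

Definition zeval x p : R := (map_poly intr p).[x].

Lemma zevalM x p q : zeval x (p * q) = zeval x p * zeval x q.
Proof. by rewrite /zeval rmorphM hornerM. Qed.

Lemma zevalD x p q : zeval x (p + q) = zeval x p + zeval x q.
Proof. by rewrite /zeval rmorphD hornerD. Qed.

Lemma zevalC x a : zeval x a%:P = a%:~R.
Proof. by rewrite /zeval map_polyC hornerC. Qed.

Lemma zevalX x : zeval x 'X = x.
Proof. by rewrite /zeval map_polyX hornerX. Qed.

Lemma zeval_wide x p n : (size p <= n)%N ->
  zeval x p = \sum_(i < n) x ^+ i *~ p`_i.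
Proof.
move=> pn; rewrite /zeval (@horner_coef_wide _ n) ?(leq_trans (size_poly _ _)) //.
by apply: eq_bigr => i _; rewrite coef_map /= mulrzl.
Qed.

Lemma zeval_eigen x z (a : int) p : x * z = z *~ a -> zeval x p * z = z *~ p.[a].
Proof.
move=> xz; elim/poly_ind: p => [|p c IH].
  by rewrite horner0 mulr0z /zeval rmorph0 horner0 mul0r.
rewrite zevalD zevalM zevalX zevalC mulrDl -mulrA xz mulrzAr IH hornerE !hornerE.
by rewrite mulrzDr mulrzA mulrzl.
Qed.

(* Cayley-Hamilton for multiplication by x on the span of ws. *)
Lemma zspan_integral (ws : seq R) x :
  (forall w, w \in ws -> zspan ws (x * w)) ->
  exists2 F : {poly int}, F \is monic & forall w, w \in ws -> zeval x F * w = 0.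
Proof.
move=> xw; have /fin_all_exists[C CE] (i : 'I_(size ws)) : exists c, x * ws`_i = zcomb ws c.
  by apply: xw; rewrite mem_nth.
pose A : 'M[int]_(size ws) := \matrix_(i, j) C i j.
exists (char_poly A); first exact: char_poly_monic.
pose f : {rmorphism {poly int} -> R} := horner_eval x \o map_poly intr.
have fE p : f p = zeval x p by [].
pose M : 'M[R]_(size ws) := map_mx f (char_poly_mx A).
pose W : 'cV[R]_(size ws) := \col_i ws`_i.
have MW : M *m W = 0.
  apply/matrixP => i j; rewrite !mxE (eq_bigr (fun k : 'I_(size ws) =>
      (if k == i then x * ws`_i else 0) - ws`_k *~ C i k)); last first.
    move=> k _; rewrite !mxE fE zevalD mulrDl; congr (_ + _).
      rewrite eq_sym; case: eqP => [->|_]; first by rewrite mulr1n zevalX.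
      by rewrite mulr0n /zeval rmorph0 horner0 mul0r.
    by rewrite -polyCN zevalC mulrzl mulrNz.
  rewrite sumrB -big_mkcond big_pred1_eq CE subrr //.
move=> w ws_w; have : \adj M *m (M *m W) = 0 by rewrite MW mulmx0.
rewrite mulmxA mul_adj_mx mul_scalar_mx det_map_mx => /matrixP.
have iw : (index w ws < size ws)%N by rewrite index_mem.
by move=> /(_ (Ordinal iw) 0); rewrite !mxE /= nth_index // fE.
Qed.

End IntegerEvaluation.

(** A nonconstant rational divisor of least degree is irreducible and, by Gauss's lemma, may be
    taken integral. The leading coefficients of g and h multiply to 1, so a common change of sign
    makes both monic. *)
Lemma monic_irreducible_factor (F : {poly int}) :
  F \is monic -> (1 < size F)%N -> exists g h : {poly int},
  [/\ g \is monic, h \is monic, irreducible_poly (pZtoQ g), F = g * h & (1 < size g)%N].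
Proof.
move=> Fm sF; have szZ (h : {poly int}) : size (pZtoQ h) = size h.
  by rewrite size_map_inj_poly //; apply: intr_inj.
have ex : exists n, `[< exists d : {poly rat}, [/\ size d = n, d %| pZtoQ F & (1 < n)%N] >].
  by exists (size F); apply/asboolP; exists (pZtoQ F); rewrite szZ dvdpp.
have [n /asboolP[d [dn dF n1]] nmin] := ex_minnP ex.
have [g [a a0 dE] [h FE]] := dvdpP_rat_int dF.
have sg : size g = n by rewrite -dn dE size_scale ?szZ.
have irr : irreducible_poly (pZtoQ g).
  split; first by rewrite szZ sg.
  move=> e e1 eg; rewrite -dvdp_size_eqp // eqn_leq dvdp_leq //=; last first.
    by rewrite -size_poly_gt0 szZ sg; lia.
  rewrite szZ sg; apply: nmin; apply/asboolP; exists e; split=> //.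
    by apply: dvdp_trans eg _; rewrite FE rmorphM dvdp_mulr.
  have e0 : e != 0.
    apply: contraTneq eg => ->; rewrite dvd0p -size_poly_gt0 szZ sg; lia.
  by move: e1; rewrite -size_poly_gt0 in e0; move: e0; case: (size e) => [|[]].
have /eqP lc : lead_coef g * lead_coef h = 1 by rewrite -lead_coefM -FE; apply/monicP.
have [[lg lh]|[lg lh]] : (lead_coef g = 1 /\ lead_coef h = 1) \/
                     (lead_coef g = -1 /\ lead_coef h = -1).
  move: lc; move: (lead_coef g) (lead_coef h) => x y /eqP e.
  have : (`|x| * `|y| == 1)%N by rewrite -abszM e.
  rewrite muln_eq1 => /andP[/eqP x1 _].
  have [xE|xE] : x = 1 \/ x = -1 by lia.
    by left; move: e; rewrite xE mul1r.
  by right; move: e; rewrite xE mulN1r => /eqP; rewrite eqr_oppLR => /eqP.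
  by exists g, h; split=> //; rewrite ?sg //; apply/monicP.
exists (- g), (- h); split; rewrite ?mulrNN ?size_polyN ?sg //.
- by apply/monicP; rewrite lead_coefN lg opprK.
- by apply/monicP; rewrite lead_coefN lh opprK.
rewrite rmorphN; case: irr => s1 s2; split; rewrite ?size_polyN // => e e1.
rewrite -scaleN1r => h1; have n1' : (-1 : rat) != 0 by rewrite oppr_eq0 oner_eq0.
by rewrite (eqp_rtrans (eqp_scale _ n1')) s2 // -(eqp_dvdr _ (eqp_scale _ n1')).
Qed.

(** * Splitting by primitive idempotents *)

Section Splitting.
Variables (R : comNzRingType) (m : nat).
Hypothesis m_gt0 : (0 < m)%N.
Hypothesis m_inv : exists u : R, u *+ m = 1.
Hypothesis tf : forall q, prime q -> ~~ (q %| m)%N -> forall x : R, x *+ q = 0 -> x = 0.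
Hypothesis frob : forall q, prime q -> ~~ (q %| m)%N -> forall x : R,
  exists y, x ^+ q - x = y *+ q.
Variable ws : seq R.
Hypothesis ws_gen : forall x, exists k, zspan ws (x *+ m ^ k).

(** The x^i z with i < deg g are independent, since a relation p would be prime to g and leave a
    nonzero integer killing z. If r is the remainder of T^q - T modulo g, then r(x) z = (x^q - x) z
    is q times an element of R, so for q not dividing D m all coefficients of r are divisible by q.
    Thus g divides T^q - T modulo q for almost every q, and [totally_split_size] applies. *)
Lemma irreducible_annihilator_linear (x z : R) (g : {poly int}) :
  g \is monic -> irreducible_poly (pZtoQ g) -> z != 0 -> zeval x g * z = 0 ->
  (size g <= 2)%N.
Proof.
move=> gm gi z0 gz; have szZ (h : {poly int}) : size (pZtoQ h) = size h.
  by rewrite size_map_inj_poly //; apply: intr_inj.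
pose n := (size g).-1; pose zs := [seq x ^+ i * z | i <- iota 0 n].
have szs : size zs = n by rewrite size_map size_iota.
have combE (p : {poly int}) : (size p <= n)%N -> zcomb zs (nth 0 p) = zeval x p * z.
  move=> pn; rewrite (zeval_wide x pn) mulr_suml /zcomb szs.
  apply: eq_bigr => i _; rewrite (nth_map 0%N) ?size_iota // nth_iota //.
  by rewrite add0n mulrzAl.
have g0 : (0 < size g)%N by rewrite size_poly_gt0 monic_neq0.
have ng : size g = n.+1 by rewrite /n prednK.
have zi : zindep zs.
  move=> c ce i iz; rewrite szs in iz; pose p := \poly_(i < n) c i.
  have pn : (size p <= n)%N by apply: size_poly.
  have pc j : (j < n)%N -> p`_j = c j by move=> jn; rewrite coef_poly jn.
  have pz : zeval x p * z = 0.
    by rewrite -combE // -[RHS]ce; apply: eq_zcomb => j; rewrite szs; apply: pc.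
  rewrite -pc //; have [->|p0] := eqVneq p 0; first by rewrite coef0.
  have : coprimep (pZtoQ g) (pZtoQ p).
    rewrite irreducible_poly_coprime //; apply/negP => /dvdp_leq.
    by rewrite -size_poly_gt0 !szZ size_poly_gt0 => /(_ p0); rewrite ng ltnNge pn.
  case/int_bezout => N [a [b [N0 ab]]]; case/eqP: z0.
  apply: (torsion_freez m_gt0 m_inv tf N0).
  rewrite -mulrzl -(zevalC x) -ab zevalD !zevalM mulrDl -!mulrA gz pz !mulr0 addr0 //.
have [D D0 bd] := bounded_denominator_gen ws_gen zi.
apply: (@totally_split_size g (D * m)) => //; first by rewrite muln_gt0 D0.
move=> q pq; rewrite Euclid_dvdM // negb_or => /andP[qD qm].
pose t : {poly int} := 'X^q - 'X.
have tE : t = Pdiv.Ring.rdivp t g * g + Pdiv.Ring.rmodp t g by apply: Pdiv.RingMonic.rdivp_eq.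
set r := Pdiv.Ring.rmodp t g in tE.
have rn : (size r <= n)%N.
  by have := Pdiv.Ring.ltn_rmodpN0 t (monic_neq0 gm); rewrite -/r ng ltnS.
have [y] := frob pq qm x => yq.
have yz : (y * z) *~ q = zcomb zs (nth 0 r).
  have rE : zeval x t * z = zeval x r * z.
    by rewrite [in LHS]tE zevalD mulrDl zevalM -mulrA gz mulr0 add0r.
  rewrite combE // -rE -mulrzAl -[y *~ q]pmulrn -yq /t.
  by rewrite /zeval rmorphB /= map_polyXn map_polyX hornerD hornerN hornerXn hornerX.
have r0 : map_poly (intr : int -> 'F_q) r = 0.
  apply/polyP => i; rewrite coef_map coef0.
  have [ni|ni] := leqP n i; first by rewrite nth_default ?(leq_trans rn).
  have [|l] := bd _ _ _ yz i; first by rewrite szs.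
  have cq : q \in [pchar 'F_q] by apply: pchar_Fp.
  rewrite (dvdz_pcharf cq) rmorphM /= mulf_eq0 => /orP[|/eqP //].
  rewrite -[_%:~R == 0](dvdz_pcharf cq (_%:Z)) dvdzE !absz_nat.
  by rewrite Euclid_dvdM // (negPf qD) Euclid_dvdX // (negPf qm).
have <- : map_poly (intr : int -> 'F_q) t = 'X^q - 'X.
  by rewrite rmorphB /= map_polyXn map_polyX.
by rewrite tE rmorphD /= r0 addr0 rmorphM dvdp_mull.
Qed.

Definition primitive_idempotent (e : R) : Prop :=
  [/\ e ^+ 2 = e, e != 0 &
    forall f, f ^+ 2 = f -> f * e = f -> f != 0 -> f = e].

(** After scaling by m^k, x is killed on e by a monic polynomial (Cayley-Hamilton). Peeling off
    irreducible factors leaves z = h(x) e != 0 killed by an irreducible g(x), which must be linear,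
    g = T - a. So x z = a z and z^2 = h(a) z; then z is a multiple of an idempotent below e, which
    is e itself by primitivity. *)
Lemma primitive_idempotent_scalar (e x : R) : primitive_idempotent e ->
  exists k (a : int), x *+ m ^ k * e = e *~ a.
Proof.
case=> e2 e0 prim.
have gen : exists k, forall w, w \in ws -> zspan ws (x *+ m ^ k * w).
  elim: {1}ws => [|w vs [k IH]]; first by exists 0%N.
  have [l hl] := ws_gen (x * w); exists (k + l)%N => v; rewrite inE => /orP[/eqP ->|/IH h].
    by rewrite mulrnAl addnC expnD mulrnA; apply: zspanMn.
  by rewrite expnD mulrnA mulrnAl; apply: zspanMn.
have [k /zspan_integral[F Fm Fw]] := gen; exists k; set X := x *+ m ^ k in Fw *.
have F0 : zeval X F * e = 0.
  have [l [c]] := ws_gen e => el; apply: (mulmI m_gt0 m_inv tf (k := l)).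
  rewrite mul0rn -mulrnAr el /zcomb mulr_sumr big1 // => i _.
  by rewrite mulrzAr Fw ?mul0rz // mem_nth.
have [g [h [gm gi ge0 ge1 ge]]] : exists g h, [/\ g \is monic, irreducible_poly (pZtoQ g),
    zeval X h * e != 0, zeval X g * (zeval X h * e) = 0 & (1 < size g)%N].
  have [n] := ubnP (size F); elim: n F Fm F0 {Fw} => // n IH F Fm F0 Fn.
  have [sF|sF] := leqP (size F) 1.
    case/eqP: e0; rewrite -F0; have -> : F = 1.
      by move/monicP: Fm; rewrite (size1_polyC sF) lead_coefC => ->.
    by rewrite -[1]/(1%:P) zevalC mul1r.
  have [g [h [gm hm gi FE sg]]] := monic_irreducible_factor Fm sF.
  have [h0|h0] := eqVneq (zeval X h * e) 0; last first.
    by exists g, h; split=> //; rewrite mulrA -zevalM -FE.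
  apply: (IH h hm h0); move: Fn; rewrite FE size_monicM ?monic_neq0 //; lia.
have g2 := irreducible_annihilator_linear gm gi ge0 ge1.
have sg2 : size g = 2%N by apply/eqP; rewrite eqn_leq g2 ge.
pose a := - g`_0; exists a.
have gE : g = 'X - a%:P.
  apply/polyP => i; rewrite coefB coefX coefC /a.
  have gl : g`_1 = 1 by move: (monicP gm); rewrite lead_coefE sg2.
  by case: i => [|[|i]] /=; rewrite ?sub0r ?opprK ?subr0 // nth_default // sg2.
set z := zeval X h * e in ge0 ge1.
have Xz : X * z = z *~ a.
  move: ge1; rewrite gE zevalD zevalX -polyCN zevalC mulrDl mulrzl => /eqP.
  by rewrite mulrNz subr_eq0 => /eqP.
have ez : e * z = z by rewrite /z mulrCA -expr2 e2.
have zz : z ^+ 2 = z *~ h.[a] by rewrite expr2 {1}/z -mulrA ez (zeval_eigen h Xz).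
have [f [d [f2 f0 d0 zE]]] := idempotent_of_scaled m_gt0 m_inv tf frob ws_gen ge0 zz.
have <- : f = e.
  by apply: prim => //; apply: (mulrzI_tf m_gt0 m_inv tf d0); rewrite -mulrzAl -zE mulrC.
by apply: (mulrzI_tf m_gt0 m_inv tf d0); rewrite -mulrzAr -zE Xz zE -!mulrzA mulrC.
Qed.

Definition orthogonal_idempotents n (E : 'I_n -> R) : Prop :=
  [/\ forall i, E i != 0, forall i, E i ^+ 2 = E i,
      forall i j, i != j -> E i * E j = 0 & \sum_i E i = 1].

(** Nonzero orthogonal idempotents are independent, and a power of m brings them into the span of
    ws; the bound makes a longest decomposition of 1 available. *)
Lemma orthogonal_idempotents_bound n (E : 'I_n -> R) :
  orthogonal_idempotents E -> (n <= size ws)%N.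
Proof.
case=> E0 E2 EE _.
have [k Ek] : exists k, forall i, zspan ws (E i *+ m ^ k).
  have [f fP] := fin_all_exists (fun i => ws_gen (E i)).
  exists (\sum_i f i)%N => i; rewrite (bigD1 i) //= expnD mulrnA.
  exact/zspanMn/fP.
pose es := [seq E i | i <- enum 'I_n].
have szE : size es = n by rewrite size_map size_enum_ord.
have nthE i (ni : (i < n)%N) : es`_i = E (Ordinal ni).
  rewrite (nth_map (Ordinal ni)) ?size_enum_ord //; congr E.
  by apply/val_inj; rewrite /= nth_enum_ord.
have ei : zindep es.
  apply: (zindep_orthogonal_idempotents m_gt0 m_inv tf).
    by move=> _ /mapP[i _ ->].
  by rewrite szE => i j ni nj ij; rewrite !nthE EE.
rewrite -[n in leqLHS]szE -(size_map (fun x => x *+ m ^ k) es).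
apply: zindep_size => [c|_ /mapP[_ /mapP[i _ ->] ->]] //.
rewrite /zcomb size_map szE => c0 i ni.
have mk0 : (m ^ k)%N%:Z != 0 by rewrite eqz_nat -lt0n expn_gt0 m_gt0.
apply: (mulIf mk0); rewrite mul0r; apply: (ei (fun i => c i * (m ^ k)%N%:Z)); last by rewrite szE.
rewrite -[RHS]c0 /zcomb szE; apply: eq_bigr => j _.
by rewrite (nth_map 0) ?szE // mulrC mulrzA -pmulrn.
Qed.

(** In a decomposition of 1 of maximal length every E i is primitive, since a smaller idempotent f
    would split it further into f and E i - f. *)
Lemma primitive_decomposition : exists n (E : 'I_n -> R),
  orthogonal_idempotents E /\ forall i, primitive_idempotent (E i).
Proof.
have ex : exists n, `[< exists E : 'I_n -> R, orthogonal_idempotents E >].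
  exists 1%N; apply/asboolP; exists (fun=> 1); split=> [i|i|i j|].
  - exact: oner_neq0.
  - exact: expr1n.
  - by rewrite !ord1.
  - by rewrite big_ord1.
have [|n /asboolP[E hE] nmax] := @ex_maxnP _ (size ws) ex.
  by move=> n /asboolP[E]; apply: orthogonal_idempotents_bound.
exists n, E; split=> // i0; have [E0 E2 EE E1] := hE; split=> // f f2 fE f0.
apply/eqP/negPn/negP => nfE.
pose E' (j : 'I_n.+1) := if unlift ord0 j is Some i then
  (if i == i0 then f else E i) else E i0 - f.
have fEj j : j != i0 -> f * E j = 0.
  by move=> ji; rewrite -fE -mulrA EE ?mulr0 // eq_sym.
have hE' : orthogonal_idempotents E'.
  have E'0 : E' ord0 = E i0 - f by rewrite /E' unlift_none.
  have E'S j : E' (lift ord0 j) = if j == i0 then f else E j by rewrite /E' liftK.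
  have o0 j : E' ord0 * E' (lift ord0 j) = 0.
    rewrite E'0 E'S; case: eqP => [_|/eqP ji].
      by rewrite mulrBl -expr2 f2 mulrC fE subrr.
    by rewrite mulrBl fEj // EE ?subrr // eq_sym.
  split.
  - move=> j; case: (unliftP ord0 j) => [k|] ->; last first.
      by rewrite E'0 subr_eq0 eq_sym.
    by rewrite E'S; case: (k == i0).
  - move=> j; case: (unliftP ord0 j) => [k|] ->; last first.
      by rewrite E'0 sqrrB E2 f2 [E i0 * f]mulrC fE mulr2n; ring.
    by rewrite E'S; case: (k == i0).
  - move=> j k; case: (unliftP ord0 j) => [j'|] ->; case: (unliftP ord0 k) => [k'|] -> //.
    + rewrite (inj_eq (@lift_inj _ _)) !E'S => jk.
      case: (eqVneq j' i0) => [e|ji]; case: (eqVneq k' i0) => [e'|ki].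
      * by move: jk; rewrite e e' eqxx.
      * exact: fEj.
      * by rewrite mulrC fEj.
      * exact: EE.
    + by rewrite mulrC o0.
  rewrite big_ord_recl E'0 -E1 [RHS](bigD1 i0) //=.
  rewrite (eq_bigr (fun j => if j == i0 then f else E j)) // (bigD1 i0) //= eqxx.
  rewrite addrA subrK; congr (_ + _); apply: eq_bigr => j ji.
  by rewrite (negPf ji).
by have := nmax n.+1; rewrite ltnn => /(_ (introT (asboolP _) (ex_intro _ E' hE'))).
Qed.

End Splitting.

Theorem scalar_decomposition (R : comPzRingType) (m : nat) (ws : seq R) :
  (0 < m)%N -> (exists u : R, u *+ m = 1) ->
  (forall q, prime q -> ~~ (q %| m)%N -> forall x : R, x *+ q = 0 -> x = 0) ->
  (forall q, prime q -> ~~ (q %| m)%N -> forall x : R, exists y, x ^+ q - x = y *+ q) ->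
  (forall x : R, exists k, zspan ws (x *+ m ^ k)) ->
  exists n (E : 'I_n -> R), [/\ forall i, E i != 0,
    forall i j, E i * E j = if i == j then E i else 0, \sum_i E i = 1 &
    forall x i, exists k (a : int), x *+ m ^ k * E i = E i *~ a].
Proof.
(* The zero ring is the case n = 0; the preceding lemmas work with 1 <> 0. *)
have [R0|R1] := eqVneq (1 : R) 0.
  move=> *; exists 0%N, (fun=> 0); split=> [[]|[]||x []] //.
  by rewrite big_ord0 R0.
pose R' : comNzRingType := HB.pack R (GRing.PzSemiRing_isNonZero.Build R R1).
move=> m0 mi tf fr gen.
have [n [E [[E0 E2 EE E1] prim]]] := @primitive_decomposition R' m m0 mi tf ws gen.
exists n, E; split=> // [i j|x i].
  by case: eqP => [<-|/eqP /EE //]; rewrite -expr2; apply: E2.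
exact: (@primitive_idempotent_scalar R' m m0 mi tf fr ws gen).
Qed.

(** * Nakayama's lemma over Z[1/m] *)

Section Nakayama.
Variables (V : zmodType) (m q : nat) (N : V -> Prop).
Hypotheses (q_gt1 : (1 < q)%N) (qm : coprime q m).
Hypothesis N0 : N 0.
Hypothesis NB : forall x y, N x -> N y -> N (x - y).
Hypothesis Ndiv : forall x, N (x *+ m) -> N x.

(** The Z[1/m]-submodule generated by N and ws, with the power of m on the side of x so that no
    division occurs. *)
Definition mspan_mod (ws : seq V) (x : V) : Prop :=
  exists j y, N y /\ zspan ws (x *+ m ^ j - y).

Lemma N_opp x : N x -> N (- x).
Proof. by rewrite -[- x]sub0r; apply: NB. Qed.

Lemma N_add x y : N x -> N y -> N (x + y).
Proof. by move=> nx ny; rewrite -[y]opprK; apply/NB/N_opp. Qed.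

Lemma N_mulrn x n : N x -> N (x *+ n).
Proof.
by move=> nx; elim: n => [|n IH]; rewrite ?mulr0n ?mulrS //; apply: N_add.
Qed.

Lemma N_mulrz x a : N x -> N (x *~ a).
Proof.
move=> nx; case: (intP a) => [|k|k]; rewrite ?mulr0z // ?mulrNz -pmulrn.
  exact: N_mulrn.
exact/N_opp/N_mulrn.
Qed.

Lemma mspan_modN ws x : N x -> mspan_mod ws x.
Proof. by move=> nx; exists 0%N, x; rewrite subrr; split=> //; apply: zspan0. Qed.

Lemma mspan_mod_mem ws x : x \in ws -> mspan_mod ws x.
Proof. by move=> xw; exists 0%N, 0; rewrite subr0; split=> //; apply: zspan_mem. Qed.

Lemma mspan_modD ws x y : mspan_mod ws x -> mspan_mod ws y -> mspan_mod ws (x + y).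
Proof.
move=> [i [x' [nx hx]]] [j [y' [ny hy]]]; exists (i + j)%N, (x' *+ m ^ j + y' *+ m ^ i).
split; first by apply: N_add; apply: N_mulrn.
rewrite mulrnDl opprD addrACA expnD; apply: zspanD.
  by rewrite mulrnA -mulrnBl; apply: zspanMn.
by rewrite mulnC mulrnA -mulrnBl; apply: zspanMn.
Qed.

Lemma mspan_modZ ws x a : mspan_mod ws x -> mspan_mod ws (x *~ a).
Proof.
move=> [i [y [ny h]]]; exists i, (y *~ a); split; first exact: N_mulrz.
by rewrite [_ *+ (m ^ i)]pmulrn mulrzAC -pmulrn -mulrzBl; apply: zspanZ.
Qed.

Lemma mspan_mod_div ws x j : mspan_mod ws (x *+ m ^ j) -> mspan_mod ws x.
Proof. by move=> [i [y [ny h]]]; exists (j + i)%N, y; rewrite expnD mulrnA. Qed.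

Lemma mspan_mod_cons w ws x :
  mspan_mod (w :: ws) x <-> exists j a, mspan_mod ws (x *+ m ^ j - w *~ a).
Proof.
split=> [[j [y [ny /zspan_consP[a h]]]]|[j [a [i [y [ny h]]]]]].
  by exists j, a, 0%N, y; rewrite mulr1n addrAC.
exists (j + i)%N, y; split=> //; apply/zspan_consP; exists (a * (m ^ i)%N%:Z).
by rewrite addrAC mulrzA -pmulrn expnD mulrnA -mulrnBl.
Qed.

(* If M is generated by ws modulo N and M = N + q M then e M lies in N for    *)
(* some e = 1 mod q up to powers of m: eliminate the generators one by one.   *)
Lemma nakayama ws :
  (forall x, mspan_mod ws x -> exists n y, [/\ N n, mspan_mod ws y & x = n + y *+ q]) ->
  exists e, [/\ (0 < e)%N, coprime e q & forall x, mspan_mod ws x -> N (x *+ e)].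
Proof.
elim: ws => [|w ws IH] h.
  exists 1%N; split=> [||x [j [y [ny [c]]]]] //; first exact: coprime1n.
  rewrite /zcomb big_ord0 => /eqP; rewrite subr_eq0 => /eqP xy; rewrite mulr1n.
  move: ny; rewrite -xy; elim: j {y xy} => [|j IHj] //.
  by rewrite expnSr mulrnA => /Ndiv/IHj.
have [n [y [nn yM we]]] := h w (mspan_mod_mem (mem_head _ _)).
case/mspan_mod_cons: (yM) => [j [a hy]].
(* From w = n + q y and m^j y = a w modulo the span of N and ws, it follows that e1 w lies in that
   span: multiplication by e1, a unit modulo q, removes the generator w. *)
pose e1 : int := (m ^ j)%N%:Z - a * q%:Z.
have we1 : mspan_mod ws (w *~ e1).
  have -> : w *~ e1 = n *+ m ^ j + (y *+ m ^ j - w *~ a) *+ q.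
    rewrite /e1 mulrzBr mulrzA -!pmulrn mulrnBl addrA; congr (_ - _).
    by rewrite we mulrnDl mulrnAC.
  apply: mspan_modD; first exact/mspan_modN/N_mulrn.
  by rewrite pmulrn; apply: mspan_modZ.
have e1M x : mspan_mod (w :: ws) x -> mspan_mod ws (x *~ e1).
  case/mspan_mod_cons=> [l [b hb]]; apply: (@mspan_mod_div _ _ l).
  rewrite pmulrn mulrzAC -pmulrn -(subrK (w *~ b) (x *+ _)) mulrzDl.
  by apply: mspan_modD; [apply: mspan_modZ|rewrite mulrzAC; apply: mspan_modZ].
have ceq : coprimez e1 q.
  have /coprimezP[[u v] /= uv] : coprimez ((m ^ j)%N%:Z) q.
    by rewrite /coprimez -[gcdz _ _]/((gcdn (m ^ j) q)%:Z) eqz_nat -/(coprime _ _) coprime_sym coprimeXr.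
  by apply/coprimezP; exists (u, v + u * a); rewrite /= -uv /e1; ring.
have wsM x : mspan_mod ws x -> mspan_mod (w :: ws) x.
  by move=> hx; apply/mspan_mod_cons; exists 0%N, 0; rewrite subr0.
(* The hypothesis passes to ws: write 1 = u e1 + v q and apply the old hypothesis to the term u e1 x
   only. *)
have [x hx|e [e0 eq he]] := IH.
  have [n' [y' [nn' y'M xE]]] := h x (wsM _ hx).
  have /coprimezP[[u v] /= uv] := ceq.
  exists (n' *~ (u * e1)), (y' *~ e1 *~ u + x *~ v); split.
  - exact: N_mulrz.
  - by apply: mspan_modD; apply: mspan_modZ => //; apply: e1M.
  rewrite -[LHS]mulr1z -uv mulrzDr {1}xE mulrzDl -addrA; congr (_ + _).
  by rewrite mulrnDl !pmulrn -!mulrzA; congr (_ *~ _ + _ *~ _); ring.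
exists (`|e1| * e)%N; split.
- rewrite muln_gt0 e0 andbT absz_gt0; apply/eqP => e10.
  by move: ceq; rewrite e10 /coprimez gcd0z absz_nat eqz_nat; move: q_gt1; lia.
- by rewrite coprimeMl eq andbT.
move=> x /e1M/he; rewrite mulrnA; case: (e1) => k //.
by rewrite NegzE abszN mulrNz mulNrn => /N_opp; rewrite opprK.
Qed.

End Nakayama.

(** * The filtration by degree in the basic classes *)

Section Filtration.
Variables (R : comPzRingType) (m : nat) (B : R -> Prop).

(* The Z[1/m]-span of the products of at most k elements of B when m is       *)
(* invertible in R, which is what the last rule is for.                       *)
Inductive prod_span : nat -> R -> Prop :=
| prod_span1 k : prod_span k 1
| prod_spanM k b x : B b -> prod_span k x -> prod_span k.+1 (b * x)
| prod_spanS k x : prod_span k x -> prod_span k.+1 x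
| prod_spanB k x y : prod_span k x -> prod_span k y -> prod_span k (x - y)
| prod_span_div k x : prod_span k (x *+ m) -> prod_span k x.

(** The Z[1/m]-span of B alone: unlike [prod_span 1], it is not made to contain the constants. *)
Inductive lin_span : R -> Prop :=
| lin_span_gen b : B b -> lin_span b
| lin_span0 : lin_span 0
| lin_spanB x y : lin_span x -> lin_span y -> lin_span (x - y)
| lin_span_div x : lin_span (x *+ m) -> lin_span x.

Lemma prod_span0 k : prod_span k 0.
Proof. by rewrite -(subrr 1); apply: prod_spanB; apply: prod_span1. Qed.

Lemma prod_spanN k x : prod_span k x -> prod_span k (- x).
Proof. exact: (N_opp (prod_span0 k) (@prod_spanB k)). Qed.

Lemma prod_spanD k x y : prod_span k x -> prod_span k y -> prod_span k (x + y).
Proof. exact: (N_add (prod_span0 k) (@prod_spanB k)). Qed.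

Lemma prod_spanMn k x n : prod_span k x -> prod_span k (x *+ n).
Proof. exact: (N_mulrn (prod_span0 k) (@prod_spanB k)). Qed.

Lemma prod_spanMz k x n : prod_span k x -> prod_span k (x *~ n).
Proof. exact: (N_mulrz (prod_span0 k) (@prod_spanB k)). Qed.

Lemma prod_span_divX k x j : prod_span k (x *+ m ^ j) -> prod_span k x.
Proof. by elim: j => [|j IH] //; rewrite expnSr mulrnA => /prod_span_div/IH. Qed.

Lemma prod_span_le k l x : (k <= l)%N -> prod_span k x -> prod_span l x.
Proof.
move/subnKC <-; elim: (l - k)%N => [|d IH]; rewrite ?addn0 // addnS => /IH.
exact: prod_spanS.
Qed.

Lemma prod_span_mul k l x y : prod_span k x -> prod_span l y -> prod_span (k + l) (x * y).
Proof.
move=> hx hy; elim: hx => {k x} [k|k b x Bb _ IH|k x _ IH|k x z _ IHx _ IHz|k x _ IH].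
- by rewrite mul1r; apply: prod_span_le hy; rewrite leq_addl.
- by rewrite addSn -mulrA; apply: prod_spanM.
- by rewrite addSn; apply: prod_spanS.
- by rewrite mulrBl; apply: prod_spanB.
- by apply: prod_span_div; rewrite -mulrnAl.
Qed.

Lemma prod_span_exp k x n : prod_span k x -> prod_span (n * k) (x ^+ n).
Proof.
move=> hx; elim: n => [|n IH]; first by rewrite expr0; apply: prod_span1.
by rewrite exprS mulSn; apply: prod_span_mul.
Qed.

Lemma lin_span_prod x : lin_span x -> prod_span 1 x.
Proof.
elim=> {x} [b Bb||x y _ hx _ hy|x _ hx].
- by rewrite -[b]mulr1; apply/prod_spanM/prod_span1.
- exact: prod_span0.
- exact: prod_spanB.
- exact: prod_span_div.
Qed.

Lemma frobeniusD q x z : prime q -> prod_span 1 x -> prod_span 1 z ->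
  exists2 y, prod_span q y & (x + z) ^+ q = x ^+ q + z ^+ q + y *+ q.
Proof.
move=> pq hx hz; have q0 := prime_gt0 pq.
exists (\sum_(i < q.-1) x ^+ (q - i.+1) * z ^+ i.+1 *+ ('C(q, i.+1) %/ q)).
  apply: (big_ind (prod_span q)); [exact: prod_span0|exact: prod_spanD|].
  move=> i _; apply: prod_spanMn.
  have := prod_span_mul (prod_span_exp (q - i.+1) hx) (prod_span_exp i.+1 hz).
  by rewrite !muln1 subnK //; have := ltn_ord i; lia.
rewrite exprDn -[in LHS](prednK q0) big_ord_recr big_ord_recl /= prednK // subn0.
rewrite bin0 binn subnn !expr0 mulr1 mul1r !mulr1n -!addrA; congr (_ + _).
rewrite addrC; congr (_ + _); rewrite -sumrMnl; apply: eq_bigr => i _.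
by rewrite /bump add1n -mulrnA divnK // prime_dvd_bin //; have := ltn_ord i; lia.
Qed.

Hypothesis m_gt0 : (0 < m)%N.
Hypothesis m_inv : exists u : R, u *+ m = 1.
Hypothesis B_frob : forall b q, B b -> prime q -> ~~ (q %| m)%N ->
  exists2 y, prod_span q y & b ^+ q - b = y *+ q.

(** Descends the congruence from m x to x: Fermat gives m^q = m + d q, and m is invertible. *)
Lemma frobenius_div q x y : prime q -> ~~ (q %| m)%N -> prod_span q x ->
  prod_span q y -> (x *+ m) ^+ q - x *+ m = y *+ q ->
  exists2 z, prod_span q z & x ^+ q - x = z *+ q.
Proof.
move=> pq qm hx hy e; have [u um] := m_inv.
have uk k : u ^+ k *+ m ^ k = 1.
  elim: k => [|j IHj]; rewrite ?expr0 // expnSr exprSr mulrnA.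
  by rewrite -mulrnAl IHj mul1r.
have /dvdnP[d dE] : (q %| m ^ q - m)%N.
  by rewrite -eqn_mod_dvd ?fermat_little // -{1}(expn1 m) leq_pexp2l // prime_gt0.
have mE : (m ^ q = d * q + m)%N.
  by rewrite -dE subnK // -{1}(expn1 m) leq_pexp2l // prime_gt0.
exists (u ^+ q * (y - x *+ d)).
  apply: (@prod_span_divX _ _ q); rewrite -mulrnAl uk mul1r.
  by apply/prod_spanB/prod_spanMn.
rewrite -mulrnAr mulrnBl -e -mulrnA exprMn_n -addrA -opprD -mulrnDr addnC -mE.
by rewrite -mulrnBl mulrnAr -mulrnAl uk mul1r.
Qed.

(** The q-th power map is additive modulo q, and the correction terms are products of q elements of
    degree 1, so the degree bound q survives. *)
Lemma lin_span_frobenius q x : prime q -> ~~ (q %| m)%N -> lin_span x ->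
  exists2 y, prod_span q y & x ^+ q - x = y *+ q.
Proof.
move=> pq qm; have q0 := prime_gt0 pq; elim=> {x} [b Bb||x y hx [x' hx' xE] hy [y' hy' yE]|x hx [y hy e]].
- exact: B_frob.
- by exists 0; [exact: prod_span0|rewrite expr0n subr0 mul0rn; case: (q) q0].
- have [w hw wE] := frobeniusD pq (lin_span_prod hx) (prod_spanN (lin_span_prod hy)).
  (* Only q = 2 needs a nonzero t: there the sign is absorbed by 2 y^2. *)
  have [t ht tE] : exists2 t, prod_span q t & (- y) ^+ q = - y ^+ q + t *+ q.
    rewrite exprNn -signr_odd; case: (boolP (odd q)) => qo.
      by exists 0; [exact: prod_span0|rewrite mulN1r mul0rn addr0].
    exists (y ^+ q); last first.
      have [->|qo'] := even_prime pq; last by rewrite qo' in qo.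
      by rewrite mul1r mulr2n addKr.
    by rewrite -[q in prod_span q]muln1; apply/prod_span_exp/lin_span_prod.
  exists (x' - y' + t + w).
    by apply: prod_spanD => //; apply: prod_spanD => //; apply: prod_spanB.
  by rewrite wE tE !mulrnDl mulNrn -xE -yE; ring.
- exact: (frobenius_div pq qm (prod_span_le q0 (lin_span_prod (lin_span_div hx))) hy e).
Qed.

Variables (r : nat) (v : 'I_r -> R).
Hypothesis v_lin : forall i, lin_span (v i).
Hypothesis v_gen : forall b, B b -> exists k c, b *+ m ^ k = \sum_i v i *~ c i.

Definition monomials k : seq R :=
  [seq \prod_(j < k) v (t j) | t : {ffun 'I_k -> 'I_r}].

Fixpoint monomials_le k : seq R :=
  if k is l.+1 then monomials k ++ monomials_le l else monomials 0.

Lemma monomials_mul k i w : w \in monomials k -> v i * w \in monomials k.+1.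
Proof.
case/fintype.imageP=> t _ ->; apply/fintype.imageP.
exists [ffun j => if unlift ord0 j is Some l then t l else i] => //.
rewrite big_ord_recl ffunE unlift_none; congr (_ * _).
by apply: eq_bigr => j _; rewrite ffunE liftK.
Qed.

Lemma monomials_le_mul k i w : w \in monomials_le k -> v i * w \in monomials_le k.+1.
Proof.
elim: k => [|k IH] /=; first by move=> h; rewrite mem_cat monomials_mul.
rewrite mem_cat => /orP[/monomials_mul h|/IH /= h]; first by rewrite mem_cat h.
by rewrite mem_cat h orbT.
Qed.

Lemma prod_span_monomials k x :
  prod_span k x -> exists j, zspan (monomials_le k) (x *+ m ^ j).
Proof.
elim=> {k x} [k|k b x Bb _ [j hj]|k x _ [j hj]|k x y _ [i hi] _ [j hj]|k x _ [j hj]].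
- exists 0%N; apply: zspan_mem; elim: k => [|k IH]; last by rewrite /= mem_cat IH orbT.
  apply/fintype.imageP; exists [ffun i : 'I_0 => match i with Ordinal n p => False_rect _ (notF p) end] => //.
  by rewrite big_ord0.
- have [i [c bE]] := v_gen Bb; exists (i + j)%N.
  have -> : b * x *+ m ^ (i + j) = \sum_i v i * (x *+ m ^ j) *~ c i.
    rewrite expnD mulrnA -mulrnAl -mulrnAr bE mulr_suml.
    by apply: eq_bigr => l _; rewrite mulrzAl.
  apply: (big_ind (zspan (monomials_le k.+1))); [exact: zspan0|exact: zspanD|].
  move=> l _; apply: zspanZ; case: hj => d ->; rewrite /zcomb mulr_sumr.
  apply: (big_ind (zspan (monomials_le k.+1))); [exact: zspan0|exact: zspanD|].
  by move=> e _; rewrite mulrzAr; apply/zspanZ/zspan_mem/monomials_le_mul; rewrite mem_nth.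
- exists j; apply: zspan_sub hj => w hw; apply: zspan_mem; rewrite /= mem_cat hw orbT //.
- exists (i + j)%N; rewrite mulrnBl -[_ - _]addr0 -mulrN1z; apply: zspanD; last exact: zspan0.
  apply: zspanD; first by rewrite expnD mulrnA; apply: zspanMn.
  by apply: zspanZ; rewrite addnC expnD mulrnA; apply: zspanMn.
- by exists j.+1; rewrite expnS mulrnA.
Qed.

(** By pigeonhole some generator v i occurs at least q times; replacing v i ^ q by v i plus q times
    an element of degree q lowers the degree modulo q. *)
Lemma monomial_reduce q k w : prime q -> ~~ (q %| m)%N -> (r * q.-1 < k)%N ->
  w \in monomials k ->
  exists n y, [/\ prod_span k.-1 n, prod_span k y & w = n + y *+ q].
Proof.
move=> pq qm rk /fintype.imageP[t _ ->]; have q1 := prime_gt1 pq.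
have [i qi] : exists i, (q <= #|[pred j | t j == i]|)%N.
  apply/existsP; apply: contraLR rk; rewrite negb_exists -leqNgt => /forallP h.
  rewrite -[k in leqLHS]card_ord -sum1_card (partition_big t predT) //=.
  apply: (@leq_trans (\sum_(i < r) q.-1)); last by rewrite sum_nat_const card_ord.
  by apply: leq_sum => i _; rewrite sum1_card -ltnS prednK ?prime_gt0 // ltnNge; apply: h.
rewrite (bigID (fun j => t j == i)) /= (eq_bigr (fun=> v i)); last by move=> j /eqP ->.
rewrite prodr_const; set c := #|_| in qi *; set rest := \prod_(_ < _ | _) _.
have vp l : prod_span 1 (v l) by apply/lin_span_prod.
have hrest : prod_span (k - c) rest.
  have -> : (k - c = #|[pred j | t j != i]|)%N.
    by rewrite -[k in LHS]card_ord -(cardC [pred j | t j == i]) addKn; apply: eq_card.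
  rewrite -sum1_card /rest; apply: (big_ind2 (fun n x => prod_span n x)).
  - exact: prod_span1.
  - by move=> *; apply: prod_span_mul.
  - by move=> j _; apply: vp.
have ck : (c <= k)%N by rewrite -[k in leqRHS]card_ord max_card.
have [y hy e] := lin_span_frobenius pq qm (v_lin i).
have h2 : prod_span (k - q) (v i ^+ (c - q) * rest).
  have -> : (k - q = (c - q) * 1 + (k - c))%N by lia.
  by apply: prod_span_mul hrest; apply: prod_span_exp.
exists (v i * (v i ^+ (c - q) * rest)), (y * (v i ^+ (c - q) * rest)); split.
- by apply: prod_span_le (prod_span_mul (vp i) h2); lia.
- by apply: prod_span_le (prod_span_mul hy h2); lia.
by rewrite -mulrnAl -e -mulrDl addrC subrK mulrA -exprD subnKC.
Qed.

Lemma monomials_prod k w : w \in monomials k -> prod_span k w.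
Proof.
case/fintype.imageP=> t _ ->; rewrite -[X in prod_span X](card_ord k) -sum1_card.
apply: (big_ind2 (fun n x => prod_span n x)); first exact: prod_span1.
  by move=> *; apply: prod_span_mul.
by move=> ? _; apply/lin_span_prod.
Qed.

Lemma monomials_le_prod k w : w \in monomials_le k -> prod_span k w.
Proof.
elim: k => [|l IH] /=; first exact: monomials_prod.
by rewrite mem_cat => /orP[/monomials_prod|/IH /prod_spanS].
Qed.

Lemma prod_span_zspan k ws x :
  (forall w, w \in ws -> prod_span k w) -> zspan ws x -> prod_span k x.
Proof.
move=> h [c ->]; apply: (big_ind (prod_span k)); [exact: prod_span0|exact: prod_spanD|].
by move=> i _; apply/prod_spanMz/h; rewrite mem_nth.
Qed.

Lemma prod_span_scale k y (u : R) j : u *+ m ^ j = 1 -> prod_span k y ->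
  prod_span k (u * y).
Proof. by move=> uj hy; apply: (@prod_span_divX _ _ j); rewrite -mulrnAl uj mul1r. Qed.

Lemma prod_span_reduce q k x : prime q -> ~~ (q %| m)%N -> (r * q.-1 < k)%N ->
  prod_span k x ->
  exists n y, [/\ prod_span k.-1 n, prod_span k y & x = n + y *+ q].
Proof.
move=> pq qm rk /prod_span_monomials[j hj].
have [u um] : exists u : R, u *+ m ^ j = 1.
  have [u um] := m_inv; exists (u ^+ j); elim: (j) => [|i IH]; first by rewrite expr0.
  by rewrite expnSr exprSr mulrnA -mulrnAl IH mul1r.
have sp : exists n y, [/\ prod_span k.-1 n, prod_span k y & x *+ m ^ j = n + y *+ q].
  case: hj => c ->; apply: (big_ind (fun z => exists n y,
    [/\ prod_span k.-1 n, prod_span k y & z = n + y *+ q])).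
  - exists 0, 0; rewrite mul0rn addr0; split=> //; exact: prod_span0.
  - move=> _ _ [n1 [y1 [h1 h2 ->]]] [n2 [y2 [h3 h4 ->]]]; exists (n1 + n2), (y1 + y2).
    by rewrite mulrnDl addrACA; split=> //; apply: prod_spanD.
  move=> i _; have := mem_nth 0 (ltn_ord i); set w := nth _ _ _ => hw.
  have [n [y [h1 h2 ->]]] : exists n y, [/\ prod_span k.-1 n, prod_span k y & w = n + y *+ q].
    move: w hw; have -> : monomials_le k = monomials k ++ monomials_le k.-1.
      by case: (k) rk.
    move=> w; rewrite mem_cat => /orP[|hw]; first exact: monomial_reduce.
    exists w, 0; rewrite mul0rn addr0; split=> //; last exact: prod_span0.
    exact: monomials_le_prod.
  exists (n *~ c i), (y *~ c i); split; try exact: prod_spanMz.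
  by rewrite mulrzDl [_ *+ q]pmulrn mulrzAC -pmulrn.
have [n [y [h1 h2 e]]] := sp; exists (u * n), (u * y).
split; try exact: (prod_span_scale um).
by rewrite -mulrnAr -mulrDr -e mulrnAr -mulrnAl um mul1r.
Qed.

(** Degree reduction modulo any e: compose the reductions modulo its prime factors, those dividing m
    being invertible. *)
Lemma prod_span_reduce_gen e : (0 < e)%N -> exists K, forall k x, (K < k)%N ->
  prod_span k x -> exists n y, [/\ prod_span k.-1 n, prod_span k y & x = n + y *+ e].
Proof.
have [N] := ubnP e; elim: N e => // N IH e; rewrite ltnS => eN e0.
have [e1|e1] := leqP e 1.
  have -> : e = 1%N by lia.
  exists 0%N => k x _ hx; exists 0, x; rewrite add0r; split=> //; exact: prod_span0.
have pq := pdiv_prime e1; have /dvdnP[d eE] := pdiv_dvd e; set q := pdiv e in pq eE.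
have q1 := prime_gt1 pq; have d0 : (0 < d)%N by lia.
have [|K1 hK1] := IH d _ d0; first by nia.
have [K2 hK2] : exists K, forall k x, (K < k)%N -> prod_span k x ->
    exists n y, [/\ prod_span k.-1 n, prod_span k y & x = n + y *+ q].
  have [qm|qm] := boolP (q %| m)%N; last first.
    by exists (r * q.-1)%N => k x rk; apply: prod_span_reduce.
  exists 0%N => k x _ hx; case/dvdnP: qm => c mE; have [u um] := m_inv.
  exists 0, (u * x *+ c); split; first exact: prod_span0.
    by apply: prod_spanMn; apply: (@prod_span_scale k x u 1).
  by rewrite add0r -mulrnA -mE -mulrnAl um mul1r.
exists (maxn K1 K2) => k x; rewrite gtn_max => /andP[h1 h2] hx.
have [n1 [y1 [a1 a2 ->]]] := hK2 k x h2 hx; have [n2 [y2 [b1 b2 ->]]] := hK1 k y1 h1 a2.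
exists (n1 + n2 *+ q), y2; split=> //; first by apply/prod_spanD/prod_spanMn.
by rewrite mulrnDl addrA -mulrnA -eE.
Qed.

(** A product of k + 2 factors is one factor times a product of k + 1, so the inclusion of e times
    one degree in the preceding one propagates upwards. *)
Lemma prod_span_scaled_step e k :
  (forall x, prod_span k.+1 x -> prod_span k (x *+ e)) ->
  forall x, prod_span k.+2 x -> prod_span k.+1 (x *+ e).
Proof.
move=> h x; move en: k.+2 => n hx.
elim: hx en => {n x} [n|n b x Bb hx _|n x hx _|n x y _ IHx _ IHy|n x _ IH] en.
- exact/prod_spanMn/prod_span1.
- by rewrite -mulrnAr; apply: prod_spanM Bb _; apply: h; case: en hx => <-.
- by apply: prod_spanMn; case: en hx => <-.
- by rewrite mulrnBl; apply: prod_spanB; [apply: IHx|apply: IHy].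
- by apply: prod_span_div; rewrite mulrnAC; apply: IH.
Qed.

(** Write F_k for degree at most k, fix one prime q > m and let k0 = r (q - 1). Since F_(k0+1) =
    F_k0 + q F_(k0+1), Nakayama gives e with e F_(k0+1) in F_k0, and the same e works in all higher
    degrees. For large k also F_(k+1) = F_k + e F_(k+1), which is therefore F_k. *)
Lemma prod_span_stable : exists K, forall k x, prod_span k x -> prod_span K x.
Proof.
have [q pq mq] := exists_large_prime m.
have qm : ~~ (q %| m)%N by apply/negP => /dvdn_leq; lia.
pose k0 := (r * q.-1)%N.
have ext x : prod_span k0.+1 x <-> mspan_mod m (prod_span k0) (monomials k0.+1) x.
  split=> [/prod_span_monomials[j /zspan_cat[s [t [hs ht e]]]]|[j [y [hy hz]]]].
    exists j, t; rewrite e addrK; split=> //.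
    by apply: prod_span_zspan ht => w; apply: monomials_le_prod.
  apply: (@prod_span_divX _ _ j); rewrite -(subrK y (x *+ _)).
  apply: prod_spanD (prod_spanS hy).
  by apply: prod_span_zspan hz => w; apply: monomials_prod.
have [||e [e0 eq he]] := @nakayama _ m q (prod_span k0) (prime_gt1 pq) _ (prod_span0 k0)
    (@prod_spanB k0) (@prod_span_div k0) (monomials k0.+1).
- by rewrite prime_coprime.
- move=> x /ext hx; have [n [y [h1 h2 h3]]] := prod_span_reduce pq qm (ltnSn _) hx.
  by exists n, y; split=> //; apply/ext.
have step d x : prod_span (k0 + d).+1 x -> prod_span (k0 + d) (x *+ e).
  elim: d x => [|d IH] x; first by rewrite addn0 => /ext/he.
  by rewrite addnS; apply: prod_span_scaled_step.
have [K1 hK1] := prod_span_reduce_gen e0.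
pose K := maxn K1 k0; exists K => k x.
have [kK|Kk] := leqP k K; first exact: prod_span_le.
rewrite -(subnKC (ltnW Kk)); elim: (k - K)%N x => [|d IH] x; first by rewrite addn0.
rewrite addnS => hx; apply: IH.
have [|n [y [h1 h2 ->]]] := hK1 _ _ _ hx; first by rewrite ltnS (leq_trans (leq_maxl K1 k0)) // leq_addr.
apply: prod_spanD h1 _; have {h2} := h2.
have -> : (K + d = k0 + (K + d - k0))%N by rewrite subnKC // (leq_trans (leq_maxr K1 k0)) // leq_addr.
exact: step.
Qed.

Theorem prod_span_finitely_generated : (forall x, exists k, prod_span k x) ->
  exists ws : seq R, forall x, exists k, zspan ws (x *+ m ^ k).
Proof.
move=> gen; have [K hK] := prod_span_stable; exists (monomials_le K) => x.
by have [k /hK] := gen x; apply: prod_span_monomials.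
Qed.

End Filtration.

(** * Frobenius lifts on presented rings *)

Section WittPolynomial.
Variable p : nat.
Hypothesis pp : prime p.

(* ((x + y)^p - x^p - y^p) / p *)
Definition wittP (R : comPzRingType) (x y : R) : R :=
  \sum_(i < p.-1) x ^+ (p - i.+1) * y ^+ i.+1 *+ ('C(p, i.+1) %/ p).

Lemma wittPE (R : comPzRingType) (x y : R) :
  (x + y) ^+ p = x ^+ p + y ^+ p + wittP x y *+ p.
Proof.
have p0 := prime_gt0 pp.
rewrite exprDn -[in LHS](prednK p0) big_ord_recr big_ord_recl /= prednK // subn0.
rewrite bin0 binn subnn !expr0 mulr1 mul1r !mulr1n -!addrA; congr (_ + _).
rewrite addrC; congr (_ + _); rewrite -sumrMnl; apply: eq_bigr => i _.
by rewrite /bump add1n -mulrnA divnK // prime_dvd_bin //; have := ltn_ord i; lia.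
Qed.

Lemma rmorph_wittP (R S : comPzRingType) (f : {rmorphism R -> S}) x y :
  f (wittP x y) = wittP (f x) (f y).
Proof.
rewrite rmorph_sum; apply: eq_bigr => i _.
by rewrite rmorphMn rmorphM !rmorphXn.
Qed.

Lemma wittP0l (R : comPzRingType) (y : R) : wittP 0 y = 0.
Proof.
rewrite /wittP big1 // => i _; rewrite expr0n subn_eq0 leqNgt.
have -> : (i.+1 < p)%N by have := ltn_ord i; lia.
by rewrite mul0r mul0rn.
Qed.

Lemma wittPM (R : comPzRingType) (x y z : R) :
  wittP (x * z) (y * z) = wittP x y * z ^+ p.
Proof.
rewrite /wittP mulr_suml; apply: eq_bigr => i _.
rewrite mulrnAl !exprMn mulrACA -exprD subnK //; have := ltn_ord i; lia.
Qed.

Local Notation Z3 := {poly {poly {poly int}}}.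

Lemma universal_ring (R : comPzRingType) (x y z : R) : (1 : R) != 0 ->
  exists (f : {rmorphism Z3 -> R}) a b c, [/\ f a = x, f b = y & f c = z].
Proof.
move=> R1; pose R' : comNzRingType := HB.pack R (GRing.PzSemiRing_isNonZero.Build R R1).
have c1 : commr_rmorph (intr : {rmorphism int -> R'}) x by move=> ?; apply: mulrC.
pose f1 : {rmorphism {poly int} -> R'} := horner_morph c1.
have c2 : commr_rmorph f1 y by move=> ?; apply: mulrC.
pose f2 : {rmorphism {poly {poly int}} -> R'} := horner_morph c2.
have c3 : commr_rmorph f2 z by move=> ?; apply: mulrC.
pose f3 : {rmorphism Z3 -> R'} := horner_morph c3.
exists f3, ('X%:P%:P), ('X%:P), 'X; split.
- exact: etrans (horner_morphC c3 _) (etrans (horner_morphC c2 _) (horner_morphX c1)).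
- exact: etrans (horner_morphC c3 _) (horner_morphX c2).
- exact: horner_morphX c3.
Qed.

Lemma Z3_mulrnI (a b : Z3) : a *+ p = b *+ p -> a = b.
Proof.
move=> e; have : (a - b) * p%:R = 0 by rewrite mulr_natr mulrnBl e subrr.
move/eqP; rewrite mulf_eq0 subr_eq0 => /orP[/eqP //|/eqP p0].
have : p \in [pchar Z3] by rewrite inE pp p0 eqxx.
by rewrite !pchar_poly pchar_num.
Qed.

(* An identity between universal integer polynomials may be checked after     *)
(* multiplication by p.                                                       *)
Lemma universal_identity (F G : forall R : comPzRingType, R -> R -> R -> R) :
  (forall (R S : comPzRingType) (f : {rmorphism R -> S}) x y z,
     f (F R x y z) = F S (f x) (f y) (f z)) ->
  (forall (R S : comPzRingType) (f : {rmorphism R -> S}) x y z,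
     f (G R x y z) = G S (f x) (f y) (f z)) ->
  (forall (R : comPzRingType) (x y z : R), F R x y z *+ p = G R x y z *+ p) ->
  forall (R : comPzRingType) (x y z : R), F R x y z = G R x y z.
Proof.
move=> Fn Gn FG R x y z; have [R0|R1] := eqVneq (1 : R) 0.
  by rewrite -[LHS]mulr1 -[RHS]mulr1 R0 !mulr0.
have [f [a [b [c [<- <- <-]]]]] := universal_ring x y z R1.
by rewrite -Fn -Gn; congr (f _); apply/Z3_mulrnI/FG.
Qed.

Lemma wittP_mulrn (R : comPzRingType) (x y : R) :
  wittP x y *+ p = (x + y) ^+ p - x ^+ p - y ^+ p.
Proof. by rewrite wittPE; ring. Qed.

Lemma wittPC (R : comPzRingType) (x y : R) : wittP x y = wittP y x.
Proof.
apply: (@universal_identity (fun R x y _ => wittP x y) (fun R x y _ => wittP y x)) => //.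
- by move=> *; apply: rmorph_wittP.
- by move=> *; apply: rmorph_wittP.
by move=> S a b _; rewrite !wittP_mulrn [b + a]addrC addrAC.
Qed.

Lemma wittPA (R : comPzRingType) (x y z : R) :
  wittP y z + wittP x (y + z) = wittP x y + wittP (x + y) z.
Proof.
apply: (@universal_identity (fun R x y z => wittP y z + wittP x (y + z))
  (fun R x y z => wittP x y + wittP (x + y) z)) => //.
- by move=> *; rewrite !rmorphD !rmorph_wittP !rmorphD.
- by move=> *; rewrite !rmorphD !rmorph_wittP !rmorphD.
move=> S a b c; rewrite !mulrnDl !wittP_mulrn [a + (b + c)]addrA.
by move: ((a + b + c) ^+ p) ((b + c) ^+ p) ((a + b) ^+ p) => *; ring.
Qed.

(** * Delta structures on presented rings *)

Section PresentedDelta.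
Variables (S : Type) (rel : cring_term S -> cring_term S -> Prop).
Local Notation Rg := (presented_ring rel).
Local Notation cl := (\pi_Rg : cring_term S -> Rg).
Variable D : S -> Rg.
Hypothesis DE : forall s, pres_gen rel s ^+ p = pres_gen rel s + D s *+ p.

(* t |-> (t^p - t) / p *)
Fixpoint term_delta (t : cring_term S) : Rg :=
  match t with
  | TGen s => D s
  | TZero => 0
  | TOne => 0
  | TAdd s t => term_delta s + term_delta t + wittP (cl s) (cl t)
  | TOpp t => - term_delta t - wittP (- cl t) (cl t)
  | TMul s t => cl s * term_delta t + cl t * term_delta s +
                term_delta s * term_delta t *+ p
  end.

Lemma clD s t : cl (TAdd s t) = cl s + cl t.
Proof. exact/esym/pres_addE. Qed.
Lemma clN t : cl (TOpp t) = - cl t.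
Proof. exact/esym/pres_oppE. Qed.
Lemma clM s t : cl (TMul s t) = cl s * cl t.
Proof. exact/esym/pres_mulE. Qed.

Lemma term_deltaE t : cl t ^+ p = cl t + term_delta t *+ p.
Proof.
elim: t => [s|||s IHs t IHt|t IHt|s IHs t IHt] /=.
- exact: DE.
- by rewrite mul0rn addr0 expr0n; case: (p) (prime_gt0 pp).
- by rewrite mul0rn addr0 expr1n.
- by rewrite clD wittPE IHs IHt !mulrnDl; ring.
- rewrite clN; have := wittPE (- cl t) (cl t); rewrite addNr expr0n.
  have -> : (p == 0)%N = false by case: (p) (prime_gt0 pp).
  move/eqP; rewrite eq_sym -addrA addr_eq0 => /eqP ->; rewrite IHt.
  by rewrite mulrnBl mulNrn; ring.
rewrite clM exprMn IHs IHt; move: (cl s) (cl t) (term_delta s) (term_delta t).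
by move=> a b c d; ring.
Qed.

Hypothesis rel_delta : forall s t, rel s t -> term_delta s = term_delta t.

(** Each ring axiom becomes an identity for delta: associativity of the sum is the cocycle identity
    [wittPA], and distributivity is [wittPM] with u^p rewritten as u + p delta(u). *)
Lemma term_delta_cong s t : cring_cong rel s t -> term_delta s = term_delta t.
Proof.
elim=> {s t} /=.
- exact: rel_delta.
- by [].
- by move=> s t _ ->.
- by move=> s t u _ -> _ ->.
- by move=> s s' t t' /clP es -> /clP et ->; rewrite es et.
- by move=> t t' /clP et ->; rewrite et.
- by move=> s s' t t' /clP es -> /clP et ->; rewrite es et.
- move=> s t u; rewrite !clD.
  rewrite -[LHS]addrA -[X in _ + X]addrA wittPA; ring.
- by move=> s t; rewrite wittPC [term_delta s + _]addrC.
- by move=> t; rewrite add0r wittP0l addr0.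
- by move=> t; rewrite clN; ring.
- by move=> s t u; rewrite !clM; ring.
- by move=> s t; ring.
- by move=> t; rewrite mulr0 addr0 mul0r mul0rn addr0 mul1r.
move=> s t u; rewrite !clM !clD wittPM term_deltaE.
by move: (cl s) (cl t) (cl u) (term_delta s) (term_delta t) (term_delta u) => *; ring.
Qed.

Lemma presented_frobenius (x : Rg) : exists y, x ^+ p = x + y *+ p.
Proof. by elim/cl_ind: x => t; exists (term_delta t); apply: term_deltaE. Qed.

Fixpoint term_mulrn (t : cring_term S) n :=
  if n is k.+1 then TAdd t (term_mulrn t k) else TZero.

Lemma cl_mulrn t n : cl (term_mulrn t n) = cl t *+ n.
Proof. by elim: n => [|n IH] //=; rewrite clD IH mulrS. Qed.

(** C is the integer delta(n) = (n^p - n) / p. *)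
Lemma term_delta_mulrn t n : exists2 C : int, C *+ p = n%:R ^+ p - n%:R &
  term_delta (term_mulrn t n) = term_delta t *+ n + cl t ^+ p *~ C.
Proof.
elim: n => [|n [C CE IH]] /=.
  by exists 0; rewrite ?mulr0n ?mulr0z ?addr0 // mul0rn expr0n; case: (p) (prime_gt0 pp).
exists (C + wittP 1 n%:R).
  by rewrite mulrnDl CE wittP_mulrn expr1n -natr1 [n%:R + 1]addrC; ring.
rewrite IH cl_mulrn mulrzDr mulrS !addrA; congr (_ + _).
have -> : wittP (cl t) (cl t *+ n) = cl t ^+ p * wittP 1 n%:R.
  by rewrite -{1}[cl t]mul1r -[_ *+ n]mulr_natl wittPM mulrC.
by rewrite -mulrzr; congr (_ * _); rewrite rmorph_wittP rmorph1 rmorph_nat.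
Qed.

(* delta (p x) = p delta x + (p^(p-1) - 1) x^p, so that p x = 0 forces        *)
(* 0 = x^p - x - x^p = - x.                                                   *)
Lemma presented_torsion_free (x : Rg) : x *+ p = 0 -> x = 0.
Proof.
elim/cl_ind: x => t px0; have [C CE] := term_delta_mulrn t p.
have -> : term_delta (term_mulrn t p) = 0.
  by rewrite (@term_delta_cong _ (@TZero S)) //; apply/clP; rewrite cl_mulrn px0.
have p1 := prime_gt1 pp.
have -> : C = p%:R ^+ p.-1 - 1.
  have p0 : (p%:R : int) != 0 by rewrite pnatr_eq0; lia.
  apply: (mulIf p0); rewrite mulr_natr CE mulrBl mul1r -exprSr prednK //; lia.
rewrite mulrzBr mulr1z -[p.-1](prednK (_ : 0 < p.-1)%N); last by lia.
rewrite exprS mulrzA.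
have -> : cl t ^+ p *~ p%:R = 0.
  have -> : cl t ^+ p = cl t * cl t ^+ p.-1 by rewrite -exprS prednK //; lia.
  by rewrite -mulrzAl natz -pmulrn px0 mul0r.
rewrite mul0rz sub0r term_deltaE => /eqP.
by rewrite eq_sym opprD addrCA subrr addr0 oppr_eq0 => /eqP.
Qed.

End PresentedDelta.
End WittPolynomial.

(** * Classes of maps of smooth sets *)

Local Open Scope classical_set_scope.
Local Open Scope ring_scope.

(** Carriers are bare types without a boolean equality, hence [List.In] here and below. *)
Lemma finite_set_list (T : Type) (A : set T) : finite_set A ->
  exists s : seq T, forall x, A x <-> List.In x s.
Proof.
elim/Pchoice: T => T in A *; case/finite_seqP=> s ->; exists s => x /=.
elim: s => [|y s IH] //=; rewrite inE; split.
  by case/orP=> [/eqP ->|/IH]; [left|right].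
by case=> [->|/IH ->]; rewrite ?eqxx ?orbT.
Qed.

Section Orbits.
Variables (P : perm_group) (T : Type) (act : P -> T -> T).
Hypothesis act1 : forall x, act 1%g x = x.
Hypothesis actM : forall g h x, act (g * h)%g x = act g (act h x).

Lemma actK g : cancel (act g) (act g^-1%g).
Proof. by move=> x; rewrite -actM mulVg act1. Qed.

Lemma actKV g : cancel (act g^-1%g) (act g).
Proof. by move=> x; rewrite -actM mulgV act1. Qed.

Lemma act_inj g : injective (act g).
Proof. exact: can_inj (actK g). Qed.

Lemma orbit_refl x : orbit act x x.
Proof. by exists 1%g. Qed.

Lemma orbit_eq x y : orbit act x y -> orbit act y = orbit act x.
Proof.
case=> g _ <-; apply/seteqP; split=> z [h _ <-].
  by exists (h * g)%g; rewrite ?actM.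
by exists (h * g^-1)%g; rewrite // actM actK.
Qed.

Definition invariant (S : set T) : Prop := forall g y, S y -> S (act g y).

Lemma invariantE S g y : invariant S -> S (act g y) = S y.
Proof.
move=> Si; apply/propext; split; last exact: Si.
by move/(Si g^-1%g); rewrite actK.
Qed.

Lemma invariant_orbit x : invariant (orbit act x).
Proof. by move=> g y [h _ <-]; rewrite -actM; exists (g * h)%g. Qed.

Lemma invariant_set0 : invariant set0. Proof. by []. Qed.
Lemma invariant_setT : invariant setT. Proof. by []. Qed.

Lemma invariant_setI S S' : invariant S -> invariant S' -> invariant (S `&` S').
Proof. by move=> h h' g y [/h ? /h' ?]. Qed.

Lemma invariant_setU S S' : invariant S -> invariant S' -> invariant (S `|` S').
Proof. by move=> h h' g y [/h ?|/h' ?]; [left|right]. Qed.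

Lemma invariant_setC S : invariant S -> invariant (~` S).
Proof. by move=> h g y /= nS; rewrite invariantE. Qed.

Lemma invariant_setD S S' : invariant S -> invariant S' -> invariant (S `\` S').
Proof. by move=> h h'; rewrite setDE; apply: invariant_setI => //; apply: invariant_setC. Qed.

Lemma orbit_sub S x : invariant S -> S x -> orbit act x `<=` S.
Proof. by move=> Si Sx _ [g _ <-]; apply: Si. Qed.

(** An invariant set is a finite disjoint union of orbits, so a statement compatible with relation
    (ii) needs checking only on orbits. *)
Lemma invariant_ind (Q : set T -> Prop) : finitely_many_orbits act ->
  Q set0 -> (forall x, Q (orbit act x)) ->
  (forall S S', invariant S -> invariant S' -> S `&` S' = set0 ->
     Q S -> Q S' -> Q (S `|` S')) ->
  forall S, invariant S -> Q S.
Proof.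
move=> /finite_set_list[Os OsP] Q0 Qo QU.
have h (l : seq (set T)) : forall S, invariant S ->
    (forall x, S x -> List.In (orbit act x) l) -> Q S.
  elim: l => [|O l IH] S Si Sl.
    suff -> : S = set0 by [].
    by apply/seteqP; split=> // x /Sl.
  have [[x [Sx xO]]|nx] := pselect (exists x, S x /\ orbit act x = O); last first.
    apply: IH => // x Sx; case: (Sl x Sx) => // xO; by case: nx; exists x.
  have -> : S = orbit act x `|` (S `\` orbit act x).
    apply/seteqP; split=> y; last by case=> [|[] //]; apply: (orbit_sub Si).
    by have [yx|nyx] := pselect (orbit act x y); [left|right].
  apply: QU.
  - exact: invariant_orbit.
  - by apply: invariant_setD => //; apply: invariant_orbit.
  - by rewrite setDE setICA setICr setI0.
  - exact: Qo.
  apply: IH => [|y [Sy nyx]]; first by apply: invariant_setD => //; apply: invariant_orbit.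
  case: (Sl y Sy) => // yO; case: nyx; rewrite xO yO; exact: orbit_refl.
by move=> S Si; apply: (h Os) => // x _; apply/OsP; exists x.
Qed.

End Orbits.

(** * Classes of restrictions to invariant subsets *)

Section Subsets.
Variable P : perm_group.
Implicit Types X Y Z : smooth_gset P.

Section SubGset.
Variables (Y : smooth_gset P) (S : set Y).

(* The largest invariant subset of S; it is S itself when S is invariant. *)
Definition inner : set Y := [set y | forall g, S (gact g y)].

Definition sub_carrier := {y : Y | inner y}.

Lemma sub_eq (y z : sub_carrier) : sval y = sval z -> y = z.
Proof.
case: y z => [y hy] [z hz] /= e; move: hy hz; rewrite e => hy hz.
by congr exist; apply: Prop_irrelevance.
Qed.

Lemma inner_act g y : inner y -> inner (gact g y).
Proof. by move=> hy h; rewrite -gactM. Qed.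

Definition sub_act (g : P) (y : sub_carrier) : sub_carrier :=
  exist _ (gact g (sval y)) (inner_act g (svalP y)).

Lemma sub_act1 y : sub_act 1%g y = y.
Proof. exact/sub_eq/gact1. Qed.

Lemma sub_actM g h y : sub_act (g * h)%g y = sub_act g (sub_act h y).
Proof. exact/sub_eq/gactM. Qed.

Lemma sub_stab y : stab sub_act y = stab (@gact P Y) (sval y).
Proof.
apply/seteqP; split=> g /=; first by move/(congr1 sval).
by move=> e; apply: sub_eq.
Qed.

Lemma sub_open y : gopen (stab sub_act y).
Proof. by rewrite sub_stab; apply: gstab_open. Qed.

Lemma sub_finite : finitely_many_orbits sub_act.
Proof.
apply: sub_finite_set (finite_image (fun O : set Y => [set y : sub_carrier | O (sval y)])
  (gorbits_finite Y)).
move=> _ [y _ <-]; exists (orbit (@gact P Y) (sval y)); first by exists (sval y).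
apply/seteqP; split=> z [g _ e]; exists g => //; last by rewrite -e.
exact: sub_eq.
Qed.

Lemma sub_smooth y : exists2 A : set (pts P), finite_set A & stab sub_act y = fixer A.
Proof. by rewrite sub_stab; apply: sgset_smooth. Qed.

Definition sub_gset : smooth_gset P :=
  @SmoothGSet P (GSet sub_act1 sub_actM sub_open sub_finite) sub_smooth.

Definition incl : gmap sub_gset Y := @GMap P sub_gset Y sval (fun g y => erefl).

Hypothesis Si : invariant (@gact P Y) S.

Lemma innerE : inner = S.
Proof.
apply/seteqP; split=> y /=; first by move/(_ 1%g); rewrite gact1.
by move=> Sy g; apply: Si.
Qed.

Lemma sub_in (y : Y) : S y -> exists z : sub_gset, sval z = y.
Proof. by move=> Sy; have h : inner y by [rewrite innerE]; exists (exist _ y h). Qed.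

Lemma sub_memP (z : sub_gset) : S (sval z).
Proof. by rewrite -innerE; apply: svalP. Qed.

End SubGset.

(* gcomp, with smooth_gset endpoints that can be inferred in theta_class. *)
Definition comap (Z Y X : smooth_gset P) (f : gmap Y X) (h : gmap Z Y) : gmap Z X :=
  gcomp f h.

Section Corestrict.
Variables (Z Y : smooth_gset P) (h : gmap Z Y) (S : set Y).
Hypothesis hS : forall z, inner S (h z).

Definition corestrict_fun (z : Z) : sub_gset S := exist _ (h z) (hS z).

Lemma corestrict_subproof g z :
  corestrict_fun (gact g z) = gact g (corestrict_fun z).
Proof. by apply: sub_eq; rewrite /= gfunE. Qed.

Definition corestrict : gmap Z (sub_gset S) := GMap corestrict_subproof.

End Corestrict.

Definition gid (X : smooth_gset P) : gmap X X := @GMap P X X id (fun g y => erefl).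

Lemma theta_class_irr Y X (f : gmap Y X) t t' : theta_class f t = theta_class f t'.
Proof. by congr theta_class; apply: Prop_irrelevance. Qed.

Lemma theta_class_pullback Y' Y X' X (q : gmap Y' Y) (f' : gmap Y' X')
    (f : gmap Y X) (b : gmap X' X) tX tX' :
  gcartesian q f' f b -> theta_class f tX = theta_class f' tX'.
Proof. by move=> c; apply/clP/cong_rel/(theta_base_change _ _ c). Qed.

Lemma theta_class_comp Z Y X (f : gmap Y X) (h : gmap Z Y) tX tY :
  gtransitive Z -> theta_class (comap f h) tX = theta_class f tX * theta_class h tY.
Proof. by move=> tZ; rewrite [RHS]pres_mulE; apply/clP/cong_rel/theta_comp. Qed.

Lemma theta_class_iso Y X (f : gmap Y X) tX : giso f -> theta_class f tX = 1.
Proof. by move=> fi; apply/clP/cong_rel/theta_iso. Qed.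

Lemma eq_theta_class Y X (f f' : gmap Y X) tX tX' :
  f =1 f' -> theta_class f tX = theta_class f' tX'.
Proof.
move=> e; apply: (@theta_class_pullback _ _ _ _ (gid Y) _ _ (gid X)).
by split=> [y|y x' /= fy]; [rewrite /= e|exists y; split=> [|z []]; rewrite -?e].
Qed.

Definition class_on Y X (f : gmap Y X) (tX : gtransitive X) (S : set Y) : Theta P :=
  theta_class (comap f (incl S)) tX.

(** Relation (iv) in a form that only asks for the square to be cartesian between S' and S, not
    between the ambient sets. *)
Lemma class_on_pullback Y' Y X' X (q : gmap Y' Y) (f' : gmap Y' X')
    (f : gmap Y X) (b : gmap X' X) tX tX' (S : set Y) (S' : set Y') :
  invariant (@gact P Y) S -> invariant (@gact P Y') S' ->
  (forall y', S' y' -> S (q y') /\ f (q y') = b (f' y')) ->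
  (forall y x', S y -> f y = b x' ->
     exists y', [/\ S' y', q y' = y, f' y' = x' &
       forall z', S' z' -> q z' = y -> f' z' = x' -> z' = y']) ->
  class_on f tX S = class_on f' tX' S'.
Proof.
move=> Si S'i h1 h2.
have hq (y' : sub_gset S') : inner S (q (sval y')).
  by rewrite innerE; have [] := h1 _ (sub_memP S'i y').
apply: (@theta_class_pullback _ _ _ _ (@corestrict _ _ (comap q (incl S')) _ hq) _ _ b).
split=> [y'|y x' e] /=; first by have [] := h1 _ (sub_memP S'i y').
have [y' [Sy' qy' fy' u]] := h2 (sval y) x' (sub_memP Si y) e.
have [z' zE] := sub_in S'i Sy'; exists z'; split.
  by split; [apply: sub_eq; rewrite /= zE|rewrite /= zE].
move=> w [w1 w2]; apply: sub_eq; rewrite zE; apply/esym/u => //.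
  exact: sub_memP.
by rewrite -w1.
Qed.

Lemma class_on_bij Y' Y X (j : gmap Y' Y) (f' : gmap Y' X) (f : gmap Y X) tX tX'
    (S : set Y) (S' : set Y') :
  invariant (@gact P Y) S -> invariant (@gact P Y') S' ->
  (forall y', S' y' -> S (j y') /\ f (j y') = f' y') ->
  (forall y, S y -> exists2 y', S' y' & j y' = y) ->
  (forall y' z', S' y' -> S' z' -> j y' = j z' -> y' = z') ->
  class_on f tX S = class_on f' tX' S'.
Proof.
move=> Si S'i h1 h2 h3; apply: (@class_on_pullback _ _ _ _ j f' f (gid X)) => //.
move=> y x' Sy /= fy; have [y' Sy' jy] := h2 y Sy; exists y'; split=> //.
  by have [_ <-] := h1 _ Sy'; rewrite jy.
by move=> z' Sz' jz _; apply: h3 => //; rewrite jz.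
Qed.

Lemma eq_class_on Y X (f f' : gmap Y X) tX (S : set Y) :
  invariant (@gact P Y) S -> (forall y, S y -> f y = f' y) ->
  class_on f tX S = class_on f' tX S.
Proof.
move=> Si e; apply: (class_on_bij tX tX (j := gid Y)) => //.
- by move=> y Sy; split=> //; apply: e.
- by move=> y Sy; exists y.
Qed.

Lemma class_onT Y X (f : gmap Y X) tX : class_on f tX setT = theta_class f tX.
Proof.
apply/esym; apply: (@theta_class_pullback _ _ _ _ (incl setT) _ _ (gid X)).
split=> // y x' /= e; have [z zE] := sub_in (@invariant_setT P Y (@gact P Y)) (I : setT y).
exists z; split; first by rewrite zE.
by move=> w [w1 _]; apply: sub_eq; rewrite zE.
Qed.

Lemma class_onU Y X (f : gmap Y X) tX (S S' : set Y) :
  invariant (@gact P Y) S -> invariant (@gact P Y) S' -> S `&` S' = set0 ->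
  class_on f tX (S `|` S') = class_on f tX S + class_on f tX S'.
Proof.
move=> Si S'i SS'.
have hU (T : set Y) : invariant (@gact P Y) T -> T `<=` S `|` S' ->
    forall y : sub_gset T, inner (S `|` S') (sval y).
  move=> Ti TU y; rewrite innerE; first exact: (TU _ (sub_memP Ti y)).
  exact: invariant_setU.
pose i T Ti TU := @corestrict _ _ (incl T) (S `|` S') (@hU T Ti TU).
have [s1 s2] : S `<=` S `|` S' /\ S' `<=` S `|` S' by split=> y; [left|right].
have du : gdisjoint_union (i S Si s1) (i S' S'i s2).
  split.
  - by move=> y z /(congr1 sval) /= e; apply: sub_eq.
  - by move=> y z /(congr1 sval) /= e; apply: sub_eq.
  - apply/seteqP; split=> // w [[y _ <-] [z _ /(congr1 sval) /= e]].
    have : (S `&` S') (sval y).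
      by split; [apply: sub_memP|rewrite -e; apply: sub_memP].
    by rewrite SS'.
  apply/seteqP; split=> // w _; have [Sw|Sw] := sub_memP (invariant_setU Si S'i) w.
    by left; have [y yE] := sub_in Si Sw; exists y => //; apply: sub_eq.
  by right; have [y yE] := sub_in S'i Sw; exists y => //; apply: sub_eq.
have -> : class_on f tX (S `|` S') =
    theta_class (comap (comap f (incl (S `|` S'))) (i S Si s1)) tX +
    theta_class (comap (comap f (incl (S `|` S'))) (i S' S'i s2)) tX.
  by rewrite [RHS]pres_addE; apply/clP/cong_rel/theta_union.
by congr (_ + _); apply: eq_theta_class.
Qed.

Lemma class_on0 Y X (f : gmap Y X) tX : class_on f tX set0 = 0.
Proof.
have := @class_onU Y X f tX set0 set0 (@invariant_set0 _ _ _) (@invariant_set0 _ _ _) (setI0 _).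
by rewrite setU0 => /eqP; rewrite -[X in X == _]addr0 (inj_eq (addrI _)) eq_sym => /eqP.
Qed.

End Subsets.

(** * Composites and fibrations *)

Section ClassCalculus.
Variable P : perm_group.
Implicit Types X Y Z : smooth_gset P.

Local Notation inv S := (invariant (@gact P _) S).
Local Notation orb := (orbit (@gact P _)).

Lemma inv_preim Z Y (h : gmap Z Y) (S : set Y) : inv S -> inv (h @^-1` S).
Proof. by move=> Si g z /= hz; rewrite gfunE; apply: Si. Qed.

Lemma sub_orbit_transitive Y (y : Y) : gtransitive (sub_gset (orb y)).
Proof.
have oi := invariant_orbit (@gactM P Y) (x := y).
have [y0 y0E] := sub_in oi (orbit_refl (@gact1 P Y) y).
exists y0; apply/seteqP; split=> // z _; have [g _ gy] := sub_memP oi z.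
by exists g => //; apply: sub_eq; rewrite /= y0E.
Qed.

Lemma transitive_orbit Y (y : Y) : gtransitive Y -> orb y = setT.
Proof.
case=> y0 y0T; have : orb y0 y by rewrite y0T.
by move/(orbit_eq (@gact1 P Y) (@gactM P Y)) => ->.
Qed.

Lemma gset_ind Y (Q : set Y -> Prop) :
  Q set0 -> (forall y, Q (orb y)) ->
  (forall S S', inv S -> inv S' -> S `&` S' = set0 -> Q S -> Q S' -> Q (S `|` S')) ->
  forall S, inv S -> Q S.
Proof. exact: (invariant_ind (@gact1 P Y) (@gactM P Y) (gorbits_finite Y)). Qed.

(** Relation (iii) asks for a transitive source; additivity over the orbits of S lifts this
    restriction. *)
Lemma class_on_comp Z Y X (f : gmap Y X) (h : gmap Z Y) tX tY (S : set Z) :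
  inv S -> class_on (comap f h) tX S = theta_class f tX * class_on h tY S.
Proof.
move: S; apply: gset_ind => [|z|S S' Si S'i SS' e e'].
- by rewrite !class_on0 mulr0.
- rewrite -theta_class_comp; first exact: eq_theta_class.
  exact: sub_orbit_transitive.
by rewrite !class_onU // e e' mulrDr.
Qed.

(** Over a single orbit of S' this is relation (iii); when the class c is the same over all orbits,
    additivity extends it to a base S' that is not transitive. *)
Lemma class_on_fibration_gen Z Y X (h : gmap Z Y) (f : gmap Y X) tX (S : set Z)
    (S' : set Y) c :
  inv S -> inv S' -> (forall z, S z -> S' (h z)) ->
  (forall y (h1 : gmap (sub_gset (S `&` h @^-1` (orb y))) (sub_gset (orb y))), S' y ->
     (forall z, sval (h1 z) = h (sval z)) ->
     theta_class h1 (sub_orbit_transitive y) = c) ->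
  class_on (comap f h) tX S = c * class_on f tX S'.
Proof.
move=> Si S'i H1 H2.
suff key : forall T, inv T -> T `<=` S' -> class_on (comap f h) tX (S `&` h @^-1` T) =
    c * class_on f tX T.
  rewrite -(key _ S'i) //; congr class_on.
  by apply/seteqP; split=> [z Sz|z []] //; split=> //; apply: H1.
apply: gset_ind => [_|y yS'|T T' Ti T'i TT' IH IH' TS].
- by rewrite preimage_set0 setI0 !class_on0 mulr0.
- have Oi := invariant_orbit (@gactM P Y) (x := y).
  set O := orb y in Oi yS' *; set S1 := S `&` _.
  have S1i : inv S1 by apply: invariant_setI => //; apply: inv_preim.
  have h1S (z : sub_gset S1) : inner O (h (sval z)).
    by rewrite innerE //; have [] := sub_memP S1i z.
  pose h1 := @corestrict _ _ _ (comap h (incl S1)) O h1S.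
  have tO := sub_orbit_transitive y.
  transitivity (theta_class (comap (comap f (incl O)) h1) tX); first exact: eq_theta_class.
  rewrite -class_onT (class_on_comp _ _ _ tO); last exact: invariant_setT.
  rewrite mulrC class_onT; congr (_ * _); rewrite -(H2 y h1) //.
    exact: theta_class_irr.
  by apply: yS'; apply: orbit_refl; apply: gact1.
rewrite !class_onU // mulrDr -IH -?IH'.
- rewrite preimage_setU setIUr class_onU //; do ?[by apply: invariant_setI => //; apply: inv_preim].
  by rewrite setIACA setIid -preimage_setI TT' preimage_set0 setI0.
- by apply: subset_trans TS => z; right.
- by apply: subset_trans TS => z; left.
Qed.

(** Here S is the fiber product of S0 and S' over X0, so by base change the class over every orbit
    of S' is that of f0 on S0. *)
Lemma class_on_fibration Z Y X X0 Y0 (h : gmap Z Y) (f : gmap Y X) (f0 : gmap Y0 X0)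
    (b : gmap Y X0) (q : gmap Z Y0) tX tX0 (S : set Z) (S' : set Y) (S0 : set Y0) :
  inv S -> inv S' -> inv S0 ->
  (forall z, S z -> [/\ S' (h z), S0 (q z) & f0 (q z) = b (h z)]) ->
  (forall y0 y, S0 y0 -> S' y -> f0 y0 = b y -> exists z,
     [/\ S z, q z = y0, h z = y & forall w, S w -> q w = y0 -> h w = y -> w = z]) ->
  class_on (comap f h) tX S = class_on f0 tX0 S0 * class_on f tX S'.
Proof.
move=> Si S'i S0i H1 H2; apply: class_on_fibration_gen => // [z /H1[]|y h1 yS' h1E] //.
have Oi := invariant_orbit (@gactM P Y) (x := y).
set O := orb y in Oi h1 h1E *; set S1 := S `&` _ in h1 h1E *.
have S1i : inv S1 by apply: invariant_setI => //; apply: inv_preim.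
rewrite -class_onT; apply/esym.
apply: (@class_on_pullback _ _ _ _ _ (comap q (incl S1)) _ _ (comap b (incl O))) => //.
  by move=> z _; rewrite /= h1E; have [Sz _] := sub_memP S1i z; have [] := H1 _ Sz.
move=> y0 y1 Sy0 e; have Oy1 := sub_memP Oi y1.
have [z [Sz qz hz u]] := H2 _ _ Sy0 (orbit_sub S'i yS' Oy1) e.
have [|z' zE] := @sub_in _ _ S1 S1i z.
  by split=> //=; rewrite hz.
exists z'; split=> //=; first by rewrite zE.
  by apply: sub_eq; rewrite h1E zE.
move=> w _ qw hw; apply: sub_eq; rewrite zE; apply: u => //.
  by have [] := sub_memP S1i w.
by rewrite -hw h1E.
Qed.

Lemma class_on_partition Y X (f : gmap Y X) tX (S : set Y) (T : nat -> set Y) N :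
  inv S -> (forall i, inv (T i)) ->
  (forall y, S y -> exists i, [/\ (i < N)%N, T i y &
     forall j, (j < N)%N -> T j y -> j = i]) ->
  class_on f tX S = \sum_(i < N) class_on f tX (S `&` T i).
Proof.
elim: N S => [|N IH] S Si Ti ex.
  rewrite big_ord0 -(class_on0 f tX); congr class_on.
  by apply/seteqP; split=> // y /ex[i []].
have SE : S = (S `\` T N) `|` (S `&` T N) by rewrite setDE -setIUr setUC setUv setIT.
have i1 : inv (S `\` T N) := invariant_setD (@gact1 P Y) (@gactM P Y) Si (Ti N).
have i2 : inv (S `&` T N) by apply: invariant_setI.
have i12 : (S `\` T N) `&` (S `&` T N) = set0 by rewrite setDE setIACA setICl setI0.
rewrite big_ord_recr /= {1}SE class_onU //; congr (_ + _); rewrite IH //.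
  apply: eq_bigr => i _; congr class_on; apply/seteqP; split=> [y [[]] //|y [Sy Tiy]].
  split=> //; split=> // TN; have [k [kN Tky u]] := ex y Sy.
  have e1 := u N (ltnSn N) TN; have e2 := u i (ltnW (ltn_ord i)) Tiy.
  by have := ltn_ord i; rewrite e2 -e1 ltnn.
move=> y [Sy nTy]; have [i [iN Tiy u]] := ex y Sy; exists i; split=> //.
  by rewrite ltnS leq_eqVlt in iN; case/orP: iN => // /eqP iN; case: nTy; rewrite -iN.
by move=> j jN; apply: u; apply: ltnW.
Qed.

Lemma class_on_partition_fin Y X (f : gmap Y X) tX (S : set Y) (I : finType)
    (T : I -> set Y) :
  inv S -> (forall i, inv (T i)) ->
  (forall y, S y -> exists i, T i y /\ forall j, T j y -> j = i) ->
  class_on f tX S = \sum_i class_on f tX (S `&` T i).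
Proof.
move=> Si Ti ex; pose T' (n : nat) := [set y | exists2 i : I, n = enum_rank i & T i y].
rewrite (@class_on_partition _ _ _ _ _ T' #|I|) //.
- rewrite [RHS](reindex _ (onW_bij _ (@enum_val_bij I))); apply: eq_bigr => n _.
  congr class_on; congr (_ `&` _); apply/seteqP; split=> y /=.
    by case=> i /val_inj -> Tiy; rewrite enum_rankK.
  by move=> Ty; exists (enum_val n) => //; rewrite enum_valK.
- by move=> n g y [i e Tiy]; exists i => //; apply: Ti.
move=> y /ex[i [Tiy u]]; exists (enum_rank i); split=> //; first by exists i.
by move=> _ _ [j -> /u ->].
Qed.

End ClassCalculus.

(** * Products and powers of smooth sets *)

Section Powers.
Variable P : perm_group.
Hypothesis olig : oligomorphic P.
Implicit Types X Y Z : smooth_gset P.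

Lemma fixer_list (A : set (pts P)) : finite_set A ->
  exists a : seq (pts P), stab (@tuple_act P) a = fixer A.
Proof.
case/finite_set_list=> a aP; exists a; apply/seteqP; split=> g /=.
  move=> e x /aP; elim: a e {aP} => [|y a IH] //= [e1 e2] [<- //|]; exact: IH.
move=> gA; have : forall x, List.In x a -> pact g x = x by move=> x /aP/gA.
elim: a {aP} => [|y a IH h]; first by [].
rewrite /stab /tuple_act /= (h y); last by left.
by congr cons; apply: IH => x xa; apply: h; right.
Qed.

Lemma stab_tuple_cat a b : stab (@tuple_act P) (a ++ b) =
  stab (@tuple_act P) a `&` stab (@tuple_act P) b.
Proof.
apply/seteqP; split=> g /=; rewrite /stab /tuple_act /= map_cat; last by case=> -> ->.
elim: a => [|x a IH] //= [-> /IH[ha hb]]; split=> //; by rewrite ha.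
Qed.

Section ProductOrbits.
Variables (T1 T2 : Type) (act1 : P -> T1 -> T1) (act2 : P -> T2 -> T2).
Hypothesis act1M : forall g h x, act1 (g * h)%g x = act1 g (act1 h x).
Hypothesis act2M : forall g h x, act2 (g * h)%g x = act2 g (act2 h x).
Hypothesis act11 : forall x, act1 1%g x = x.
Hypothesis act21 : forall x, act2 1%g x = x.
Hypothesis tame1 : forall t, exists a, stab (@tuple_act P) a `<=` stab act1 t.
Hypothesis tame2 : forall t, exists a, stab (@tuple_act P) a `<=` stab act2 t.
Variables (S1 : set T1) (S2 : set T2).
Hypothesis fin1 : finite_set [set orbit act1 t | t in S1].
Hypothesis fin2 : finite_set [set orbit act2 t | t in S2].

Definition prod_act g (t : T1 * T2) := (act1 g t.1, act2 g t.2).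

Lemma stab_transport (T : Type) (act : P -> T -> T) (t : T) (a : seq (pts P)) g h :
  (forall g h x, act (g * h)%g x = act g (act h x)) -> (forall x, act 1%g x = x) ->
  stab (@tuple_act P) a `<=` stab act t ->
  tuple_act g a = tuple_act h a -> act g t = act h t.
Proof.
move=> actM act1' sub e; have : stab (@tuple_act P) a (h^-1 * g)%g.
  by rewrite /stab /= tuple_actM e -tuple_actM mulVg tuple_act1.
by move/sub; rewrite /stab /= actM => {2}<-; rewrite -actM mulgV act1'.
Qed.

(* The orbit of (g t, h u) is determined by the G-orbit of the tuple (g a, h b) *)
(* where the tuples a and b have stabilizers inside those of t and u.           *)
Lemma finite_orbits_prod : finite_set [set orbit prod_act t | t in S1 `*` S2].
Proof.
pose F (O1 : set T1) (O2 : set T2) := [set orbit prod_act t | t in O1 `*` O2].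
apply: (@sub_finite_set _ _ (\bigcup_(O1 in [set orbit act1 t | t in S1])
    \bigcup_(O2 in [set orbit act2 t | t in S2]) F O1 O2)).
  move=> _ [[t u] [/= St Su] <-]; exists (orbit act1 t); first by exists t.
  exists (orbit act2 u); first by exists u.
  by exists (t, u) => //; split; apply: orbit_refl.
apply: bigcup_finite => // _ [t _ <-]; apply: bigcup_finite => // _ [u _ <-].
have [a ta] := tame1 t; have [b ub] := tame2 u.
pose phi (O : set (seq (pts P))) : set (T1 * T2) :=
  [set x | exists g h, O (tuple_act g a ++ tuple_act h b) /\ x = (act1 g t, act2 h u)].
apply: sub_finite_set (finite_image phi (olig (size a + size b)%N)).
move=> _ [[_ _] [/= [g _ <-] [h _ <-]] <-].
exists (orbit (@tuple_act P) (tuple_act g a ++ tuple_act h b)).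
  exists (tuple_act g a ++ tuple_act h b) => //=.
  by rewrite size_cat !size_map.
have catE k : tuple_act k (tuple_act g a ++ tuple_act h b) =
    tuple_act (k * g)%g a ++ tuple_act (k * h)%g b.
  by rewrite !tuple_actM /tuple_act map_cat.
apply/seteqP; split=> [_ [g' [h' [[k _ e] ->]]]|_ [k _ <-]].
  exists k => //; rewrite /prod_act /= -act1M -act2M; move: e; rewrite catE.
  move=> e; have /eqP : size (tuple_act (k * g)%g a) = size (tuple_act g' a) by rewrite !size_map.
  move=> se; have e1 : tuple_act (k * g)%g a = tuple_act g' a.
    by have := congr1 (take (size (tuple_act g' a))) e; rewrite take_size_cat ?(eqP se) // take_size_cat.
  have e2 : tuple_act (k * h)%g b = tuple_act h' b.
    by have := congr1 (drop (size (tuple_act g' a))) e; rewrite drop_size_cat ?(eqP se) // drop_size_cat.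
  by rewrite (stab_transport act1M act11 ta e1) (stab_transport act2M act21 ub e2).
exists (k * g)%g, (k * h)%g; split; first by exists k.
by rewrite /prod_act /= act1M act2M.
Qed.

End ProductOrbits.

Lemma gset_tame Y (y : Y) : exists a, stab (@tuple_act P) a `<=` stab (@gact P Y) y.
Proof.
by have [A fA ->] := sgset_smooth y; have [a e] := fixer_list fA; exists a; rewrite e.
Qed.

Lemma fixerU (A B : set (pts P)) : fixer A `&` fixer B = fixer (A `|` B).
Proof.
apply/seteqP; split=> g /=; first by case=> hA hB x [/hA|/hB].
by move=> h; split=> x hx; apply: h; [left|right].
Qed.

Lemma fixer_open (A : set (pts P)) : finite_set A -> gopen (fixer A).
Proof. by move=> fA g gA; exists A => // h hA a Aa; rewrite pactM hA // gA. Qed.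

Section Product.
Variables Y Z : smooth_gset P.
Local Notation pact2 := (prod_act (@gact P Y) (@gact P Z)).

Lemma prod_act1 t : pact2 1%g t = t.
Proof. by case: t => y z; rewrite /prod_act /= !gact1. Qed.

Lemma prod_actM g h t : pact2 (g * h)%g t = pact2 g (pact2 h t).
Proof. by rewrite /prod_act /= !gactM. Qed.

Lemma prod_smooth t : exists2 A : set (pts P), finite_set A & stab pact2 t = fixer A.
Proof.
case: t => y z; have [A fA Ay] := sgset_smooth y; have [B fB Bz] := sgset_smooth z.
exists (A `|` B); first by rewrite finite_setU.
rewrite -fixerU -Ay -Bz; apply/seteqP; split=> g /=; first by case.
by case=> e1 e2; rewrite /stab /prod_act /= e1 e2.
Qed.

Lemma prod_open t : gopen (stab pact2 t).
Proof. by have [A fA ->] := prod_smooth t; apply: fixer_open. Qed.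

Lemma prod_finite : finitely_many_orbits pact2.
Proof.
have := @finite_orbits_prod _ _ _ _ (@gactM P Y) (@gactM P Z) (@gact1 P Y) (@gact1 P Z)
  (@gset_tame Y) (@gset_tame Z) setT setT (gorbits_finite Y) (gorbits_finite Z).
by rewrite setXTT.
Qed.

Definition prod_gset : smooth_gset P :=
  @SmoothGSet P (GSet prod_act1 prod_actM prod_open prod_finite) prod_smooth.

Definition gfst : gmap prod_gset Y := @GMap P prod_gset Y fst (fun g t => erefl).
Definition gsnd : gmap prod_gset Z := @GMap P prod_gset Z snd (fun g t => erefl).

End Product.

Section Sequences.
Variables (Z : smooth_gset P) (k : nat).
Definition list_act (g : P) (s : seq Z) : seq Z := [seq gact g z | z <- s].

Lemma list_act1 s : list_act 1%g s = s.
Proof. by rewrite /list_act (eq_map (@gact1 P Z)) map_id. Qed.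

Lemma list_actM g h s : list_act (g * h)%g s = list_act g (list_act h s).
Proof. by rewrite /list_act -map_comp (eq_map (gactM g h)). Qed.

Lemma list_smooth s : exists2 A : set (pts P), finite_set A & stab list_act s = fixer A.
Proof.
elim: s => [|z s [A fA sA]].
  by exists set0 => //; apply/seteqP; split=> g // _ a [].
have [B fB zB] := sgset_smooth z; exists (B `|` A); first by rewrite finite_setU.
rewrite -fixerU -sA -zB; apply/seteqP; split=> g /=; first by case.
by case=> e1 e2; rewrite /stab /list_act /= e1; congr cons.
Qed.

Lemma list_tame s : exists a, stab (@tuple_act P) a `<=` stab list_act s.
Proof.
by have [A fA ->] := list_smooth s; have [a e] := fixer_list fA; exists a; rewrite e.
Qed.

Lemma list_finite l : finite_set [set orbit list_act s | s in [set s | size s = l]].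
Proof.
elim: l => [|l IH].
  apply: sub_finite_set (finite_set1 (orbit list_act [::])) => _ [s /= /size0nil -> <-] //.
pose cns (O : set (Z * seq Z)) : set (seq Z) := [set t.1 :: t.2 | t in O].
have fp := finite_orbits_prod (@gactM P Z) list_actM (@gact1 P Z) list_act1 (@gset_tame Z)
  list_tame (gorbits_finite Z) IH.
apply: sub_finite_set (finite_image cns fp) => _ [[|z s] //= [sl] <-].
exists (orbit (prod_act (@gact P Z) list_act) (z, s)); first by exists (z, s).
apply/seteqP; split=> [_ [_ [g _ <-] <-]|_ [g _ <-]]; first by exists g.
by exists (gact g z, list_act g s) => //; exists g.
Qed.

Definition seqs_carrier := {s : seq Z | size s = k}.

Lemma seqs_eq (s t : seqs_carrier) : sval s = sval t -> s = t.
Proof.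
case: s t => [s hs] [t ht] /= e; move: hs ht; rewrite e => hs ht.
by congr exist; apply: Prop_irrelevance.
Qed.

Lemma size_list_act g s : size s = k -> size (list_act g s) = k.
Proof. by rewrite size_map. Qed.

Definition seqs_act (g : P) (s : seqs_carrier) : seqs_carrier :=
  exist _ (list_act g (sval s)) (size_list_act g (svalP s)).

Lemma seqs_act1 s : seqs_act 1%g s = s.
Proof. exact/seqs_eq/list_act1. Qed.

Lemma seqs_actM g h s : seqs_act (g * h)%g s = seqs_act g (seqs_act h s).
Proof. exact/seqs_eq/list_actM. Qed.

Lemma seqs_stab s : stab seqs_act s = stab list_act (sval s).
Proof.
apply/seteqP; split=> g /=; first by move/(congr1 sval).
by move=> e; apply: seqs_eq.
Qed.

Lemma seqs_smooth s : exists2 A : set (pts P), finite_set A & stab seqs_act s = fixer A.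
Proof. by rewrite seqs_stab; apply: list_smooth. Qed.

Lemma seqs_open s : gopen (stab seqs_act s).
Proof. by have [A fA ->] := seqs_smooth s; apply: fixer_open. Qed.

Lemma seqs_finite : finitely_many_orbits seqs_act.
Proof.
apply: sub_finite_set (finite_image (fun O : set (seq Z) => [set s : seqs_carrier | O (sval s)])
  (list_finite k)).
move=> _ [s _ <-]; exists (orbit list_act (sval s)).
  by exists (sval s) => //; apply: (svalP s).
apply/seteqP; split=> t [g _ e]; exists g => //; last by rewrite -e.
exact: seqs_eq.
Qed.

Definition seqs_gset : smooth_gset P :=
  @SmoothGSet P (GSet seqs_act1 seqs_actM seqs_open seqs_finite) seqs_smooth.

End Sequences.

End Powers.

(** * Fiber powers *)

Section Fibers.
Variable P : perm_group.
Hypothesis olig : oligomorphic P.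
Local Notation inv S := (invariant (@gact P _) S).
Local Notation prodg := (prod_gset olig).
Local Notation seqsg := (seqs_gset olig).

(** One relation per coordinate: the pairs (o, s) form the fiber product over O of the graphs of the
    members of Fs. *)
Fixpoint fibers (O Z : Type) (Fs : seq (O -> Z -> Prop)) (o : O) (s : seq Z) : Prop :=
  match Fs, s with
  | [::], [::] => True
  | F :: Fs', z :: s' => F o z /\ fibers Fs' o s'
  | _, _ => False
  end.

Section SeqMaps.
Variables (Z : smooth_gset P) (k : nat).

Definition seq_head (s : seqsg Z k.+1) : Z :=
  match sval s as s0 return size s0 = k.+1 -> Z with
  | [::] => fun e => match O_S _ e with end
  | z :: _ => fun _ => z
  end (svalP s).

Lemma seq_head_subproof g s : seq_head (gact g s) = gact g (seq_head s).
Proof.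
by case: s => [[|y t] e].
Qed.

Definition ghead : gmap (seqsg Z k.+1) Z := GMap seq_head_subproof.

Lemma size_behead_seqs (s : seqsg Z k.+1) : size (behead (sval s)) = k.
Proof. by rewrite size_behead (svalP s). Qed.

Definition seq_behead (s : seqsg Z k.+1) : seqsg Z k :=
  exist _ (behead (sval s)) (size_behead_seqs s).

Lemma seq_behead_subproof g s : seq_behead (gact g s) = gact g (seq_behead s).
Proof. by apply: seqs_eq; case: s => [[|y t] e]. Qed.

Definition gbehead : gmap (seqsg Z k.+1) (seqsg Z k) := GMap seq_behead_subproof.

End SeqMaps.

Lemma pair_map_subproof (A B C : smooth_gset P) (f : gmap A B) (h : gmap A C) g a :
  (f (gact g a), h (gact g a)) = @gact P (prodg B C) g (f a, h a).
Proof. by rewrite !gfunE. Qed.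

Definition gpair (A B C : smooth_gset P) (f : gmap A B) (h : gmap A C) :
  gmap A (prodg B C) :=
  @GMap P A (prodg B C) (fun a => (f a, h a)) (pair_map_subproof f h).

Section FiberClass.
Variables (O Z : smooth_gset P) (tO : gtransitive O).
Implicit Types (F : O -> Z -> Prop) (Fs : seq (O -> Z -> Prop)).

Definition rel_inv F := forall g o z, F o z -> F (gact g o) (gact g z).
Definition rel_graph F : set (prodg O Z) := [set t | F t.1 t.2].
Definition fiber_set Fs k : set (prodg O (seqsg Z k)) :=
  [set t | fibers Fs t.1 (sval t.2)].

Lemma inv_rel_graph F : rel_inv F -> inv (rel_graph F).
Proof. by move=> Fi g [o z]; apply: Fi. Qed.

Lemma fibers_inv Fs g o s : (forall i, (i < size Fs)%N -> rel_inv (nth (fun _ _ => False) Fs i)) ->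
  fibers Fs o s -> fibers Fs (gact g o) (list_act g s).
Proof.
elim: Fs s => [|F Fs IH] [|z s] //= Fi [Foz h]; split; first exact: (Fi 0%N).
by apply: IH h => i iF; apply: (Fi i.+1).
Qed.

Lemma inv_fiber_set Fs k : (forall i, (i < size Fs)%N -> rel_inv (nth (fun _ _ => False) Fs i)) ->
  inv (@fiber_set Fs k).
Proof. by move=> Fi g [o s]; apply: fibers_inv. Qed.

(** The class of a fiber product is the product of the classes; splitting off the head of the
    sequence is a fibration with fiber the graph of the first relation. *)
Lemma class_on_fibers Fs k : size Fs = k ->
  (forall i, (i < size Fs)%N -> rel_inv (nth (fun _ _ => False) Fs i)) ->
  class_on (gfst olig O (seqsg Z k)) tO (@fiber_set Fs k) =
  \prod_(F <- Fs) class_on (gfst olig O Z) tO (rel_graph F).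
Proof.
elim: Fs k => [|F Fs IH] [|k] //= sz Fi.
  rewrite big_nil -(@theta_class_iso P O O (gid O) tO); last by exists (gid O).
  pose nl : seqsg Z 0 := exist _ [::] erefl.
  have nE g o : (gact g o, nl) = @gact P (prodg O (seqsg Z 0)) g (o, nl).
    by congr pair; apply: seqs_eq.
  rewrite -class_onT.
  apply: (@class_on_bij _ _ _ _ (@GMap P O (prodg O (seqsg Z 0)) (fun o => (o, nl)) nE)) => //.
  - exact: inv_fiber_set.
  - move=> [o [[|z s] es]] //= _; exists o => //.
    by congr pair; apply: seqs_eq.
  - by move=> o o' _ _ [].
have Fi0 : rel_inv F := Fi 0%N isT.
have Fi' i : (i < size Fs)%N -> rel_inv (nth (fun _ _ => False) Fs i) by move=> h; apply: (Fi i.+1).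
rewrite big_cons -(IH k) //; last by case: sz.
pose h : gmap (prodg O (seqsg Z k.+1)) (prodg O (seqsg Z k)) :=
  gpair (gfst olig _ _) (comap (gbehead Z k) (gsnd olig _ _)).
pose q : gmap (prodg O (seqsg Z k.+1)) (prodg O Z) :=
  gpair (gfst olig _ _) (comap (ghead Z k) (gsnd olig _ _)).
have Si : inv (@fiber_set (F :: Fs) k.+1) by apply: inv_fiber_set.
rewrite -(@class_on_fibration _ _ _ _ _ _ h (gfst olig O (seqsg Z k)) (gfst olig O Z)
  (gfst olig O (seqsg Z k)) q _ _ (@fiber_set (F :: Fs) k.+1)) //.
- by apply: eq_class_on.
- exact: inv_fiber_set.
- exact: inv_rel_graph.
- by move=> [o [[|z s] es]] //= [Foz hs]; split.
move=> [o z] [o' [s es]] /= Foz hs eo; move: hs; rewrite -eo => hs.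
have es' : size (z :: s) = k.+1 by rewrite /= es.
exists (o, exist _ (z :: s) es'); split=> //.
  by congr pair; apply: seqs_eq.
move=> [w [[|z' s'] ew]] // _ qe he.
have /= -> := congr1 fst qe; congr pair; apply: seqs_eq => /=.
have /= -> := congr1 (fun t => sval (snd t)) he.
by congr cons; exact: (congr1 snd qe).
Qed.

End FiberClass.
End Fibers.

(** * Transversals of a free cyclic action *)

Section Transversals.
Variable P : perm_group.
Local Notation inv S := (invariant (@gact P _) S).
Variables (E X : smooth_gset P) (sigma : gmap E E) (phi : gmap E X) (tX : gtransitive X).
Variables (p : nat) (T : set E).
Hypothesis p_gt0 : (0 < p)%N.
Hypothesis sigma_p : forall t, iter p sigma t = t.
Hypothesis phi_sigma : forall t, phi (sigma t) = phi t.
Hypothesis T_inv : inv T.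
Hypothesis T_sigma : forall t, T t -> T (sigma t).

(** A G-stable fundamental domain in T for the cyclic group of order p generated by sigma. *)
Definition transversal (U : set E) : Prop :=
  [/\ inv U, U `<=` T & forall t, T t -> exists i,
    [/\ (i < p)%N, U (iter i sigma t) &
        forall j, (j < p)%N -> U (iter j sigma t) -> j = i]].

Lemma giter_subproof i g t : iter i sigma (gact g t) = gact g (iter i sigma t).
Proof. by elim: i => //= i ->; rewrite gfunE. Qed.

Definition giter i : gmap E E := GMap (giter_subproof i).

Lemma T_iter i t : T t -> T (iter i sigma t).
Proof. by move=> Tt; elim: i => //= i; apply: T_sigma. Qed.

Lemma phi_iter i t : phi (iter i sigma t) = phi t.
Proof. by elim: i => //= i <-; apply: phi_sigma. Qed.

Lemma iterK i t : (i <= p)%N -> iter (p - i) sigma (iter i sigma t) = t.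
Proof. by move=> ip; rewrite -iterD subnK. Qed.

Lemma iterKV i t : (i <= p)%N -> iter i sigma (iter (p - i) sigma t) = t.
Proof. by move=> ip; rewrite -iterD subnKC. Qed.

Lemma inv_iter_preim U i : inv U -> inv [set t | U (iter i sigma t)].
Proof. by move=> Ui g t /= h; rewrite giter_subproof; apply: Ui. Qed.

Lemma class_on_iter (S S' : set E) i : (i <= p)%N -> inv S -> inv S' ->
  (forall t, S' t <-> S (iter i sigma t)) ->
  class_on phi tX S = class_on phi tX S'.
Proof.
move=> ip Si S'i SS'; apply: (@class_on_bij _ _ _ _ (giter i)) => //.
- by move=> t /SS'; rewrite /= phi_iter.
- by move=> t St; exists (iter (p - i) sigma t); rewrite /= ?iterKV //; apply/SS'; rewrite iterKV.
- by move=> t u _ _ /= e; rewrite -(iterK t ip) e iterK.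
Qed.

Lemma class_on_transversal U : transversal U ->
  class_on phi tX T = class_on phi tX U *+ p.
Proof.
case=> Ui UT ex; rewrite (@class_on_partition _ _ _ _ _ _ (fun i => [set t | U (iter i sigma t)]) p) //.
- rewrite (eq_bigr (fun=> class_on phi tX U)) ?sumr_const ?card_ord // => i _.
  apply/esym/(@class_on_iter _ _ i) => //.
  + exact: ltnW.
  + by apply: invariant_setI => //; apply: inv_iter_preim.
  + move=> t; split=> [[]|] // h; split=> //; rewrite -(iterK t (ltnW (ltn_ord i))).
    exact/T_iter/UT.
by move=> i; apply: inv_iter_preim.
Qed.

(** Cut U by the rotates of U', and U' by the inverse rotates of U; the i-th pieces correspond under
    sigma^i. Cancelling p in [class_on_transversal] would be circular, since torsion-freeness is
    deduced from this independence. *)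
Lemma class_on_transversal_eq U U' : transversal U -> transversal U' ->
  class_on phi tX U = class_on phi tX U'.
Proof.
move=> [Ui UT ex] [U'i U'T ex'].
rewrite (@class_on_partition _ _ _ phi tX U (fun i => [set t | U' (iter i sigma t)]) p) //; last 2 first.
- by move=> i; apply: inv_iter_preim.
- by move=> t /UT/ex'.
rewrite (@class_on_partition _ _ _ phi tX U' (fun i => [set t | U (iter (p - i) sigma t)]) p) //; last 2 first.
- by move=> i; apply: inv_iter_preim.
- move=> t /U'T/ex[[|i] [ip Ut u]].
    exists 0%N; split=> //=; first by rewrite subn0 sigma_p.
    move=> [|j] // jp Uj; have := u (p - j.+1)%N _ Uj; rewrite ltn_subrL p_gt0 /=; lia.
  exists (p - i.+1)%N; split=> /=; [by rewrite ltn_subrL|by rewrite subKn // ltnW|].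
  move=> [|j] jp; first by rewrite subn0 sigma_p => Uj; have := u 0%N p_gt0 Uj.
  move=> Uj; have := u (p - j.+1)%N _ Uj; rewrite ltn_subrL p_gt0 /=; lia.
apply: eq_bigr => i _; apply/esym/(@class_on_iter _ _ i).
- exact: ltnW.
- by apply: invariant_setI => //; apply: inv_iter_preim.
- by apply: invariant_setI => //; apply: inv_iter_preim.
move=> t; split=> -[h1 h2]; first by split=> //=; rewrite iterK // ltnW.
by split=> //; move: h2; rewrite /= iterK // ltnW.
Qed.

(** Choose one element in each joint orbit of G and sigma, and let U be the union of the G-orbits of
    the chosen elements; freeness makes the exponent unique. *)
Lemma transversal_exists :
  (forall t i, T t -> (0 < i < p)%N -> ~ orbit (@gact P E) t (iter i sigma t)) ->
  exists U, transversal U.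
Proof.
move=> free; pose K t : set E := [set u | exists i g, u = gact g (iter i sigma t)].
have Kt t : exists u, K t u by exists t, 0%N, 1%g; rewrite gact1.
pose rep t := sval (cid (Kt t)).
(* The choice is made from the set [K t], so it depends only on the joint orbit. *)
have repK t u : K t = K u -> rep t = rep u.
  rewrite /rep; move: (Kt t) (Kt u) => + + e; rewrite e => h h'.
  by rewrite (Prop_irrelevance h h').
have iterM i t : iter (i %% p) sigma t = iter i sigma t.
  rewrite {2}(divn_eq i p) addnC iterD; congr iter.
  by elim: (i %/ p)%N => //= n IH; rewrite mulSn iterD -IH sigma_p.
have Kact g t : K (gact g t) = K t.
  apply/seteqP; split=> _ [i [h ->]].
    by exists i, (h * g)%g; rewrite giter_subproof gactM.
  by exists i, (h * g^-1)%g; rewrite giter_subproof -gactM mulgVK.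
have Kiter i t : K (iter i sigma t) = K t.
  apply/seteqP; split=> _ [j [h ->]]; first by exists (j + i)%N, h; rewrite iterD.
  exists (j + (p - i %% p))%N, h; rewrite iterD -[iter i _ _]iterM iterK //.
  exact/ltnW/ltn_pmod.
exists [set t | T t /\ exists g, t = gact g (rep t)]; split.
- move=> g t [Tt [h e]]; split; first exact: T_inv.
  by exists (g * h)%g; rewrite (repK _ _ (Kact g t)) gactM -e.
- by move=> t [].
move=> t Tt; have [i [g rE]] := svalP (cid (Kt t)).
exists (i %% p)%N; split; first exact: ltn_pmod.
  split; first exact: T_iter.
  by exists g^-1%g; rewrite (repK _ _ (Kiter _ t)) iterM /rep rE actK //; [apply: gact1|apply: gactM].
move=> j jp [_ [h]]; rewrite (repK _ _ (Kiter j t)) => jE.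
have ip := ltn_pmod i p_gt0.
have iE : iter (i %% p) sigma t = gact g^-1%g (rep t).
  by rewrite iterM /rep rE actK //; [apply: gact1|apply: gactM].
have orb a b : (a < b)%N -> (b < p)%N ->
    (exists g, iter b sigma t = gact g (iter a sigma t)) -> False.
  move=> ab bp [k e]; apply: (free (iter a sigma t) (b - a)%N); first exact: T_iter.
    by rewrite subn_gt0 ab /=; lia.
  by exists k => //; rewrite -e -iterD subnK // ltnW.
have [jlt|jgt|//] := ltngtP j (i %% p)%N.
  case: (orb _ _ jlt ip); exists (g^-1 * h^-1)%g.
  by rewrite iE jE gactM actK //; [apply: gact1|apply: gactM].
case: (orb _ _ jgt jp); exists (h * g)%g.
by rewrite iE jE gactM actKV //; [apply: gact1|apply: gactM].
Qed.

End Transversals.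

(** * Freeness of cyclic rotations *)

Lemma iter_mul_fix (T : Type) (f : T -> T) p k t : iter p f t = t -> iter (k * p) f t = t.
Proof. by move=> e; elim: k => // k IH; rewrite mulSn iterD IH. Qed.

Lemma iter_coprime_fix (T : Type) (f : T -> T) p i t : (0 < i)%N -> coprime i p ->
  iter p f t = t -> iter i f t = t -> f t = t.
Proof.
move=> i0 /eqP cip ep ei; case: (egcdnP p i0) => a b e _.
have := iter_mul_fix a ei; rewrite e cip addn1 /= iter_mul_fix //.
Qed.

Lemma iter_rot1 (T : Type) (s : seq T) i : (i <= size s)%N -> iter i (rot 1) s = rot i s.
Proof.
elim: i => [|i IH] h; first by rewrite rot0.
by rewrite /= IH ?(ltnW h) // -rotS.
Qed.

Lemma iter_rot1_size (T : Type) (s : seq T) : iter (size s) (rot 1) s = s.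
Proof. by rewrite iter_rot1 // rot_size. Qed.

Lemma rot1_fix (T : Type) (s : seq T) p i : prime p -> size s = p -> (0 < i < p)%N ->
  iter i (rot 1) s = s -> rot 1 s = s.
Proof.
move=> pp sp /andP[i0 ip]; apply: (@iter_coprime_fix _ _ p) => //.
  by rewrite coprime_sym prime_coprime //; apply/negP => /dvdn_leq; lia.
by rewrite -sp iter_rot1_size.
Qed.

Lemma prime_dvd_card_free (T : finType) (f : T -> T) p : prime p ->
  (forall x, iter p f x = x) -> (forall x, f x <> x) -> (p %| #|T|)%N.
Proof.
move=> pp fp fx; have p0 := prime_gt0 pp.
have fI : injective f.
  move=> x y e; rewrite -[x]fp -[y]fp -(prednK p0) !iterSr e //.
pose s := perm fI.
have sp : (s ^+ p = 1)%g.
  apply/perm.permP => x; rewrite perm1 permX -[RHS]fp.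
  by apply: eq_iter => y; rewrite permE.
have pg : (p.-group <[s]>)%g.
  rewrite /pgroup -/(#[s]%g); apply: (@pnat_dvd _ p); last exact: pnat_id.
  by rewrite order_dvdn sp.
have acts : [acts <[s]>%g, on [set: T]%SET | 'P].
  by apply/fintype.subsetP => y _; rewrite !inE; apply/fintype.subsetP => x _; rewrite !inE.
have := pgroup_fix_mod pg acts; rewrite cardsT => /eqP.
have -> : #|('Fix_([set: T]%SET | 'P)(<[s]>))%g| = 0%N.
  apply: eq_card0 => x; apply/negP; rewrite finset.in_setI => /andP[_].
  rewrite afix_cycle ?finset.in_setT // => /afix1P; rewrite /= apermE permE; exact: fx.
by rewrite mod0n.
Qed.

Lemma prime_dvd_free (T : Type) (C : set T) (f : T -> T) p d : prime p ->
  (C #= `I_d)%card -> (forall x, C x -> C (f x)) ->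
  (forall x, C x -> iter p f x = x) -> (forall x, C x -> f x <> x) -> (p %| d)%N.
Proof.
move=> pp /card_set_bijP[e [eC eI eS]] fC fp fx.
have inv (i : 'I_d) : exists x, C x /\ e x = i.
  by have [x Cx xe] := eS i (ltn_ord i); exists x.
pose r (i : 'I_d) := sval (cid (inv i)).
have rC i : C (r i) by have [] := svalP (cid (inv i)).
have re i : e (r i) = i by have [] := svalP (cid (inv i)).
have elt x : C x -> (e x < d)%N by move=> Cx; apply: (eC x).
pose F (i : 'I_d) := Ordinal (elt _ (fC _ (rC i))).
have eI' x y : C x -> C y -> e x = e y -> x = y.
  by move=> Cx Cy; apply: eI; rewrite inE.
have rF i : r (F i) = f (r i).
  by apply: eI'; rewrite ?re //; apply: (fC _ (rC i)).
have rI : injective r by move=> i j /(congr1 e); rewrite !re => /val_inj.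
have riter n i : r (iter n F i) = iter n f (r i) by elim: n => //= n <-; rewrite rF.
have Fp i : iter p F i = i by apply: rI; rewrite riter fp.
have Ff i : F i <> i by move/(congr1 r); rewrite rF; apply: fx.
by rewrite -(card_ord d); apply: prime_dvd_card_free Fp Ff.
Qed.

Section Freeness.
Variables (P : perm_group) (m : nat).
Hypothesis olig : oligomorphic P.
Hypothesis ind : Ind P m.

Local Notation fixed A := [set a | forall h : P, fixer A h -> pact h a = a].

(** If a lists A, two points x, y fixed by G(A) with x :: a and y :: a in one orbit are equal, and
    there are finitely many orbits on tuples of that length. *)
Lemma fixed_finite (A : set (pts P)) : finite_set A -> finite_set (fixed A).
Proof.
move=> /fixer_list[a aA]; pose psi (x : pts P) := orbit (@tuple_act P) (x :: a).
have psi_inj : {in fixed A &, injective psi}.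
  move=> x y /[!inE] /= hx hy e.
  have [h _ [hxy ha]] : psi x (y :: a) by rewrite e; exists 1%g => //; apply: tuple_act1.
  by rewrite -hxy hx // -aA.
rewrite -(eq_finite_set (inj_card_eq psi_inj)).
apply: sub_finite_set (olig (size a).+1) => _ [x _ <-].
by exists (x :: a).
Qed.

Lemma fixer_fixed (A : set (pts P)) : fixer (fixed A) = fixer A.
Proof.
apply/seteqP; split=> g; first by move=> h x Ax; apply: h => k; apply.
by move=> h x; apply.
Qed.

(* If an element g rotates a list of fixers then it acts on Fix(Fix(A)) with   *)
(* order p modulo G(A), so that p divides an index as in Ind m.                *)
Lemma rotation_free (Y : smooth_gset P) (s : seq Y) p i (g : P) :
  prime p -> ~~ (p %| m)%N -> size s = p -> rot 1 s <> s -> (0 < i < p)%N ->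
  list_act g s <> iter i (rot 1) s.
Proof.
move=> pp pm sp ns ip gs; have [A fA sA] := list_smooth s.
(* The element g normalizes G(A) but may move A; the fixed set B of G(A) has the same fixer and is
   preserved by g. *)
pose B := fixed A; have fB : finite_set B := fixed_finite fA.
have AB : fixer B = fixer A := fixer_fixed A.
have rotact h j t : list_act h (iter j (rot 1) t) = iter j (rot 1) (list_act h t) :> seq Y.
  by elim: j => //= j <-; rewrite /list_act map_rot.
have stE h : fixer A h <-> list_act h s = s by rewrite -sA.
have gV : list_act g^-1%g s = iter (p - i) (rot 1) s.
  have [i0 ip'] := andP ip.
  have rI : injective (iter i (rot 1 (T := Y))).
    by elim: (i) => [|j IH] x y //= /rot_inj/IH.
  apply: rI; rewrite -rotact -iterD subnKC ?(ltnW ip') // -sp iter_rot1_size.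
  by rewrite -gs -list_actM mulVg list_act1.
have conj h : fixer A h -> fixer A (g^-1 * h * g)%g.
  move/stE => hs; apply/stE; rewrite !list_actM gs rotact hs -gs.
  by rewrite -list_actM mulVg list_act1.
have conjV h : fixer A h -> fixer A (g * h * g^-1)%g.
  move/stE => hs; apply/stE; rewrite !list_actM gV rotact hs -gV.
  by rewrite -list_actM mulgV list_act1.
have Bg : setwise_stab B g.
  apply/seteqP; split=> [_ [x Bx <-] h hA|x Bx].
    have -> : pact h (pact g x) = pact g (pact (g^-1 * h * g)%g x).
      by rewrite -!pactM !mulgA mulgV mul1g.
    by rewrite (Bx _ (conj _ hA)).
  exists (pact g^-1%g x); last by rewrite -pactM mulgV pact1.
  move=> h hA; have -> : pact h (pact g^-1%g x) = pact g^-1%g (pact (g * h * g^-1)%g x).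
    by rewrite -!pactM !mulgA mulVg mul1g.
  by rewrite (Bx _ (conjV _ hA)).
have [d hd [k dk]] := ind fB.
(* Left multiplication by g permutes the cosets of G(B) in G[B]. Its p-th power is the identity
   since g^p fixes s, and a fixed coset would, by normality, put g in G(B), so that s would be
   constant. *)
have pk : (p %| d)%N.
  have normal x h : setwise_stab B x -> fixer B h -> fixer B (x^-1 * h * x)%g.
    move=> xB hB a Ba; have : B (pact x a) by rewrite -xB; exists a.
    by move/hB => e; rewrite !pactM e -pactM mulVg pact1.
  have normal' x h : setwise_stab B x -> fixer B h -> fixer B (x * h * x^-1)%g.
    move=> xB hB a; rewrite -{1}xB => -[b Bb <-].
    by rewrite -!pactM -mulgA mulVg mulg1 pactM hB.
  pose f (c : set P) := [set (g * x)%g | x in c].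
  have fE x : f [set (x * h)%g | h in fixer B] = [set (g * x * h)%g | h in fixer B].
    apply/seteqP; split=> [_ [_ [h hB <-] <-]|_ [h hB <-]].
      by exists h => //; rewrite mulgA.
    by exists (x * h)%g; [exists h|rewrite mulgA].
  have fn n x : iter n f [set (x * h)%g | h in fixer B] = [set (g ^+ n * x * h)%g | h in fixer B].
    elim: n => [|n IH] /=; first by rewrite expg0 mul1g.
    by rewrite IH fE expgS mulgA.
  have stabM x y : setwise_stab B x -> setwise_stab B y -> setwise_stab B (x * y)%g.
    rewrite /setwise_stab /= => xB yB; rewrite -{2}xB -{2}yB image_comp.
    by apply: eq_imagel => a _; rewrite pactM.
  have gp : fixer B (g ^+ p)%g.
    rewrite AB; apply/stE; have gn n : list_act (g ^+ n)%g s = iter (n * i) (rot 1) s.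
      elim: n => [|n IH]; first by rewrite expg0 list_act1.
      by rewrite expgS list_actM IH rotact gs mulSn addnC iterD.
    by rewrite gn mulnC -sp iter_mul_fix // iter_rot1_size.
  apply: (prime_dvd_free (f := f) pp hd).
  - move=> _ [x xB <-]; rewrite fE; exists (g * x)%g => //; exact: stabM.
  - move=> _ [x xB <-]; rewrite fn; apply/seteqP; split=> [_ [h hB <-]|_ [h hB <-]].
      exists (x^-1 * g ^+ p * x * h)%g; last by rewrite !mulgA mulgV mul1g.
      by move=> a Ba; rewrite pactM hB //; apply: (normal _ _ xB gp).
    exists (x^-1 * (g ^+ p)^-1 * x * h)%g; last by rewrite !mulgA mulgK mulgV mul1g.
    move=> a Ba; rewrite pactM hB //; apply: (normal _ _ xB) => // b Bb.
    by rewrite -{1}(gp b Bb) -pactM mulVg pact1.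
  move=> _ [x xB <-]; rewrite fE => e.
  have : [set (x * h)%g | h in fixer B] (g * x * 1)%g.
    by rewrite -e; exists 1%g => // a _; apply: pact1.
  case=> h hB; rewrite mulg1 => xh.
  have : fixer B g.
    have -> : g = (x * h * x^-1)%g by rewrite xh mulgK.
    exact: normal'.
  rewrite AB => /stE; rewrite gs => /(rot1_fix pp sp ip).
  exact: ns.
have := dvdn_trans pk dk; rewrite Euclid_dvdX // => /andP[pm' _].
by rewrite pm' in pm.
Qed.

End Freeness.

(** * Binary words up to rotation *)

Lemma iter_rot1_inj (T : Type) i : injective (iter i (rot 1 (T := T))).
Proof. by elim: i => [|i IH] s t //= /rot_inj/IH. Qed.

Lemma rot1_nseq (T : Type) n (x : T) : rot 1 (nseq n x) = nseq n x.
Proof. by case: n => //= n; rewrite rot1_cons; elim: n => //= n ->. Qed.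

Lemma rot1_fixed (T : Type) (x : T) (s : seq T) :
  rot 1 (x :: s) = x :: s -> s = nseq (size s) x.
Proof.
rewrite rot1_cons; elim: s => //= y s IH [yx e].
by rewrite yx in e *; congr cons; apply: IH.
Qed.

Section Words.
Variable p : nat.
Hypothesis pp : prime p.
Local Notation word := (p.-tuple bool).
Local Notation shift i w := (iter i (fun v : word => [tuple of rot 1 v]) w).

Lemma val_shift i (w : word) : shift i w = iter i (rot 1) w :> seq bool.
Proof. by elim: i => //= i ->. Qed.

Lemma shift_p (w : word) : shift p w = w.
Proof. by apply: val_inj; rewrite /= val_shift -{1}(size_tuple w) iter_rot1_size. Qed.

Lemma shift_mod i (w : word) : shift (i %% p) w = shift i w.
Proof.
by rewrite {2}(divn_eq i p) addnC iterD iter_mul_fix // shift_p.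
Qed.

Lemma shift_bij i : bijective (fun w : word => shift i w).
Proof.
have ip : (i %% p <= p)%N by rewrite ltnW // ltn_pmod // prime_gt0.
exists (fun w => shift (p - i %% p) w) => w.
  by rewrite -(shift_mod i) -iterD subnK // shift_p.
by rewrite -(shift_mod i) -iterD subnKC // shift_p.
Qed.

Definition nonconst (w : word) : bool := rot 1 w != w.

Lemma nonconst_shift i w : nonconst (shift i w) = nonconst w.
Proof.
congr negb; rewrite val_shift.
have -> : rot 1 (iter i (rot 1) w) = iter i (rot 1) (rot 1 w) by rewrite -iterS iterSr.
elim: i => //= i IH; rewrite (inj_eq (@rot_inj _ _)); exact: IH.
Qed.

Lemma shift_inj w i j : nonconst w -> (i < p)%N -> (j < p)%N ->
  shift i w = shift j w -> i = j.
Proof.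
have lt a b : nonconst w -> (a < b)%N -> (b < p)%N -> shift a w = shift b w -> False.
  move=> nw ab bp /(congr1 val) /=; rewrite !val_shift -(subnK (ltnW ab)) addnC iterD => e.
  move/eqP: nw; apply; apply: (@rot1_fix _ _ p (b - a)) => //.
  - exact: size_tuple.
  - by rewrite subn_gt0 ab /=; lia.
  by move/iter_rot1_inj: e.
by move=> nw ip jp e; case: (ltngtP i j) => // /lt[].
Qed.

(** Picks one word in each rotation class of non-constant words, the first one in an arbitrary
    enumeration. *)
Definition word_rep (w : word) : bool :=
  nonconst w && [forall i : 'I_p, (enum_rank w <= enum_rank (shift i w))%N].

Lemma word_rep_transversal (w : word) : nonconst w -> exists i,
  [/\ (i < p)%N, word_rep (shift i w) &
      forall j, (j < p)%N -> word_rep (shift j w) -> j = i].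
Proof.
move=> nw; have p0 := prime_gt0 pp.
have [i _ imin] := @arg_minnP _ (Ordinal p0) xpredT (fun i => enum_rank (shift i w)) isT.
have min k : (enum_rank (shift i w) <= enum_rank (shift k w))%N.
  by rewrite -(shift_mod k); apply: (imin (Ordinal (ltn_pmod k p0)) isT).
exists i; split=> //.
  rewrite /word_rep nonconst_shift nw /=; apply/forallP => k.
  by rewrite -iterD.
move=> j jp /andP[_ /forallP jmin].
have [k ke] : exists k : 'I_p, shift k (shift j w) = shift i w.
  exists (Ordinal (ltn_pmod (i + (p - j)) p0)); rewrite /= shift_mod -iterD -addnA subnK ?(ltnW jp) //.
  by rewrite iterD shift_p.
apply: (shift_inj nw) => //; apply: enum_rank_inj; apply: val_inj => /=.
by apply/eqP; rewrite eqn_leq min andbT -ke; apply: jmin.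
Qed.

Section Sums.
Variables (R : comPzRingType) (x y : R).
Definition word_prod (w : word) : R := \prod_(b <- w) (if b then x else y).

Lemma word_prod_shift i w : word_prod (shift i w) = word_prod w.
Proof.
rewrite /word_prod val_shift; elim: i => //= i <-.
by apply: perm_big; rewrite perm_rot.
Qed.

Lemma sum_word_prod : \sum_w word_prod w = (x + y) ^+ p.
Proof.
have -> : (x + y) ^+ p = \prod_(i < p) \sum_(b : bool) (if b then x else y).
  rewrite (eq_bigr (fun=> x + y)) ?prodr_const ?card_ord // => i _.
  by rewrite (bigD1 true) //= (big_pred1 false) // => -[].
rewrite bigA_distr_bigA (reindex (fun w : word => [ffun i => tnth w i])) /=.
  apply: eq_bigr => w _; rewrite /word_prod big_tuple.
  by apply: eq_bigr => i _; rewrite ffunE.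
exists (fun f => [tuple f i | i < p]) => [w _|f _].
  by apply: eq_from_tnth => i; rewrite tnth_mktuple ffunE.
by apply/ffunP => i; rewrite ffunE tnth_mktuple.
Qed.

Lemma const_wordP w : ~~ nonconst w -> exists b, w = [tuple of nseq p b].
Proof.
rewrite negbK; case: w => -[|b s] /= sp /eqP e.
  by exists true; apply: val_inj; rewrite /= -(eqP sp).
by exists b; apply: val_inj; rewrite /= {1}(rot1_fixed e) -(eqP sp).
Qed.

Lemma sum_const_words : \sum_(w | ~~ nonconst w) word_prod w = x ^+ p + y ^+ p.
Proof.
have p0 := prime_gt0 pp; pose cw b : word := [tuple of nseq p b].
have cn b : ~~ nonconst (cw b) by rewrite negbK; apply/eqP/rot1_nseq.
have cwP b : word_prod (cw b) = (if b then x else y) ^+ p.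
  by rewrite /word_prod big_nseq iter_mulr_1.
have ct : cw true != cw false.
  by rewrite -val_eqE /=; case: (p) p0.
rewrite (bigD1 (cw true)) //= (bigD1 (cw false)) /=; last by rewrite cn eq_sym.
rewrite !cwP big1 ?addr0 // => w /andP[/andP[/const_wordP[[] ->]]].
  by rewrite eqxx.
by rewrite !eqxx.
Qed.

Lemma sum_word_rep_mulrn :
  (\sum_(w | word_rep w) word_prod w) *+ p = (x + y) ^+ p - x ^+ p - y ^+ p.
Proof.
rewrite -addrA -opprD -sum_const_words -sum_word_prod [X in X - _](bigID nonconst) /= addrK.
have -> : (\sum_(w | word_rep w) word_prod w) *+ p =
    \sum_(i < p) \sum_(w | word_rep (shift i w)) word_prod w.
  transitivity (\sum_(i < p) \sum_(w | word_rep w) word_prod w).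
    by rewrite sumr_const card_ord.
  apply: eq_bigr => i _.
  rewrite (reindex _ (onW_bij _ (shift_bij i))).
  by apply: eq_bigr => w _; rewrite word_prod_shift.
rewrite (exchange_big_dep nonconst) /=; last first.
  by move=> i w _ /andP[]; rewrite nonconst_shift.
apply: eq_bigr => w nw; have [i [ip wi u]] := word_rep_transversal nw.
rewrite (big_pred1 (Ordinal ip)) // => j /=; apply/idP/eqP => [|-> //].
by move/u => h; apply/val_inj/h.
Qed.

End Sums.

(** All words sum to (x + y)^p and the constant ones to x^p + y^p, while the non-constant ones fall
    into classes of p rotations with equal products. The factor p is cancelled by universality. *)
Lemma sum_word_rep (R : comPzRingType) (x y : R) :
  \sum_(w | word_rep w) word_prod x y w = wittP p x y.
Proof.
apply: (@universal_identity p pp (fun R x y _ => \sum_(w | word_rep w) word_prod x y w)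
  (fun R x y _ => wittP p x y)) => //.
- move=> S T f a b _; rewrite rmorph_sum; apply: eq_bigr => w _.
  by rewrite rmorph_prod; apply: eq_bigr => -[].
- by move=> *; apply: rmorph_wittP.
by move=> S a b _; rewrite sum_word_rep_mulrn wittP_mulrn.
Qed.
End Words.

(** * Cyclic powers *)

Lemma fibers_nseqP (O Z : Type) (F : O -> Z -> Prop) k o s :
  fibers (nseq k F) o s <-> size s = k /\ forall z, List.In z s -> F o z.
Proof.
elim: k s => [|k IH] [|z s] /=; first by split.
- by split=> // -[].
- by split=> // -[].
rewrite IH; split=> [[Fz [<- h]]|[[<-] h]].
  by split=> // y [<-|/h].
by split; [apply: h; left|split=> // y ys; apply: h; right].
Qed.

Lemma In_rot1 (T : Type) (x : T) (s : seq T) : List.In x (rot 1 s) <-> List.In x s.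
Proof.
case: s => // y s; rewrite rot1_cons.
elim: s => [|z s IH] //=; split.
  by case=> [e|/IH[e|h]]; [right; left|left|right; right].
by case=> [e|[e|h]]; [right; apply/IH; left|left|right; apply/IH; right].
Qed.

Lemma In_map (T U : Type) (f : T -> U) (s : seq T) u :
  List.In u [seq f x | x <- s] <-> exists2 x, List.In x s & f x = u.
Proof.
elim: s => [|x s IH] /=; first by split=> // -[].
split=> [[<-|/IH[y ys <-]]|[y [<- <-|ys yu]]].
- by exists x => //; left.
- by exists y => //; right.
- by left.
- by right; apply/IH; exists y.
Qed.

Lemma map_inj_In (T U : Type) (f : T -> U) (s t : seq T) :
  (forall x y, List.In x s -> List.In y t -> f x = f y -> x = y) ->
  map f s = map f t -> s = t.
Proof.
elim: s t => [|x s IH] [|y t] //= h [e1 e2]; congr cons.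
  by apply: h e1; left.
by apply: IH e2 => a b sa tb; apply: h; right.
Qed.

Lemma map_In_lift (T U : Type) (f : T -> U) (Q : T -> Prop) (s : seq U) :
  (forall u, List.In u s -> exists2 x, Q x & f x = u) ->
  exists2 t, (forall x, List.In x t -> Q x) & map f t = s.
Proof.
elim: s => [|u s IH] h; first by exists [::].
have [x Qx fx] := h u (or_introl erefl).
have [|t Qt ft] := IH; first by move=> v vs; apply: h; right.
by exists (x :: t); [move=> y [<-|/Qt]|rewrite /= fx ft].
Qed.

Section CyclicPowers.
Variables (P : perm_group) (p : nat).
Hypothesis olig : oligomorphic P.
Hypothesis pp : prime p.
Local Notation inv S := (invariant (@gact P _) S).
Local Notation prodg := (prod_gset olig).
Local Notation seqsg := (seqs_gset olig).
Implicit Types X Y Z : smooth_gset P.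

Section Rotation.
Variables X Y : smooth_gset P.
Local Notation E := (prodg X (seqsg Y p)).

Lemma pair_seq_eq (t u : E) : t.1 = u.1 -> sval t.2 = sval u.2 -> t = u.
Proof. by case: t u => [x s] [y r] /= -> /seqs_eq ->. Qed.

Lemma size_rot_seqs (s : seqsg Y p) : size (rot 1 (sval s)) = p.
Proof. by rewrite size_rot (svalP s). Qed.

Definition rot_seqs (s : seqsg Y p) : seqsg Y p := exist _ (rot 1 (sval s)) (size_rot_seqs s).

Lemma rot_seqs_subproof g s : rot_seqs (gact g s) = gact g (rot_seqs s).
Proof. by apply: seqs_eq; rewrite /= /list_act map_rot. Qed.

Definition grot : gmap (seqsg Y p) (seqsg Y p) := GMap rot_seqs_subproof.

Definition csigma : gmap E E :=
  gpair olig (gfst olig X (seqsg Y p)) (comap grot (gsnd olig X (seqsg Y p))).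

Lemma iter_csigma1 i t : (iter i csigma t).1 = t.1.
Proof. by elim: i => //= i ->. Qed.

Lemma iter_csigma2 i t : sval (iter i csigma t).2 = iter i (rot 1) (sval t.2).
Proof. by elim: i => //= i ->. Qed.

Lemma csigma_p t : iter p csigma t = t.
Proof.
apply: pair_seq_eq; first exact: iter_csigma1.
by rewrite iter_csigma2 -{1}(svalP t.2) iter_rot1_size.
Qed.

Definition over (f : gmap Y X) (x : X) (y : Y) : Prop := f y = x.

(* the complement of the diagonal in the p-fold fiber power of f *)
Definition cyc_dom (f : gmap Y X) : set E :=
  [set t | fibers (nseq p (over f)) t.1 (sval t.2) /\ rot 1 (sval t.2) <> sval t.2].

Lemma over_inv (f : gmap Y X) : rel_inv (over f).
Proof. by move=> g x y; rewrite /over gfunE => ->. Qed.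

Lemma cyc_domP (f : gmap Y X) t : cyc_dom f t <->
  (forall y, List.In y (sval t.2) -> f y = t.1) /\ rot 1 (sval t.2) <> sval t.2.
Proof.
split=> [[/fibers_nseqP[_ h] n]|[h n]] //; split=> //.
by apply/fibers_nseqP; split=> //; exact: (svalP t.2).
Qed.

Lemma nth_nseq_inv (f : gmap Y X) i : (i < size (nseq p (over f)))%N ->
  rel_inv (nth (fun _ _ => False) (nseq p (over f)) i).
Proof. by rewrite size_nseq nth_nseq => ->; apply: over_inv. Qed.

Lemma rot1_list_act g (s : seq Y) : rot 1 (list_act g s) = list_act g s <-> rot 1 s = s.
Proof.
rewrite /list_act -map_rot; split=> [|-> //].
by apply: map_inj_In => x y _ _; apply: (act_inj (@gact1 P Y) (@gactM P Y)).
Qed.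

Lemma inv_cyc_dom (f : gmap Y X) : inv (cyc_dom f).
Proof.
move=> g t [h n]; split; last by move/rot1_list_act.
by apply: fibers_inv h => i; apply: nth_nseq_inv.
Qed.

Lemma cyc_dom_sigma (f : gmap Y X) t : cyc_dom f t -> cyc_dom f (csigma t).
Proof.
move/cyc_domP=> [h n]; apply/cyc_domP; split=> [y /In_rot1/h|] //=.
by move/rot_inj.
Qed.

Definition cyc_transversal (f : gmap Y X) (U : set E) : Prop :=
  transversal csigma p (cyc_dom f) U.

Lemma cyc_transversal_eq (f : gmap Y X) tX U U' :
  cyc_transversal f U -> cyc_transversal f U' ->
  class_on (gfst olig X (seqsg Y p)) tX U = class_on (gfst olig X (seqsg Y p)) tX U'.
Proof.
exact: (class_on_transversal_eq tX (prime_gt0 pp) csigma_p).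
Qed.

Lemma rot1_fixP (y : Y) (s : seq Y) : rot 1 s = s -> List.In y s -> s = nseq (size s) y.
Proof.
case: s => [_ []|z s h]; have e := rot1_fixed h.
have nz n : List.In y (nseq n z) -> y = z by elim: n => //= n IH [->|/IH].
by case=> [<-|]; [|rewrite {1}e => /nz ->]; rewrite /= -e.
Qed.

(* The diagonal of the fiber power is a copy of Y, and its complement splits  *)
(* into the p rotations of U.                                                 *)
Lemma theta_class_pow (f : gmap Y X) tX U : cyc_transversal f U ->
  theta_class f tX ^+ p = theta_class f tX +
    class_on (gfst olig X (seqsg Y p)) tX U *+ p.
Proof.
move=> tU; have p0 := prime_gt0 pp.
rewrite -(class_on_transversal (phi := gfst olig X (seqsg Y p)) tX csigma_p (fun=> erefl) (@inv_cyc_dom f) (@cyc_dom_sigma f) tU).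
pose FS := @fiber_set _ olig X Y (nseq p (over f)) p.
have FSi : inv FS by apply: inv_fiber_set => i; apply: nth_nseq_inv.
have graphE : class_on (gfst olig X Y) tX (rel_graph (olig := olig) (over f)) = theta_class f tX.
  rewrite -class_onT; apply: (@class_on_bij _ _ _ _ (gpair olig f (gid Y))) => //.
  - exact: (inv_rel_graph (@over_inv f)).
  - by move=> [x y] e; exists y => //; congr pair; exact: e.
  - by move=> y y' _ _ /(congr1 snd).
have -> : theta_class f tX ^+ p = class_on (gfst olig X (seqsg Y p)) tX FS.
  rewrite class_on_fibers ?size_nseq //; last by move=> i ip; apply: nth_nseq_inv; rewrite size_nseq.
  by rewrite big_nseq iter_mulr_1 graphE.
have -> : FS = (FS `\` cyc_dom f) `|` cyc_dom f.
  rewrite setDE; apply/seteqP; split=> t; last by case=> [[]|[]].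
  by have [h|h] := pselect (cyc_dom f t); [right|left].
rewrite class_onU.
- congr (_ + _); rewrite -class_onT.
  have nE g y : (exist _ (nseq p (gact g y)) (size_nseq p _) : seqsg Y p) =
      gact g (exist _ (nseq p y) (size_nseq p _) : seqsg Y p).
    by apply: seqs_eq; rewrite /= /list_act map_nseq.
  pose diag : gmap Y (seqsg Y p) := @GMap P Y (seqsg Y p) (fun y => exist _ (nseq p y) (size_nseq p y)) nE.
  apply: (@class_on_bij _ _ _ _ (gpair olig f diag)) => //.
  + exact: (invariant_setD (@gact1 P E) (@gactM P E) FSi (@inv_cyc_dom f)).
  + move=> y _; split=> //; split=> /=; last by case=> _; rewrite rot1_nseq.
    apply/fibers_nseqP; rewrite /= size_nseq; split=> // z.
    by elim: (p) => //= n IH [->|/IH].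
  + move=> [x s] [/= hs ns]; move: (hs) => /fibers_nseqP[_ hx].
    have e : rot 1 (sval s) = sval s.
      by have [//|h] := pselect (rot 1 (sval s) = sval s); case: ns; split.
    have [y ys] : exists y, List.In y (sval s).
      by case: (s) => [[|y r] sr]; [have := p0; rewrite -{1}sr|exists y; left].
    exists y => //; apply: pair_seq_eq => /=; first exact: hx.
    by rewrite [RHS](rot1_fixP e ys) (svalP s).
  + by move=> y y' _ _ /(congr1 (fun t => sval t.2)) /=; rewrite -(prednK p0) => -[].
- exact: (invariant_setD (@gact1 P E) (@gactM P E) FSi (@inv_cyc_dom f)).
- exact: inv_cyc_dom.
by rewrite setDE -setIA setICl setI0.
Qed.

End Rotation.

End CyclicPowers.

Lemma fibers_nthP (O Z Y : Type) (h : Z -> Y) (u : O -> seq Y) y0 j k o s :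
  (j + k <= size (u o))%N ->
  fibers [seq (fun o z => h z = nth y0 (u o) i) | i <- iota j k] o s <->
  map h s = take k (drop j (u o)).
Proof.
elim: k j s => [|k IH] j s; first by rewrite take0; case: s.
rewrite addnS -addSn => jk; rewrite (drop_nth y0) /=; last by lia.
case: s => [|z s] //=; rewrite IH //.
by split=> [[-> ->]|[-> ->]].
Qed.

(** * D on isomorphisms, base changes and composites *)

Section DeltaRelations.
Variables (P : perm_group) (m p : nat).
Hypothesis olig : oligomorphic P.
Hypothesis ind : Ind P m.
Hypothesis pp : prime p.
Hypothesis pm : ~~ (p %| m)%N.
Local Notation inv S := (invariant (@gact P _) S).
Local Notation prodg := (prod_gset olig).
Local Notation seqsg := (seqs_gset olig).
Local Notation cpow X Y := (prodg X (seqsg Y p)).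
Local Notation proj X Y := (gfst olig X (seqsg Y p)).
Local Notation csig X Y := (csigma p olig X Y).
Local Notation trans f U := (@cyc_transversal P p olig _ _ f U).
Local Notation dom f := (@cyc_dom P p olig _ _ f).
Implicit Types X Y Z : smooth_gset P.

Lemma cyc_transversal_exists Y X (f : gmap Y X) : exists U, trans f U.
Proof.
apply: transversal_exists.
- exact: prime_gt0.
- exact: csigma_p.
- exact: inv_cyc_dom.
- exact: cyc_dom_sigma.
move=> t i [ht nt] ip [g _ e].
apply: (rotation_free olig ind pp pm (svalP t.2) nt ip (g := g)).
by have /(congr1 (fun u => sval u.2)) := e; rewrite iter_csigma2.
Qed.

(** Fibers have at most one point, so the fiber power is reduced to its diagonal. *)
Lemma cyc_transversal_injective Y X (f : gmap Y X) tX U : injective f -> trans f U ->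
  class_on (proj X Y) tX U = 0.
Proof.
move=> fI [Ui UT _]; rewrite -(class_on0 (proj X Y) tX); congr class_on.
apply/seteqP; split=> // t /UT/cyc_domP[h n]; apply: n.
case: t h => x [[|y s] ss] //= h.
suff -> : s = nseq (size s) y by rewrite -[y :: nseq _ _]/(nseq (size s).+1 y) rot1_nseq.
have : forall z, List.In z s -> z = y.
  by move=> z zs; apply: fI; rewrite (h z (or_intror zs)) (h y (or_introl erefl)).
elim: s {ss h} => //= z s IH h; congr cons; first by apply: h; left.
by apply: IH => w ws; apply: h; right.
Qed.

Section MapSequences.
Variables (Y' Y X' X : smooth_gset P) (q : gmap Y' Y) (b : gmap X' X).

Lemma size_map_seqs (s : seqsg Y' p) : size (map q (sval s)) = p.
Proof. by rewrite size_map (svalP s). Qed.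

Definition map_seqs (s : seqsg Y' p) : seqsg Y p := exist _ (map q (sval s)) (size_map_seqs s).

Lemma map_seqs_subproof g s : map_seqs (gact g s) = gact g (map_seqs s).
Proof.
apply: seqs_eq; rewrite /= /list_act -!map_comp; apply: eq_map => y /=.
exact: gfunE.
Qed.

Definition gmap_seqs : gmap (seqsg Y' p) (seqsg Y p) := GMap map_seqs_subproof.

Definition cmap : gmap (cpow X' Y') (cpow X Y) :=
  gpair olig (comap b (proj X' Y')) (comap gmap_seqs (gsnd olig X' (seqsg Y' p))).

Lemma cmap_sigma t : cmap (csig X' Y' t) = csig X Y (cmap t).
Proof. by apply: pair_seq_eq => //=; rewrite map_rot. Qed.

Lemma cmap_iter i t : cmap (iter i (csig X' Y') t) = iter i (csig X Y) (cmap t).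
Proof. by elim: i => [|i IH] //; rewrite !iterS -IH; apply: cmap_sigma. Qed.

End MapSequences.

Lemma cyc_dom_iter Y X (f : gmap Y X) i t : dom f t -> dom f (iter i (csig X Y) t).
Proof. by move=> ft; elim: i => //= i; apply: cyc_dom_sigma. Qed.

(** The fiber power of f' is the base change of that of f, compatibly with rotation, so a
    transversal pulls back to a transversal. *)
Lemma cyc_transversal_pullback Y' Y X' X (q : gmap Y' Y) (f' : gmap Y' X')
    (f : gmap Y X) (b : gmap X' X) tX tX' U U' :
  gcartesian q f' f b -> trans f U -> trans f' U' ->
  class_on (proj X Y) tX U = class_on (proj X' Y') tX' U'.
Proof.
move=> [c1 c2] tU tU'; have [Ui UT ex] := tU.
have qI y z : f' y = f' z -> q y = q z -> y = z.
  move=> fyz qyz; have e : f (q z) = b (f' z) by apply: c1.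
  have [w [_ u]] := c2 _ _ e; by rewrite -(u y) // -(u z).
have domE t : (forall y, List.In y (sval t.2) -> f' y = t.1) -> dom f (cmap q b t) <-> dom f' t.
  move=> ht; split=> /cyc_domP[h n]; apply/cyc_domP; split=> //=.
  - by move=> e; apply: n; rewrite /= -map_rot e.
  - by move=> _ /In_map[y ys <-]; rewrite c1 ht.
  rewrite -map_rot => e; apply: n; apply: map_inj_In e => y z.
  by move=> /In_rot1/ht e1 /ht e2; apply: qI; rewrite e1 e2.
pose V := dom f' `&` (cmap q b @^-1` U).
have Vi : inv V.
  by apply: invariant_setI; [apply: inv_cyc_dom|apply: inv_preim].
have tV : trans f' V.
  split=> // [t []|t dt] //; have /cyc_domP[ht nt] := dt.
  have [i [ip Ut u]] := ex _ ((domE t ht).2 dt); exists i; split=> //.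
    by split; [apply: cyc_dom_iter|rewrite /preimage /mkset cmap_iter].
  by move=> j jp [_]; rewrite /preimage /mkset cmap_iter; apply: u.
rewrite (cyc_transversal_eq pp tX' tU' tV).
apply: (@class_on_pullback _ _ _ _ _ (cmap q b) _ _ b) => //; first by move=> t [].
move=> [x s] x' Uxs /= xE; have /cyc_domP[hs ns] := UT _ Uxs.
have lift y : List.In y (sval s) -> exists2 y', f' y' = x' & q y' = y.
  move=> ys; have e : f y = b x' by rewrite (hs y ys).
  by have [y' [[h1 h2] _]] := c2 _ _ e; exists y'.
have [s' hs' qs'] := map_In_lift lift.
have ss' : size s' = p by rewrite -(size_map q) qs' (svalP s).
pose t : cpow X' Y' := (x', exist _ s' ss').
have tE : cmap q b t = (x, s) by apply: pair_seq_eq.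
exists t; split=> //; first by split; [apply/(domE t hs'); rewrite tE; apply: UT|rewrite /preimage /mkset tE].
move=> u [/cyc_domP[hu _] _] qu u1; apply: pair_seq_eq => //=.
have : map q (sval u.2) = map q s'.
  by rewrite qs'; have /(congr1 (fun t => sval t.2)) := qu.
apply: map_inj_In => y z yu zs; apply: qI.
by rewrite (hu _ yu) (hs' _ zs).
Qed.

Section Composition.
Variables (Z Y X : smooth_gset P) (f : gmap Y X) (h : gmap Z Y).
Hypotheses (tX : gtransitive X) (tY : gtransitive Y).
Variables (Uf : set (cpow X Y)) (Uh : set (cpow Y Z)).
Hypotheses (tUf : trans f Uf) (tUh : trans h Uh).

(** A non-constant sequence of Z over X either has constant image in Y, and then comes from the
    fiber power of h through [alpha], or is sent by [beta] to a non-constant sequence of Y. [U1] and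
    [U2] are transversals of these two parts. *)
Let alpha : gmap (cpow Y Z) (cpow X Z) := cmap (gid Z) f.
Let beta : gmap (cpow X Z) (cpow X Y) := cmap h (gid X).
Let U1 : set (cpow X Z) := [set alpha t | t in Uh].
Let U2 : set (cpow X Z) := [set t | (forall z, List.In z (sval t.2) -> f (h z) = t.1) /\ Uf (beta t)].

Let p0 : (0 < p)%N := prime_gt0 pp.

Lemma alpha_inj t u : dom h t -> dom h u -> alpha t = alpha u -> t = u.
Proof.
move=> /cyc_domP[ht _] /cyc_domP[hu _] e; have e2 : sval t.2 = sval u.2.
  by have /(congr1 (fun t => sval t.2)) := e; rewrite /= !map_id.
apply: pair_seq_eq => //; case: (t) (u) ht hu e2 => [y [[|z s] ss]] [y' [s' ss']] /= ht hu e2.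
  by have := p0; rewrite -{1}ss.
by rewrite -(ht z) -?(hu z) -?e2 //; left.
Qed.

Lemma U1_inv : inv U1.
Proof.
have [Ui _ _] := tUh; move=> g _ [t Ut <-]; exists (gact g t); first exact: Ui.
exact: gfunE.
Qed.

Lemma U2_inv : inv U2.
Proof.
have [Ui _ _] := tUf; move=> g t [h1 h2]; split; last by rewrite gfunE; apply: Ui.
by move=> _ /In_map[z zs <-]; rewrite !gfunE h1.
Qed.

Lemma map_alpha_rot1 t : dom h t ->
  rot 1 (map h (sval (alpha t).2)) = map h (sval (alpha t).2).
Proof.
case/cyc_domP=> ht _; rewrite /= map_id.
have -> : map h (sval t.2) = nseq (size (sval t.2)) t.1.
  elim: (sval t.2) ht => //= z s IH ht; rewrite (ht z); last by left.
  by congr cons; apply: IH => w ws; apply: ht; right.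
exact: rot1_nseq.
Qed.

Lemma U12_disjoint : U1 `&` U2 = set0.
Proof.
apply/seteqP; split=> // _ [[t Ut <-] [_ Ub]].
have [_ UhT _] := tUh; have [_ UfT _] := tUf.
by have /cyc_domP[_] := UfT _ Ub; apply; apply: map_alpha_rot1 (UhT _ Ut).
Qed.

Lemma map_iter_rot1 i (s : seq Z) : map h (iter i (rot 1) s) = iter i (rot 1) (map h s).
Proof. by elim: i => //= i <-; rewrite map_rot. Qed.

Lemma cyc_transversal_comp : trans (comap f h) (U1 `|` U2).
Proof.
have [Uhi UhT exh] := tUh; have [Ufi UfT exf] := tUf.
have U2dom : U2 `<=` dom (comap f h).
  move=> t [h1 /UfT/cyc_domP[h2 n2]]; apply/cyc_domP; split=> //= e; apply: n2.
  by rewrite /= -map_rot e.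
have U1dom : U1 `<=` dom (comap f h).
  move=> _ [t /UhT/cyc_domP[h1 n1] <-]; apply/cyc_domP; rewrite /= map_id; split=> //.
  by move=> z zs; rewrite h1.
split.
- exact: (invariant_setU U1_inv U2_inv).
- by move=> t [/U1dom|/U2dom].
move=> t dt; have /cyc_domP[ht nt] := dt.
have [e|ne] := pselect (rot 1 (map h (sval t.2)) = map h (sval t.2)).
  have [z zt] : exists z, List.In z (sval t.2).
    by case: (t.2) => [[|y r] sr]; [have := p0; rewrite -{1}sr|exists y; left].
  have hz w : List.In w (sval t.2) -> h w = h z.
    move=> wt; have hw : List.In (h w) (map h (sval t.2)) by apply/In_map; exists w.
    have := rot1_fixP e (_ : List.In (h z) (map h (sval t.2))).
    move=> es; move: hw; rewrite es; last by apply/In_map; exists z.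
    by elim: (size _) => //= n IH [->|/IH].
  pose u : cpow Y Z := (h z, t.2).
  have du : dom h u by apply/cyc_domP; split=> // w /= /hz ->.
  have au : alpha u = t by apply: pair_seq_eq; rewrite /= ?map_id //; apply: ht.
  have [i [ip Uu uniq]] := exh u du; exists i; split=> //.
    by left; exists (iter i (csig Y Z) u); rewrite ?cmap_iter ?au.
  move=> j jp [[v Uv]|]; last first.
    move=> [_ /UfT/cyc_domP[_]]; rewrite cmap_iter => n; case: n.
    by rewrite iter_csigma2 -iterS iterSr; congr iter; apply: e.
  rewrite -au -cmap_iter => /alpha_inj e'; apply: uniq => //; rewrite -e' //; first exact: UhT.
  exact: cyc_dom_iter.
have db : dom f (beta t).
  by apply/cyc_domP; split=> //= _ /In_map[w /ht wt <-].
have [i [ip Ut uniq]] := exf _ db; exists i; split=> //.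
  right; split; last by rewrite cmap_iter.
  by have /cyc_domP[] := cyc_dom_iter i dt.
move=> j jp [[v Uv e]|[_]]; last by rewrite cmap_iter; apply: uniq.
have := map_alpha_rot1 (UhT _ Uv); rewrite e iter_csigma2 map_iter_rot1 -iterS iterSr.
by move/iter_rot1_inj/ne.
Qed.

Lemma class_on_U1 :
  class_on (proj X Z) tX U1 = theta_class f tX * class_on (proj Y Z) tY Uh.
Proof.
have [Uhi UhT _] := tUh; rewrite -class_on_comp //.
apply: (class_on_bij tX tX (j := alpha)) => //; first exact: U1_inv.
- by move=> t Ut; split=> //; exists t.
by move=> t u Ut Uu; apply: alpha_inj; apply: UhT.
Qed.

(** Over an orbit O of [Uf] the i-th entry is a map from O to Y, and the sequences of Z above O form
    the fiber product of the p base changes of h along these maps, whence the factor [h]^p. *)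
Lemma class_on_U2 :
  class_on (proj X Z) tX U2 = theta_class h tY ^+ p * class_on (proj X Y) tX Uf.
Proof.
have [Ufi UfT _] := tUf.
have -> : class_on (proj X Z) tX U2 = class_on (comap (proj X Y) beta) tX U2.
  by apply: eq_class_on => //; exact: U2_inv.
apply: class_on_fibration_gen => //; first exact: U2_inv.
  by move=> t [].
have [y0 _] := tY.
move=> t0 h1 Ut0 h1E; set O := orbit _ t0 in h1 h1E *; set S1 := U2 `&` _ in h1 h1E *.
have Oi : inv O by exact: (invariant_orbit (@gactM P (cpow X Y)) (x := t0)).
have S1i : inv S1 by apply: invariant_setI; [exact: U2_inv|apply: inv_preim].
have tO := sub_orbit_transitive t0.
have OU : O `<=` Uf by exact: orbit_sub.
have size_o (o : sub_gset O) : size (sval (sval o).2) = p by exact: (svalP (sval o).2).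
(* [y0] serves only as the default of [nth]; all indices used are below p. *)
pose F i (o : sub_gset O) z := h z = nth y0 (sval (sval o).2) i.
have nthE i g (o : sub_gset O) : (i < p)%N ->
    nth y0 (sval (sval (gact g o)).2) i = gact g (nth y0 (sval (sval o).2) i).
  by move=> ip; rewrite /= (nth_map y0) ?size_o.
have Fi i : (i < p)%N -> rel_inv (F i).
  by move=> ip g o z; rewrite /F nthE // gfunE => ->.
pose Fs := mkseq F p.
have FsP o s : fibers Fs o s <-> map h s = sval (sval o).2.
  have := @fibers_nthP _ _ _ h (fun o : sub_gset O => sval (sval o).2) y0 0 p o s.
  by rewrite drop0 take_oversize ?size_o //; apply.
have sFs : size Fs = p by rewrite size_mkseq.
have Fsi i : (i < size Fs)%N -> rel_inv (nth (fun _ _ => False) Fs i).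
  by rewrite sFs => ip; rewrite nth_mkseq //; apply: Fi.
have gr i : (i < p)%N ->
    class_on (gfst olig (sub_gset O) Z) tO (rel_graph (olig := olig) (F i)) = theta_class h tY.
  move=> ip; rewrite -class_onT; apply/esym.
  pose b : gmap (sub_gset O) Y := @GMap P (sub_gset O) Y
    (fun o => nth y0 (sval (sval o).2) i) (fun g o => nthE i g o ip).
  apply: (class_on_pullback _ _ (q := gsnd olig _ Z) (b := b)) => //.
  - exact: (inv_rel_graph (Fi i ip)).
  - move=> z o _ e; exists (o, z); split=> //.
    by move=> [o' z'] _ /= -> ->.
transitivity (\prod_(F <- Fs) class_on (gfst olig (sub_gset O) Z) tO (rel_graph (olig := olig) F)); last first.
  rewrite big_map (eq_big_seq (fun=> theta_class h tY)) => [|i]; last first.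
    by rewrite mem_iota => /gr.
  by rewrite big_const_seq count_predT size_iota iter_mulr_1.
rewrite -(class_on_fibers olig tO sFs Fsi) (theta_class_irr h1 _ tO) -class_onT.
apply/esym.
apply: (class_on_pullback _ _ (q := gpair olig h1 (comap (gsnd olig _ _) (incl S1))) (b := gid _)) => //.
- exact: inv_fiber_set.
- move=> z _; split; last by [].
  by apply/FsP; rewrite /= h1E.
move=> [o s] o' /= hs oo'; subst o'.
have hsE := (FsP _ _).1 hs.
have /UfT/cyc_domP[fo _] := OU _ (sub_memP Oi o).
pose t : cpow X Z := ((sval o).1, s).
have bt : beta t = sval o by apply: pair_seq_eq; rewrite //= hsE.
have tS1 : S1 t.
  split; last by rewrite /preimage /mkset bt; apply: (sub_memP Oi).
  split; last by rewrite bt; apply/OU/(sub_memP Oi).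
  by move=> z zs; apply: fo; rewrite -hsE; apply/In_map; exists z.
have [t' t'E] := sub_in S1i tS1.
have h1t : h1 t' = o by apply: sub_eq; rewrite h1E t'E.
exists t'; split=> //; first by rewrite h1t t'E.
move=> w _ [w1 w2] _; apply: sub_eq; rewrite t'E; apply: pair_seq_eq => /=.
  by rewrite -w1 h1E.
by rewrite -w2.
Qed.

(** As [h]^p = [h] + p D(h), this is the product rule built into [term_delta]. *)
Lemma class_on_comp_delta U : trans (comap f h) U ->
  class_on (proj X Z) tX U = theta_class f tX * class_on (proj Y Z) tY Uh +
    theta_class h tY ^+ p * class_on (proj X Y) tX Uf.
Proof.
move=> tU; rewrite (cyc_transversal_eq pp tX tU cyc_transversal_comp).
by rewrite class_onU ?class_on_U1 ?class_on_U2 ?U12_disjoint //; [apply: U1_inv|apply: U2_inv].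
Qed.

End Composition.

End DeltaRelations.

(** * D on disjoint unions *)

Section DeltaUnion.
Variables (P : perm_group) (p : nat).
Hypothesis olig : oligomorphic P.
Hypothesis pp : prime p.
Local Notation inv S := (invariant (@gact P _) S).
Local Notation prodg := (prod_gset olig).
Local Notation seqsg := (seqs_gset olig).
Local Notation cpow X Y := (prodg X (seqsg Y p)).
Local Notation proj X Y := (gfst olig X (seqsg Y p)).
Local Notation csig X Y := (csigma p olig X Y).
Local Notation trans f U := (@cyc_transversal P p olig _ _ f U).
Local Notation dom f := (@cyc_dom P p olig _ _ f).
Implicit Types X Y Z : smooth_gset P.

Section Inclusion.
Variables (Z Y X : smooth_gset P) (i : gmap Z Y) (f : gmap Y X) (tX : gtransitive X).
Hypothesis iI : injective i.
Variable U : set (cpow X Z).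
Hypothesis tU : trans (comap f i) U.

Definition cincl : gmap (cpow X Z) (cpow X Y) := @cmap P p olig _ _ _ _ i (gid X).

Lemma cincl_iter j t : cincl (iter j (csig X Z) t) = iter j (csig X Y) (cincl t).
Proof. exact: cmap_iter. Qed.

Lemma cincl_inj : injective cincl.
Proof.
move=> t u e; apply: pair_seq_eq; first by have /(congr1 fst) := e.
have /(congr1 (fun t => sval t.2)) /= := e; apply: map_inj_In => x y _ _.
exact: iI.
Qed.

Lemma cincl_dom u : dom f (cincl u) <-> dom (comap f i) u.
Proof.
split=> /cyc_domP[h n]; apply/cyc_domP; split=> /=.
- by move=> z zu; apply: h; apply/In_map; exists z.
- by move=> e; apply: n; rewrite /= -map_rot e.
- by move=> _ /In_map[z zu <-]; apply: h.
rewrite -map_rot => e; apply: n; apply: map_inj_In e => x y _ _; exact: iI.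
Qed.

Lemma cincl_lift t : (forall y, List.In y (sval t.2) -> range i y) ->
  exists u, cincl u = t.
Proof.
case: t => x [s ss] /= h.
have [|s' _ e] := @map_In_lift _ _ i (fun=> True) s.
  by move=> y /h[z _ <-]; exists z.
have ss' : size s' = p by rewrite -(size_map i) e.
by exists (x, exist _ s' ss'); apply: pair_seq_eq.
Qed.

Lemma cincl_image_inv : inv (cincl @` U).
Proof.
have [Ui _ _] := tU; move=> g _ [u Uu <-]; exists (gact g u); first exact: Ui.
exact: gfunE.
Qed.

Lemma cincl_image_dom : cincl @` U `<=` dom f.
Proof. by have [_ UT _] := tU; move=> _ [u /UT du <-]; apply/cincl_dom. Qed.

Lemma cincl_image_range t y : (cincl @` U) t -> List.In y (sval t.2) -> range i y.
Proof. by case=> u _ <- /In_map[z _ <-]; exists z. Qed.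

Lemma cincl_image_transversal t : dom f t -> (forall y, List.In y (sval t.2) -> range i y) ->
  exists j, [/\ (j < p)%N, (cincl @` U) (iter j (csig X Y) t) &
    forall k, (k < p)%N -> (cincl @` U) (iter k (csig X Y) t) -> k = j].
Proof.
move=> dt /cincl_lift[u ut]; rewrite -{t}ut in dt *.
have [_ _ ex] := tU; have [j [jp Uj uniq]] := ex _ ((cincl_dom u).1 dt).
exists j; split=> //; first by exists (iter j (csig X Z) u) => //; apply: cincl_iter.
by move=> k kp [v Uv]; rewrite -cincl_iter => /cincl_inj e; apply: uniq; rewrite // -e.
Qed.

Lemma class_on_cincl : class_on (proj X Y) tX (cincl @` U) = class_on (proj X Z) tX U.
Proof.
have [Ui _ _] := tU; apply: (class_on_bij tX tX (j := cincl)) => //.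
- exact: cincl_image_inv.
by move=> t u _ _; apply: cincl_inj.
Qed.

End Inclusion.

Section Union.
Variables (Y1 Y2 Y X : smooth_gset P) (i1 : gmap Y1 Y) (i2 : gmap Y2 Y).
Variables (f : gmap Y X) (tX : gtransitive X).
Hypothesis du : gdisjoint_union i1 i2.
Variables (U1 : set (cpow X Y1)) (U2 : set (cpow X Y2)).
Hypotheses (tU1 : trans (comap f i1) U1) (tU2 : trans (comap f i2) U2).

Let p0 : (0 < p)%N := prime_gt0 pp.

(** Colouring Y by its two parts turns a sequence into a binary word. Constant words belong to the
    fiber powers of Y1 and Y2; the others produce the Witt polynomial. *)
Definition colour (y : Y) : bool := `[< range i1 y >].

Lemma colour1 y : colour y = true <-> range i1 y.
Proof. by split=> /asboolP. Qed.

Lemma colour2 y : colour y = false <-> range i2 y.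
Proof.
have [_ _ I U] := du; split=> h.
  by have : (range i1 `|` range i2) y by [rewrite U]; case=> // /colour1; rewrite h.
apply/negP => /colour1 h1; suff : (range i1 `&` range i2) y by rewrite I.
by [].
Qed.

Lemma colour_act g y : colour (gact g y) = colour y.
Proof.
apply/asboolP/asboolP => -[z _ e]; last by exists (gact g z); rewrite // gfunE e.
exists (gact g^-1%g z) => //.
by rewrite gfunE e -gactM mulVg gact1.
Qed.

Lemma size_colour_word (t : cpow X Y) : size (map colour (sval t.2)) == p.
Proof. by rewrite size_map (svalP t.2). Qed.

Definition colour_word (t : cpow X Y) : p.-tuple bool := Tuple (size_colour_word t).

Lemma colour_word_iter j t : colour_word (iter j (csig X Y) t) =
  iter j (fun v : p.-tuple bool => [tuple of rot 1 v]) (colour_word t).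
Proof.
apply: val_inj; rewrite [RHS]val_shift /= iter_csigma2.
by elim: j => //= j <-; rewrite map_rot.
Qed.

Lemma colour_word_act g t : colour_word (gact g t) = colour_word t.
Proof.
by apply: val_inj; rewrite /= /list_act -map_comp; apply: eq_map => y; apply: colour_act.
Qed.

Lemma colour_word_const t b : (forall y, List.In y (sval t.2) -> colour y = b) ->
  ~~ nonconst (colour_word t).
Proof.
move=> h; rewrite negbK /=; apply/eqP.
suff -> : map colour (sval t.2) = nseq (size (sval t.2)) b by apply: rot1_nseq.
elim: (sval t.2) h => //= y s IH h; rewrite (h y); last by left.
by congr cons; apply: IH => z zs; apply: h; right.
Qed.

Lemma colour_word_constP t : ~~ nonconst (colour_word t) ->
  exists b, forall y, List.In y (sval t.2) -> colour y = b.
Proof.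
move/const_wordP => [b /(congr1 val) /= e]; exists b => y ys.
have : List.In (colour y) (map colour (sval t.2)) by apply/In_map; exists y.
by rewrite e; elim: (p) => //= n IH [<-|/IH].
Qed.

(** A non-constant word of prime length has no rotational symmetry, so fixing its representative
    already selects one rotation of the sequence. *)
Definition mixed : set (cpow X Y) :=
  [set t | (forall y, List.In y (sval t.2) -> f y = t.1) /\ word_rep (colour_word t)].

Lemma mixed_inv : inv mixed.
Proof.
move=> g t [h1 h2]; split; last by rewrite colour_word_act.
by move=> _ /In_map[y /h1 fy <-]; rewrite gfunE fy.
Qed.

Lemma mixed_dom : mixed `<=` dom f.
Proof.
move=> t [h1 /andP[n _]]; apply/cyc_domP; split=> // e; case/negP: n.
by apply/eqP; rewrite /= -map_rot e.
Qed.

Let S1 := cincl X i1 @` U1.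
Let S2 := cincl X i2 @` U2.

Lemma S1_colour t y : S1 t -> List.In y (sval t.2) -> colour y = true.
Proof. by move=> h ys; apply/colour1; apply: cincl_image_range h ys. Qed.

Lemma S2_colour t y : S2 t -> List.In y (sval t.2) -> colour y = false.
Proof. by move=> h ys; apply/colour2; apply: cincl_image_range h ys. Qed.

Lemma S12_disjoint t : S1 t -> S2 t -> False.
Proof.
move=> h1 h2; have [y ys] : exists y, List.In y (sval t.2).
  by case: (t.2) => [[|y r] sr]; [have := p0; rewrite -{1}sr|exists y; left].
by have := S1_colour h1 ys; rewrite (S2_colour h2 ys).
Qed.

Lemma S_mixed_disjoint t : S1 t \/ S2 t -> mixed t -> False.
Proof.
move=> h [_ /andP[n _]]; have : ~~ nonconst (colour_word t).
  by case: h => h; apply: colour_word_const => y; [apply: S1_colour|apply: S2_colour].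
by rewrite n.
Qed.

Lemma In_iter j (t : cpow X Y) y :
  List.In y (sval (iter j (csig X Y) t).2) <-> List.In y (sval t.2).
Proof.
rewrite iter_csigma2; elim: j => //= j IH; rewrite -IH; exact: In_rot1.
Qed.

Lemma cyc_transversal_union : trans f (S1 `|` S2 `|` mixed).
Proof.
have [_ _ i1i2 _] := du; have [i1I i2I _ _] := du.
split.
- apply: invariant_setU mixed_inv; apply: invariant_setU;
    [exact: cincl_image_inv tU1|exact: cincl_image_inv tU2].
- by move=> t [[]|]; [exact: cincl_image_dom|exact: cincl_image_dom|exact: mixed_dom].
move=> t dt; have /cyc_domP[ht nt] := dt.
have [nw|] := boolP (nonconst (colour_word t)).
  have [j [jp wj uniq]] := word_rep_transversal pp nw.
  have cst k : ~ (S1 (iter k (csig X Y) t) \/ S2 (iter k (csig X Y) t)).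
    move=> h; suff : ~~ nonconst (colour_word (iter k (csig X Y) t)).
      by rewrite colour_word_iter nonconst_shift nw.
    by case: h => h; apply: colour_word_const => y; [apply: S1_colour|apply: S2_colour].
  exists j; split=> //.
    right; split; last by rewrite colour_word_iter.
    by have /cyc_domP[] := cyc_dom_iter j dt.
  by move=> k kp [/cst|[_]] //; rewrite colour_word_iter; apply: uniq.
move=> cw; have nm k : ~ mixed (iter k (csig X Y) t).
  by move=> [_ /andP[]]; rewrite colour_word_iter nonconst_shift (negbTE cw).
have [y ys] : exists y, List.In y (sval t.2).
  by case: (t.2) => [[|y r] sr]; [have := p0; rewrite -{1}sr|exists y; left].
have [[] cb] := colour_word_constP cw.
  have [|j [jp Sj uniq]] := cincl_image_transversal i1I tU1 dt.
    by move=> z /cb /colour1.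
  exists j; split=> //; first by left; left.
  move=> k kp [[|/S2_colour/(_ ((In_iter k t y).2 ys))]|/nm] //; first exact: uniq.
  by rewrite cb.
have [|j [jp Sj uniq]] := cincl_image_transversal i2I tU2 dt.
  by move=> z /cb /colour2.
exists j; split=> //; first by left; right.
move=> k kp [[/S1_colour/(_ ((In_iter k t y).2 ys))|]|/nm] //; last exact: uniq.
by rewrite cb.
Qed.

Definition colour_over (b : bool) (x : X) (y : Y) : Prop := f y = x /\ colour y = b.

Lemma colour_over_inv b : rel_inv (colour_over b).
Proof. by move=> g x y [<- <-]; split; rewrite ?gfunE ?colour_act. Qed.

Lemma class_on_colour_over b :
  class_on (gfst olig X Y) tX (rel_graph (olig := olig) (colour_over b)) =
  if b then theta_class (comap f i1) tX else theta_class (comap f i2) tX.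
Proof.
have [i1I i2I _ _] := du.
have ri := inv_rel_graph (olig := olig) (@colour_over_inv b).
case: b ri => ri; rewrite -class_onT.
- apply: (class_on_bij _ _ (j := gpair olig (comap f i1) i1)) => //.
  + by move=> z _; split=> //; split=> //; apply/colour1; exists z.
  + by move=> [x y] [/= fy /colour1[z _ zy]]; exists z => //=; rewrite zy fy.
  + by move=> z z' _ _ /(congr1 snd) /i1I.
- apply: (class_on_bij _ _ (j := gpair olig (comap f i2) i2)) => //.
  + by move=> z _; split=> //; split=> //; apply/colour2; exists z.
  + by move=> [x y] [/= fy /colour2[z _ zy]]; exists z => //=; rewrite zy fy.
  + by move=> z z' _ _ /(congr1 snd) /i2I.
Qed.

Lemma fibers_colour (w : seq bool) x s : fibers [seq colour_over b | b <- w] x s <->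
  (forall y, List.In y s -> f y = x) /\ map colour s = w.
Proof.
elim: w s => [|b w IH] [|y s] /=; try by split=> // -[].
rewrite IH; split=> [[[fy cy] [h <-]]|[h [cy sw]]].
  by split; [move=> z [<-|/h]|rewrite cy].
by split; [split=> //; apply: h; left|split=> // z zs; apply: h; right].
Qed.

(** Sequences with a given word form a fiber product of copies of Y1 and Y2 over X, so the word
    contributes the corresponding monomial in the two classes. *)
Lemma class_on_mixed : class_on (proj X Y) tX mixed =
  wittP p (theta_class (comap f i1) tX) (theta_class (comap f i2) tX).
Proof.
rewrite -sum_word_rep //.
rewrite (@class_on_partition_fin _ _ _ _ _ _ (p.-tuple bool) (fun w => [set t | colour_word t = w])).
- rewrite [RHS]big_mkcond /=; apply: eq_bigr => w _; have [rw|nrw] := boolP (word_rep w).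
    have -> : mixed `&` [set t | colour_word t = w] =
        fiber_set (olig := olig) [seq colour_over b | b <- w] (k := p).
      apply/seteqP; split=> t; first by move=> [[h _] cw]; apply/fibers_colour; split=> //; rewrite -cw.
      move/fibers_colour => [h cw]; have e : colour_word t = w by apply: val_inj.
      by split=> //; split=> //; rewrite e.
    rewrite class_on_fibers ?size_map ?size_tuple //.
      rewrite big_map /word_prod; apply: eq_bigr => b _; exact: class_on_colour_over.
    by move=> i ip; rewrite (nth_map true) ?size_tuple //; apply: colour_over_inv.
  rewrite -(class_on0 (proj X Y) tX); congr class_on; apply/seteqP; split=> // t [[_ h] e].
  by move: h; rewrite e (negbTE nrw).
- exact: mixed_inv.
- by move=> w g t /= <-; rewrite colour_word_act.
by move=> t _; exists (colour_word t); split=> [|w <-].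
Qed.

Lemma class_on_union_delta U : trans f U ->
  class_on (proj X Y) tX U = class_on (proj X Y1) tX U1 + class_on (proj X Y2) tX U2 +
    wittP p (theta_class (comap f i1) tX) (theta_class (comap f i2) tX).
Proof.
have [i1I i2I _ _] := du.
move=> tU; rewrite (cyc_transversal_eq pp tX tU cyc_transversal_union).
have S1i := cincl_image_inv tU1; have S2i := cincl_image_inv tU2.
rewrite class_onU ?class_on_mixed; first congr (_ + _).
- rewrite class_onU //; first by rewrite (class_on_cincl tX i1I tU1) (class_on_cincl tX i2I tU2).
  by apply/seteqP; split=> // t [/S12_disjoint h /h].
- exact: invariant_setU.
- exact: mixed_inv.
by apply/seteqP; split=> // t [h /(S_mixed_disjoint h)].
Qed.

End Union.
End DeltaUnion.

(** * Frobenius congruences and torsion in Theta *)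

Section ThetaDelta.
Variables (P : perm_group) (m p : nat).
Hypothesis olig : oligomorphic P.
Hypothesis ind : Ind P m.
Hypothesis pp : prime p.
Hypothesis pm : ~~ (p %| m)%N.
Local Notation prodg := (prod_gset olig).
Local Notation seqsg := (seqs_gset olig).
Local Notation proj X Y := (gfst olig X (seqsg Y p)).
Local Notation trans f U := (@cyc_transversal P p olig _ _ f U).
Implicit Types X Y Z : smooth_gset P.

Definition delta_set Y X (f : gmap Y X) := sval (cid (cyc_transversal_exists olig ind pp pm f)).

Lemma delta_setP Y X (f : gmap Y X) : trans f (delta_set f).
Proof. exact: svalP. Qed.

Definition symbol_delta (s : symbol P) : Theta P :=
  class_on (proj (sym_cod s) (sym_dom s)) (@sym_cod_transitive P s) (delta_set (sym_map s)).

Lemma symbol_deltaE (s : symbol P) :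
  pres_gen (@theta_rel P) s ^+ p = pres_gen (@theta_rel P) s + symbol_delta s *+ p.
Proof.
case: s => Y X f tX.
exact: (theta_class_pow (olig := olig) pp tX (delta_setP f)).
Qed.

Lemma symbol_delta_rel s t : theta_rel s t ->
  term_delta p symbol_delta s = term_delta p symbol_delta t.
Proof.
case=> {s t} /=.
- move=> Y X f tX [f' [fK _]]; rewrite /symbol_delta /=.
  apply: cyc_transversal_injective (delta_setP f); exact: can_inj fK.
- move=> Y1 Y2 Y X i1 i2 f tX du; rewrite /symbol_delta /=.
  rewrite (class_on_union_delta pp tX du (delta_setP _) (delta_setP _) (delta_setP f)).
  by [].
- move=> Z Y X f h tX tY tZ; rewrite /symbol_delta /=.
  rewrite (class_on_comp_delta pp tX tY (delta_setP f) (delta_setP h) (delta_setP _)).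
  rewrite (theta_class_pow pp tY (delta_setP h)).
  rewrite -!/(pres_gen (@theta_rel P) _) -/(theta_class f tX) -/(theta_class h tY).
  move: (theta_class f tX) (theta_class h tY) (class_on _ _ _) (class_on _ _ _) => a b c d.
  by rewrite mulrDl mulrnAl addrA [d * c]mulrC.
move=> Y' Y X' X q f' f b tX tX' c; rewrite /symbol_delta /=.
exact: (cyc_transversal_pullback pp tX tX' c (delta_setP f) (delta_setP f')).
Qed.

Lemma theta_frobenius (x : Theta P) : exists y, x ^+ p = x + y *+ p.
Proof. exact: (presented_frobenius pp symbol_deltaE). Qed.

Lemma theta_torsion_free (x : Theta P) : x *+ p = 0 -> x = 0.
Proof. exact: (presented_torsion_free pp symbol_deltaE symbol_delta_rel). Qed.

End ThetaDelta.

(** * Basic classes *)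

Section TransitiveMaps.
Variable P : perm_group.
Implicit Types X Y Z : smooth_gset P.

Lemma transitive_witness Y (y y' : Y) : gtransitive Y -> exists g, gact g y = y'.
Proof.
move=> tY; have : orbit (@gact P Y) y y' by rewrite transitive_orbit.
by case=> g _ <-; exists g.
Qed.

Lemma gmap_eq_transitive Y Z (f h : gmap Y Z) (y : Y) :
  gtransitive Y -> f y = h y -> f =1 h.
Proof.
by move=> tY e z; have [g <-] := transitive_witness y z tY; rewrite !gfunE e.
Qed.

Lemma gmap_transitive Y Z (y : Y) (z : Z) : gtransitive Y ->
  stab (@gact P Y) y `<=` stab (@gact P Z) z -> exists j : gmap Y Z, j y = z.
Proof.
move=> tY yz; pose w y' := sval (cid (transitive_witness y y' tY)).
have wE y' : gact (w y') y = y' by rewrite /w; case: cid.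
have indep g h : gact g y = gact h y -> gact g z = gact h z.
  move=> e; have : stab (@gact P Y) y (h^-1 * g)%g.
    by rewrite /stab /= gactM e -gactM mulVg gact1.
  by move/yz; rewrite /stab /= gactM => {2}<-; rewrite -gactM mulgV gact1.
have jE g y' : gact (w (gact g y')) z = gact g (gact (w y') z).
  by rewrite -gactM; apply: indep; rewrite gactM !wE.
exists (@GMap P Y Z (fun y' => gact (w y') z) jE) => /=.
by rewrite -[RHS]gact1; apply: indep; rewrite wE gact1.
Qed.

Lemma giso_transitive Y Z (y : Y) (z : Z) : gtransitive Y -> gtransitive Z ->
  stab (@gact P Y) y = stab (@gact P Z) z ->
  exists (j : gmap Y Z) (j' : gmap Z Y), [/\ j y = z, cancel j j' & cancel j' j].
Proof.
move=> tY tZ e.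
have [j jy] : exists j : gmap Y Z, j y = z by apply: gmap_transitive; rewrite // e.
have [j' jz] : exists j' : gmap Z Y, j' z = y by apply: gmap_transitive; rewrite // e.
exists j, j'; split=> //.
  by apply: (@gmap_eq_transitive _ _ (comap j' j) (gid Y) y) => //=; rewrite jy.
by apply: (@gmap_eq_transitive _ _ (comap j j') (gid Z) z) => //=; rewrite jz.
Qed.

Section Truncation.
Variables (l : nat) (z w : seq (pts P)).
Hypothesis zw : take l z = w.

Lemma truncate_subproof1 (y : tuple_orbit_gset z) : orbit (@tuple_act P) w (take l (sval y)).
Proof. by rewrite -zw; case: (svalP y) => g _ <-; exists g => //; rewrite /tuple_act map_take. Qed.

Definition truncate_fun (y : tuple_orbit_gset z) : tuple_orbit_gset w :=
  exist _ (take l (sval y)) (truncate_subproof1 y).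

Lemma truncate_subproof g y : truncate_fun (gact g y) = gact g (truncate_fun y).
Proof. by apply: tuple_orbit_eq; rewrite /= /tuple_act map_take. Qed.

Definition truncate : gmap (tuple_orbit_gset z) (tuple_orbit_gset w) := GMap truncate_subproof.

End Truncation.

(** With m = 1 the division rule is vacuous: this is the integral span of products of at most k
    basic classes. *)
Local Notation bspan := (prod_span 1 (@basic_class P)).

(** Dropping k coordinates one at a time writes the projection as a composite of k basic maps. *)
Lemma truncate_span k l z w (zw : take l z = w) : size z = (l + k)%N ->
  bspan k (theta_class (truncate zw) (tuple_orbit_transitive w)).
Proof.
elim: k z zw => [|k IH] z zw sz.
  rewrite theta_class_iso; first exact: prod_span1.
  have e : z = w by rewrite -zw take_oversize // sz addn0.
  subst z; exists (gid _); split=> y; apply: tuple_orbit_eq => /=.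
    by case: (svalP y) => g _ <-; rewrite take_oversize // size_map sz addn0.
  by case: (svalP y) => g _ <-; rewrite take_oversize // size_map sz addn0.
have zw' : take l (take (l + k) z) = w by rewrite take_takel ?leq_addr.
have -> : theta_class (truncate zw) (tuple_orbit_transitive w) =
    basic_map_class (l + k) z * theta_class (truncate zw') (tuple_orbit_transitive w).
  rewrite mulrC -theta_class_comp; last exact: tuple_orbit_transitive.
  by apply: eq_theta_class => y; apply: tuple_orbit_eq; rewrite /= take_takel ?leq_addr.
apply: prod_spanM; first by exists (l + k)%N, z; rewrite sz addnS.
by apply: IH; rewrite size_take sz addnS ltnSn.
Qed.

Lemma tuple_orbit_base z : exists2 y : tuple_orbit_gset z, sval y = z &
  stab (@gact P (tuple_orbit_gset z)) y = stab (@tuple_act P) z.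
Proof.
have oz : orbit (@tuple_act P) z z by exists 1%g => //; apply: tuple_act1.
exists (exist _ z oz) => //; apply/seteqP; split=> g /=; first by move/(congr1 sval).
by move=> e; apply: tuple_orbit_eq.
Qed.

(** Transitive sets are determined by a point stabilizer, so f is isomorphic to the projection from
    the orbit of w ++ b to that of w; the degree is the number of added coordinates. *)
Lemma transitive_class_span Y X (f : gmap Y X) tX (y : Y) (w b : seq (pts P)) :
  gtransitive Y -> stab (@gact P X) (f y) = stab (@tuple_act P) w ->
  stab (@gact P Y) y = stab (@tuple_act P) (w ++ b) ->
  bspan (size b) (theta_class f tX).
Proof.
move=> tY sx sy; have zw : take (size w) (w ++ b) = w by rewrite take_size_cat.
have [u uE su] := tuple_orbit_base (w ++ b); have [v vE sv] := tuple_orbit_base w.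
have [q [q' [qu qK qK']]] : exists (q : gmap (tuple_orbit_gset (w ++ b)) Y) (q' : gmap Y _),
    [/\ q u = y, cancel q q' & cancel q' q].
  by apply: giso_transitive; rewrite ?su ?sy //; apply: tuple_orbit_transitive.
have [j [j' [jv jK jK']]] : exists (j : gmap (tuple_orbit_gset w) X) (j' : gmap X _),
    [/\ j v = f y, cancel j j' & cancel j' j].
  by apply: giso_transitive; rewrite ?sv ?sx //; apply: tuple_orbit_transitive.
have tu : truncate zw u = v by apply: tuple_orbit_eq; rewrite /= uE vE.
have sq : (fun t => f (q t)) =1 (fun t => j (truncate zw t)).
  apply: (@gmap_eq_transitive _ _ (comap f q) (comap j (truncate zw)) u).
    exact: tuple_orbit_transitive.
  by rewrite /= qu -jv -tu.
rewrite (@theta_class_pullback P _ _ _ _ q (truncate zw) f j tX (tuple_orbit_transitive w)).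
  by apply: truncate_span; rewrite size_cat.
split=> // y0 x' e; exists (q' y0); split.
  by split=> //; apply: (can_inj jK); rewrite -sq qK'.
by move=> t [<- _]; rewrite qK.
Qed.

Lemma stab_tuple_exists Y (y : Y) : exists w, stab (@gact P Y) y = stab (@tuple_act P) w.
Proof. by have [A fA ->] := sgset_smooth y; have [w <-] := fixer_list fA; exists w. Qed.

Lemma transitive_class_span_exists Y X (f : gmap Y X) tX : gtransitive Y ->
  exists k, bspan k (theta_class f tX).
Proof.
move=> tY; have [y _] := tY; have [w sw] := stab_tuple_exists (f y).
have [b sb] := stab_tuple_exists y; exists (size b).
apply: (@transitive_class_span _ _ f tX y w b) => //.
rewrite stab_tuple_cat -sw -sb; apply/seteqP; split=> g /=; last by case.
by move=> gy; split=> //; rewrite /stab /= -gfunE gy.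
Qed.

Lemma class_span_exists Y X (f : gmap Y X) tX : exists k, bspan k (theta_class f tX).
Proof.
rewrite -class_onT.
suff : forall S, invariant (@gact P Y) S -> exists k, bspan k (class_on f tX S) by apply.
apply: gset_ind.
- by exists 0%N; rewrite class_on0; apply: prod_span0.
- by move=> y; apply: transitive_class_span_exists; apply: sub_orbit_transitive.
move=> S S' Si S'i SS' [k hk] [k' hk']; exists (k + k')%N; rewrite class_onU //.
by apply: prod_spanD; [apply: prod_span_le hk|apply: prod_span_le hk']; rewrite ?leq_addr ?leq_addl.
Qed.

Lemma bspanMr k l x y : bspan k x -> bspan l y -> bspan (k + l) (x * y).
Proof.
move=> hx hy; elim: hx => {k x}.
- by move=> k; rewrite mul1r; apply: prod_span_le hy; apply: leq_addl.
- by move=> k b x Bb _ IH; rewrite -mulrA; apply: prod_spanM.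
- by move=> k x _ IH; apply: prod_spanS.
- by move=> k x x' _ IH _ IH'; rewrite mulrBl; apply: prod_spanB.
by move=> k x _; rewrite mulr1n.
Qed.

Lemma theta_span (x : Theta P) : exists k, bspan k x.
Proof.
elim/cl_ind: x; elim=> [[Y X f tX]|||s [k hk] t [l hl]|t [k hk]|s [k hk] t [l hl]].
- exact: class_span_exists.
- by exists 0%N; apply: prod_span0.
- by exists 0%N; apply: prod_span1.
- exists (k + l)%N; rewrite clD; apply: prod_spanD.
    by apply: prod_span_le hk; apply: leq_addr.
  by apply: prod_span_le hl; apply: leq_addl.
- by exists k; rewrite clN; apply: prod_spanN.
by exists (k + l)%N; rewrite clM; apply: bspanMr.
Qed.

End TransitiveMaps.

(** * Sharper congruences for transitive maps and basic classes *)

Section Frobenius.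
Variables (P : perm_group) (m p : nat).
Hypothesis olig : oligomorphic P.
Hypothesis ind : Ind P m.
Hypothesis pp : prime p.
Hypothesis pm : ~~ (p %| m)%N.
Local Notation prodg := (prod_gset olig).
Local Notation seqsg := (seqs_gset olig).
Local Notation proj X Y := (gfst olig X (seqsg Y p)).
Local Notation bspan := (prod_span 1 (@basic_class P)).
Implicit Types X Y Z : smooth_gset P.

(** On the transversal the projection to X is f composed with the first entry of the sequence, so
    D(f) is [f] times the class of the first-entry map over the transitive set Y. *)
Lemma transitive_frobenius Y X (f : gmap Y X) tX : gtransitive Y ->
  exists z, theta_class f tX ^+ p = theta_class f tX + theta_class f tX * z *+ p.
Proof.
move=> tY; have [y0 _] := tY; have p0 := prime_gt0 pp.
have [U tU] := cyc_transversal_exists olig ind pp pm f; have [Ui UT _] := tU.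
have nthE g (t : prodg X (seqsg Y p)) :
    nth y0 (sval (gact g t).2) 0 = gact g (nth y0 (sval t.2) 0).
  by rewrite /= (nth_map y0) ?(svalP t.2).
pose hd : gmap (prodg X (seqsg Y p)) Y := GMap nthE.
exists (class_on hd tY U); rewrite (theta_class_pow pp tX tU) -class_on_comp //.
congr (_ + _ *+ _); apply: eq_class_on => // t /UT/cyc_domP[h _]; apply/esym/h => /=.
by case: (t.2) => [[|y s] ss] /=; [have := p0; rewrite -{1}ss|left].
Qed.

Lemma tuple_orbit_stab z (y : tuple_orbit_gset z) :
  stab (@gact P (tuple_orbit_gset z)) y = stab (@tuple_act P) (sval y).
Proof.
apply/seteqP; split=> g /=; first by move/(congr1 sval).
by move=> e; apply: tuple_orbit_eq.
Qed.

Lemma size_tuple_orbit z (y : tuple_orbit_gset (P := P) z) : size (sval y) = size z.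
Proof. by case: (svalP y) => g _ <-; rewrite size_map. Qed.

Lemma stab_flatten (T : Type) (F : T -> seq (pts P)) (s : seq T) g :
  stab (@tuple_act P) (flatten (map F s)) g <->
  forall y, List.In y s -> stab (@tuple_act P) (F y) g.
Proof.
elim: s => [|y s IH] //=; rewrite stab_tuple_cat; split.
  by move=> [gy /IH h] z [<-|/h].
by move=> h; split; [apply: h; left|apply/IH => z zs; apply: h; right].
Qed.

Lemma stab_list Y (s : seq Y) g :
  list_act g s = s <-> forall y, List.In y s -> gact g y = y.
Proof.
elim: s => [|y s IH] //=; split; first by case=> gy /IH h z [<-|/h].
by move=> h; congr cons; [apply: h; left|apply/IH => z zs; apply: h; right].
Qed.

(** A point of the fiber power is a tuple x' in X with p one-coordinate extensions. Its stabilizer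
    is that of x' followed by these p last coordinates, so each orbit has degree at most p over
    X. *)
Lemma basic_frobenius b : basic_class b -> exists2 y, bspan p y & b ^+ p = b + y *+ p.
Proof.
case=> l [x [sx ->]]; set f := basic_map l x.
set X := tuple_orbit_gset (take l x) in f *; set Y := tuple_orbit_gset x in f *.
have [U tU] := cyc_transversal_exists olig ind pp pm f; have [Ui UT _] := tU.
have tX : gtransitive X := tuple_orbit_transitive (take l x).
exists (class_on (proj X Y) tX U); last first.
  rewrite /basic_map_class -/f (theta_class_irr f _ tX).
  exact: (theta_class_pow pp tX tU).
suff key S : invariant (@gact P _) S -> bspan p (class_on (proj X Y) tX (S `&` U)).
  by rewrite -[U]setTI; apply: key.
move: S; apply: gset_ind => [|t|S S' Si S'i SS' hS hS'].
- by rewrite set0I class_on0; apply: prod_span0.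
- have Oi := invariant_orbit (@gactM P (prodg X (seqsg Y p))) (x := t).
  have [Ut|nUt] := pselect (U t); last first.
    have -> : orbit (@gact P (prodg X (seqsg Y p))) t `&` U = set0.
      apply/seteqP; split=> // _ [[g _ <-]]; rewrite invariantE //.
      - exact: gact1.
      - exact: gactM.
    by rewrite class_on0; apply: prod_span0.
  have -> : orbit (@gact P (prodg X (seqsg Y p))) t `&` U = orbit (@gact P _) t.
    by apply/setIidPl; apply: orbit_sub.
  have [t0 t0E] := sub_in Oi (orbit_refl (@gact1 P _) t).
  have /cyc_domP[ft _] := UT _ Ut.
  pose F (y : Y) := drop l (sval y).
  have szF (s : seq Y) : size (flatten (map F s)) = size s.
    elim: s => //= y s IH; rewrite size_cat IH size_drop size_tuple_orbit sx.
    by rewrite subSnn.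
  rewrite -[X in prod_span _ _ X _](svalP t.2) -szF.
  apply: (@transitive_class_span _ _ _ _ tX t0 (sval t.1)).
  + exact: sub_orbit_transitive.
  + by rewrite /= t0E -tuple_orbit_stab.
  rewrite stab_tuple_cat sub_stab t0E.
  have ys y : List.In y (sval t.2) -> sval y = sval t.1 ++ F y.
    by move=> yt; rewrite -(ft y yt) /= cat_take_drop.
  apply/seteqP; split=> g.
    case: t {Ut Oi t0 t0E} ft ys => [x' s] /= ft ys /= e.
    have e1 : gact g x' = x' by have := congr1 fst e.
    have e2 : list_act g (sval s) = sval s by have := congr1 (fun u => sval u.2) e.
    have gx : stab (@tuple_act P) (sval x') g by rewrite -tuple_orbit_stab.
    split=> //; apply/stab_flatten => y yt; have /stab_list/(_ y yt) gy := e2.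
    have : stab (@tuple_act P) (sval y) g by rewrite -tuple_orbit_stab.
    by rewrite (ys y yt) stab_tuple_cat => -[].
  move=> [g1 /stab_flatten g2]; apply: pair_seq_eq.
    by rewrite -tuple_orbit_stab in g1.
  apply/stab_list => y yt.
  suff : stab (@gact P Y) y g by [].
  by rewrite tuple_orbit_stab (ys y yt) stab_tuple_cat; split=> //; apply: g2.
rewrite setIUl class_onU.
- exact: prod_spanD.
- exact: invariant_setI.
- exact: invariant_setI.
by rewrite setIACA SS' set0I.
Qed.

End Frobenius.

(** * Localizations *)

Section LocCalculus.
Variables (m : nat) (M : zmodType).
Implicit Types x y : M.

Lemma loc_fracM x i j : loc_frac m (x *+ m ^ j) (i + j) = loc_frac m x i.
Proof. by apply: loc_frac_eq; rewrite -mulrnA -expnD addnC. Qed.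

Lemma loc_fracD x y i : loc_frac m (x + y) i = loc_frac m x i + loc_frac m y i.
Proof. by rewrite loc_addfrac -mulrnDl loc_fracM. Qed.

Lemma loc_frac0 i : loc_frac m (0 : M) i = 0.
Proof. by apply: loc_frac_eq; rewrite !mul0rn. Qed.

Lemma loc_fracN x i : loc_frac m (- x) i = - loc_frac m x i.
Proof. exact/esym/loc_oppE. Qed.

Lemma loc_fracMn x i n : loc_frac m (x *+ n) i = loc_frac m x i *+ n.
Proof.
elim: n => [|n IH]; first by rewrite !mulr0n loc_frac0.
by rewrite !mulrS loc_fracD IH.
Qed.

Lemma loc_fracMz x i a : loc_frac m (x *~ a) i = loc_frac m x i *~ a.
Proof.
case: (intP a) => [|n|n]; first by rewrite !mulr0z loc_frac0.
  by rewrite -!pmulrn loc_fracMn.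
by rewrite !mulrNz loc_fracN -!pmulrn loc_fracMn.
Qed.

Lemma loc_frac_clear x i : loc_frac m x i *+ m ^ i = loc_frac m x 0.
Proof. by rewrite -loc_fracMn -[in RHS](loc_fracM x 0 i). Qed.

Lemma loc_clear (u : loc m M) : exists i x, u *+ m ^ i = loc_frac m x 0.
Proof. by elim/loc_frac_ind: u => x i; exists i, x; apply: loc_frac_clear. Qed.

Lemma loc_frac_eq0 x i : loc_frac m x i = 0 -> exists k, x *+ m ^ k = 0.
Proof.
rewrite -(loc_frac0 0) => /loc_fracP[k /=]; rewrite mul0rn addn0 => e.
by exists k.
Qed.

Lemma loc_torsion_free q : (forall x, x *+ q = 0 -> x = 0) ->
  forall u : loc m M, u *+ q = 0 -> u = 0.
Proof.
move=> tf; elim/loc_frac_ind=> x i; rewrite -loc_fracMn => /loc_frac_eq0[k e].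
rewrite -(loc_fracM x i k) (tf (x *+ m ^ k)) ?loc_frac0 //.
by rewrite mulrnAC.
Qed.

Lemma loc_frac_scale (a : int) k (u : loc m M) :
  (loc_frac m a k *: u) *+ m ^ k = u *~ a.
Proof.
elim/loc_frac_ind: u => x i; rewrite [_ *: _]loc_scaleE.
by rewrite -loc_fracMn addnC loc_fracM loc_fracMz.
Qed.

End LocCalculus.

Lemma common_denominator m n (c : 'I_n -> loc m int) :
  exists K (a : 'I_n -> int), forall i, c i = loc_frac m (a i) K.
Proof.
pose K := (\sum_i (repr (c i)).2)%N.
exists K, (fun i => (repr (c i)).1 *+ m ^ (K - (repr (c i)).2)) => i.
have le : ((repr (c i)).2 <= K)%N by rewrite /K (bigD1 i) //= leq_addr.
by rewrite -[X in loc_frac _ _ X](subnKC le) loc_fracM -loc_fracE.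
Qed.

Section LocMap.
Variables (m : nat) (M N : zmodType) (f : M -> N).
Hypothesis fB : {morph f : x y / x - y}.

Lemma loc_map_f0 : f 0 = 0.
Proof. by rewrite -[X in f X](subrr 0) fB subrr. Qed.

Lemma loc_map_fN x : f (- x) = - f x.
Proof. by rewrite -[- x]sub0r fB loc_map_f0 sub0r. Qed.

Lemma loc_map_fD x y : f (x + y) = f x + f y.
Proof. by rewrite -[y in LHS]opprK fB loc_map_fN opprK. Qed.

Lemma loc_map_fMn x n : f (x *+ n) = f x *+ n.
Proof. by elim: n => [|n IH]; rewrite ?mulr0n ?loc_map_f0 // !mulrS loc_map_fD IH. Qed.

Definition loc_map (u : loc m M) : loc m N := loc_frac m (f (repr u).1) (repr u).2.

Lemma loc_mapE x i : loc_map (loc_frac m x i) = loc_frac m (f x) i.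
Proof.
rewrite /loc_map; case: (loc_frac_repr m x i) => k /= e.
by apply/loc_fracP; exists k; rewrite /= -!loc_map_fMn e.
Qed.

Lemma loc_map0 : loc_map 0 = 0.
Proof. by rewrite -[0 in LHS](loc_frac0 m M 0) loc_mapE loc_map_f0 loc_frac0. Qed.

Lemma loc_mapD u v : loc_map (u + v) = loc_map u + loc_map v.
Proof.
elim/loc_frac_ind: u => x i; elim/loc_frac_ind: v => y j.
by rewrite loc_addfrac !loc_mapE loc_addfrac loc_map_fD !loc_map_fMn.
Qed.

Lemma loc_map_sum n (F : 'I_n -> loc m M) : loc_map (\sum_i F i) = \sum_i loc_map (F i).
Proof. exact: (big_morph loc_map loc_mapD loc_map0). Qed.

Lemma loc_mapMn u n : loc_map (u *+ n) = loc_map u *+ n.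
Proof.
by elim/loc_frac_ind: u => x i; rewrite -loc_fracMn !loc_mapE loc_map_fMn loc_fracMn.
Qed.

Lemma loc_mapMz u a : loc_map (u *~ a) = loc_map u *~ a.
Proof.
have N0 v : loc_map (- v) = - loc_map v.
  by elim/loc_frac_ind: v => x i; rewrite -loc_fracN !loc_mapE loc_map_fN loc_fracN.
by case: (intP a) => [|n|n]; rewrite ?mulr0z ?loc_map0 // ?mulrNz ?N0 -!pmulrn loc_mapMn.
Qed.

End LocMap.

Section LocRing.
Variables (m : nat) (R : comPzRingType).
Local Notation RL := (loc m R).

Lemma loc_frac_mul (x y : R) i j :
  loc_frac m x i * loc_frac m y j = loc_frac m (x * y) (i + j).
Proof. exact: loc_mulE. Qed.

Lemma loc_frac_exp (x : R) n : loc_frac m x 0 ^+ n = loc_frac m (x ^+ n) 0.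
Proof. by elim: n => [|n IH] //; rewrite !exprS IH loc_frac_mul. Qed.

Lemma loc_inv_exists : exists u : RL, u *+ m = 1.
Proof. by exists (loc_frac m 1 1); have := loc_frac_clear m (1 : R) 1; rewrite expn1. Qed.

Lemma loc_scaleAl (a : loc m int) (u v : RL) : (a *: u) * v = a *: (u * v).
Proof.
elim/loc_frac_ind: a => a k; elim/loc_frac_ind: u => x i; elim/loc_frac_ind: v => y j.
by rewrite [_ *: loc_frac m x i]loc_scaleE !loc_frac_mul [RHS]loc_scaleE mulrzAl addnA.
Qed.

Lemma loc_frobenius q : (0 < m)%N -> prime q -> ~~ (q %| m)%N ->
  (forall x : R, exists y, x ^+ q = x + y *+ q) ->
  forall u : RL, exists y, u ^+ q - u = y *+ q.
Proof.
move=> m0 pq qm frob u; have [i [x ux]] := loc_clear u.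
(* With every element taken as a generator the degree conditions of [frobenius_div] become empty. *)
pose B (u : RL) := True.
have span v : prod_span m B q v.
  rewrite -[v]mulr1 -(prednK (prime_gt0 pq)); apply: prod_spanM => //.
  exact: prod_span1.
have {x ux} : exists y, (u *+ m ^ i) ^+ q - u *+ m ^ i = y *+ q.
  have [y xy] := frob x; exists (loc_frac m y 0); rewrite ux.
  by rewrite loc_frac_exp xy loc_fracD loc_fracMn addrAC subrr add0r.
elim: i => [|i IH]; first by rewrite mulr1n.
rewrite expnSr mulrnA => -[y e].
have [z _ ez] := frobenius_div m0 loc_inv_exists pq qm (span _) (span _) e.
by apply: IH; exists z.
Qed.

End LocRing.

Section Residue.
Variables (m q : nat).
Hypothesis pq : prime q.
Hypothesis qm : ~~ (q %| m)%N.

Lemma natr_Fp_neq0 : (m%:R : 'F_q) != 0.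
Proof. by rewrite -(dvdn_pcharf (pchar_Fp pq)). Qed.

Lemma intr_mulm (c : int) s : (c *+ m ^ s)%:~R = c%:~R * m%:R ^+ s :> 'F_q.
Proof. by rewrite rmorphMn /= -mulr_natr natrX. Qed.

Definition loc_residue (u : loc m int) : 'F_q :=
  (repr u).1%:~R / m%:R ^+ (repr u).2.

Lemma loc_residueE (a : int) k : loc_residue (loc_frac m a k) = a%:~R / m%:R ^+ k.
Proof.
rewrite /loc_residue; case: (loc_frac_repr m a k); move: (repr _) => [b j] l /= e.
have mE i : (m%:R : 'F_q) ^+ i != 0 by rewrite expf_neq0 // natr_Fp_neq0.
have : (b *+ m ^ (l + k))%:~R = (a *+ m ^ (l + j))%:~R :> 'F_q by rewrite e.
rewrite !intr_mulm !exprD !mulrA ![_ * m%:R ^+ l]mulrC.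
rewrite -!mulrA => /(mulfI (mE l)) h; apply/eqP.
by rewrite eqr_div // h mulrC.
Qed.

Lemma loc_residue_is_zmod_morphism : zmod_morphism loc_residue.
Proof.
elim/loc_frac_ind=> a i; elim/loc_frac_ind=> b j.
have mE k : (m%:R : 'F_q) ^+ k != 0 by rewrite expf_neq0 // natr_Fp_neq0.
rewrite -loc_fracN loc_addfrac !loc_residueE.
rewrite -mulNr -rmorphN /= addf_div // -exprD; congr (_ / _).
by rewrite intrD !intr_mulm.
Qed.

Lemma loc_residue_is_monoid_morphism : monoid_morphism loc_residue.
Proof.
split; first by rewrite -[1]/(loc_frac m (1 : int) 0) loc_residueE expr0 divr1.
elim/loc_frac_ind=> a i; elim/loc_frac_ind=> b j.
by rewrite loc_frac_mul !loc_residueE intrM exprD invfM mulrACA.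
Qed.

HB.instance Definition _ :=
  GRing.isZmodMorphism.Build (loc m int) 'F_q loc_residue loc_residue_is_zmod_morphism.
HB.instance Definition _ :=
  GRing.isMonoidMorphism.Build (loc m int) 'F_q loc_residue loc_residue_is_monoid_morphism.

End Residue.

Section Integers.
Variable m : nat.
Hypothesis m0 : (0 < m)%N.
Local Notation A := (loc m int).

Lemma loc_int_eq0 (a : int) k : loc_frac m a k = 0 -> a = 0.
Proof.
case/loc_frac_eq0=> l /eqP; rewrite mulrn_eq0 expn_eq0.
by case: m m0 => //= n _ /eqP.
Qed.

Lemma loc_int_integral (a b : A) : a * b = 0 -> a = 0 \/ b = 0.
Proof.
elim/loc_frac_ind: a => a i; elim/loc_frac_ind: b => b j.
rewrite loc_frac_mul => /loc_int_eq0/eqP; rewrite mulf_eq0 => /orP[]/eqP ->.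
  by left; rewrite loc_frac0.
by right; rewrite loc_frac0.
Qed.

Lemma loc_int_unit (a : int) k j : (`|a| %| m ^ j)%N -> is_unit (loc_frac m a k : A).
Proof.
move=> /dvdnP[d e]; have [b ab] : exists b : int, a * b = (m ^ j)%N%:Z.
  exists (sgz a * d%:Z); rewrite mulrA [a * _]mulrC -abszEsg e PoszM mulrC.
  by [].
suff h : loc_frac m a k * loc_frac m (b *+ m ^ k) j = 1.
  by exists (loc_frac m (b *+ m ^ k) j); split; rewrite // mulrC.
rewrite loc_frac_mul mulrnAr addnC loc_fracM ab -[1]/(loc_frac m (1 : int) 0).
by rewrite -(loc_fracM m (1 : int) 0 j) -[(m ^ j)%N%:Z]natz.
Qed.

(** If a is nonzero and a prime q outside m divides its numerator, cancelling a gives a^(q-1) = 1 +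
    q z, which reads 0 = 1 modulo q. *)
Lemma loc_int_zero_or_unit (a : A) :
  (forall q, prime q -> ~~ (q %| m)%N -> exists z, a ^+ q = a + a * z *+ q) ->
  a = 0 \/ is_unit a.
Proof.
elim/loc_frac_ind: a => a k h; have [->|a0] := eqVneq a 0.
  by left; apply: loc_frac0.
right; have [q_m|[q [pq qa qm]]] : (forall q, prime q -> (q %| `|a|)%N -> (q %| m)%N) \/
    exists q, [/\ prime q, (q %| `|a|)%N & ~~ (q %| m)%N].
  have [h1|nh] := pselect (exists q, [/\ prime q, (q %| `|a|)%N & ~~ (q %| m)%N]); first by right.
  left=> q pq qa; apply/negPn/negP => qm; apply: nh; by exists q.
  by have [|j /loc_int_unit] := dvdn_exp_of_primes _ q_m; rewrite ?absz_gt0.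
have [z e] := h q pq qm; have q1 := prime_gt1 pq.
have : loc_frac m a k * (loc_frac m a k ^+ q.-1 - 1 - z *+ q) = 0.
  rewrite !mulrBr mulr1 -exprS prednK ?e; last by lia.
  by rewrite mulrnAr addrAC addrK subrr.
case/loc_int_integral => [/loc_int_eq0/eqP|]; first by rewrite (negbTE a0).
move/(congr1 (loc_residue q)); rewrite !rmorphB rmorphXn rmorphMn rmorph1 rmorph0 //=.
rewrite (loc_residueE pq qm).
have -> : a%:~R = 0 :> 'F_q.
  have [b ->] : exists b, a = b * q%:Z by apply/dvdzP.
  by rewrite intrM -pmulrn -[X in _ * X]/(q%:R) pchar_Fp_0 ?mulr0.
have q0 : (q.-1 == 0)%N = false by lia.
rewrite mul0r expr0n q0 -[_ *+ q]mulr_natr pchar_Fp_0 // mulr0 subr0 sub0r.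
by move/eqP; rewrite oppr_eq0 oner_eq0.
Qed.

End Integers.

(** * Coordinates *)

Section Assembly.
Variables (P : perm_group) (m : nat).
Hypothesis olig : oligomorphic P.
Hypothesis m_gt0 : (0 < m)%N.
Hypothesis ind : Ind P m.
Local Notation R := (loc m (Theta P)).
Local Notation A := (loc m int).
Local Notation iota x := (loc_frac m (x : Theta P) 0 : R).

Definition loc_basic (u : R) : Prop := exists2 b, basic_class b & u = iota b.

Lemma prod_span_iota k x : prod_span 1 (@basic_class P) k x -> prod_span m loc_basic k (iota x).
Proof.
elim=> {k x} [k|k b x Bb _ IH|k x _|k x y _ IHx _ IHy|k x _].
- exact: prod_span1.
- have -> : iota (b * x) = iota b * iota x by rewrite loc_frac_mul.
  by apply: prod_spanM => //; exists b.
- exact: prod_spanS.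
- by rewrite loc_fracD loc_fracN; apply: prod_spanB.
by rewrite mulr1n.
Qed.

Lemma loc_span (u : R) : exists k, prod_span m loc_basic k u.
Proof.
have [i [x ux]] := loc_clear u; have [k /prod_span_iota hk] := theta_span x.
exists k; move: hk; rewrite -ux; elim: i {ux} => [|i IH]; first by rewrite mulr1n.
by rewrite expnSr mulrnA => /prod_span_div.
Qed.

Lemma loc_basic_frobenius b q : loc_basic b -> prime q -> ~~ (q %| m)%N ->
  exists2 y, prod_span m loc_basic q y & b ^+ q - b = y *+ q.
Proof.
case=> c /(basic_frobenius olig ind) hc -> pq qm; have [y hy e] := hc q pq qm.
exists (iota y); first exact: prod_span_iota.
by rewrite loc_frac_exp e loc_fracD loc_fracMn addrAC subrr add0r.
Qed.

Local Notation val1 := (@theta_le1_val P).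
Local Notation jmap := (loc_map val1 : loc m (Theta_le1 P) -> R).

Lemma val1B : {morph val1 : x y / x - y}. Proof. by []. Qed.

Lemma jmap_lin_span (u : loc m (Theta_le1 P)) : lin_span m loc_basic (jmap u).
Proof.
elim/loc_frac_ind: u => x i; rewrite (loc_mapE m val1B).
have : lin_span m loc_basic (iota (val1 x)).
  have /asboolP := theta_le1_valP x; elim=> {x} [a Ba||a b _ ha _ hb].
  - by apply: lin_span_gen; exists a.
  - by rewrite loc_frac0; apply: lin_span0.
  by rewrite loc_fracD loc_fracN; apply: lin_spanB.
rewrite -(loc_frac_clear m (val1 x) i); elim: i {1 3}i => [|i IH] j; first by rewrite mulr1n.
by rewrite expnSr mulrnA => /lin_span_div/IH.
Qed.

(** Carries generators of the localized [Theta_le1] over to Theta[1/m], with a common denominator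
    m^k cleared, as the degree filtration requires. *)
Lemma basic_comb r (v : 'I_r -> loc m (Theta_le1 P)) :
  (forall u, exists c : 'I_r -> A, u = \sum_i c i *: v i) ->
  forall b, loc_basic b -> exists k (c : 'I_r -> int), b *+ m ^ k = \sum_i jmap (v i) *~ c i.
Proof.
move=> vgen _ [b Bb ->].
have bP : b \in theta_le1 (P := P) by apply/asboolP/theta_le1_basic.
pose u := loc_frac m (MkTheta_le1 bP) 0.
have [c uE] := vgen u; have [K [a cE]] := common_denominator c.
exists K, a; have -> : iota b = jmap u by rewrite (loc_mapE m val1B).
rewrite -(loc_mapMn val1B) uE -sumrMnl (loc_map_sum val1B); apply: eq_bigr => i _.
by rewrite cE loc_frac_scale (loc_mapMz val1B).
Qed.

Lemma R_torsion_free q : prime q -> ~~ (q %| m)%N -> forall x : R, x *+ q = 0 -> x = 0.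
Proof.
move=> pq qm; apply: loc_torsion_free => x; exact: (theta_torsion_free olig ind pq qm).
Qed.

Lemma R_frobenius q : prime q -> ~~ (q %| m)%N -> forall x : R, exists y, x ^+ q - x = y *+ q.
Proof.
move=> pq qm; apply: loc_frobenius => // x; exact: (theta_frobenius olig ind pq qm).
Qed.

Section Decomposed.
Variables (n : nat) (E : 'I_n -> R).
Hypothesis E_neq0 : forall i, E i != 0.
Hypothesis E_orth : forall i j, E i * E j = if i == j then E i else 0.
Hypothesis E_sum : \sum_i E i = 1.
Hypothesis E_scalar : forall x i, exists k (a : int), x *+ m ^ k * E i = E i *~ a.

Lemma scale_inj (a b : A) i : a *: E i = b *: E i -> a = b.
Proof.
move=> e; apply/eqP; rewrite -subr_eq0; apply/eqP; have : (a - b) *: E i = 0.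
  by rewrite scalerBl e subrr.
elim/loc_frac_ind: (a - b) => N k h; have : E i *~ N = 0.
  by rewrite -(loc_frac_scale N k) h mul0rn.
move=> eN; have [->|N0] := eqVneq N 0; first by rewrite loc_frac0.
have := torsion_freez m_gt0 (loc_inv_exists m _) R_torsion_free N0 eN.
by move/eqP: (E_neq0 i).
Qed.

Lemma scalar_exists x i : exists a : A, x * E i = a *: E i.
Proof.
have [k [a e]] := E_scalar x i; exists (loc_frac m a k).
apply: (mulmI m_gt0 (loc_inv_exists m _) R_torsion_free (k := k)).
by rewrite loc_frac_scale -mulrnAl.
Qed.

Definition coordinate (x : R) : {ffun 'I_n -> A} := [ffun i => sval (cid (scalar_exists x i))].

Lemma coordinateE x i : x * E i = coordinate x i *: E i.
Proof. by rewrite ffunE; case: cid. Qed.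

Lemma coordinate_unique x i a : x * E i = a *: E i -> coordinate x i = a.
Proof. by move=> e; apply: (@scale_inj _ _ i); rewrite -coordinateE. Qed.

Lemma coordinateB x y i : coordinate (x - y) i = coordinate x i - coordinate y i.
Proof. by apply: coordinate_unique; rewrite mulrBl !coordinateE scalerBl. Qed.

Lemma coordinate1 i : coordinate 1 i = 1.
Proof. by apply: coordinate_unique; rewrite mul1r scale1r. Qed.

Lemma coordinateM x y i : coordinate (x * y) i = coordinate x i * coordinate y i.
Proof.
apply: coordinate_unique.
by rewrite mulrAC coordinateE loc_scaleAl mulrC coordinateE scalerA.
Qed.

Lemma coordinate_is_zmod_morphism : zmod_morphism coordinate.
Proof.
move=> x y; apply/ffunP => i; rewrite coordinateB [RHS]ffunE.
by congr (_ + _); rewrite [RHS]ffunE.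
Qed.

Lemma coordinate_is_monoid_morphism : monoid_morphism coordinate.
Proof.
split; first by apply/ffunP => i; rewrite coordinate1 ffunE.
by move=> x y; apply/ffunP => i; rewrite coordinateM [RHS]ffunE.
Qed.

Definition coordinate_rmorphism : {rmorphism R -> {ffun 'I_n -> A}} :=
  HB.pack coordinate
    (GRing.isZmodMorphism.Build R {ffun 'I_n -> A} coordinate coordinate_is_zmod_morphism)
    (GRing.isMonoidMorphism.Build R {ffun 'I_n -> A} coordinate coordinate_is_monoid_morphism).

Lemma coordinate_bij : bijective coordinate.
Proof.
exists (fun f : {ffun 'I_n -> A} => \sum_i f i *: E i) => [x|f].
  rewrite -[RHS]mulr1 -E_sum mulr_sumr; apply: eq_bigr => i _.
  by rewrite coordinateE.
apply/ffunP => i; apply: coordinate_unique; rewrite mulr_suml (bigD1 i) //=.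
rewrite loc_scaleAl E_orth eqxx big1 ?addr0 // => j ji.
by rewrite loc_scaleAl E_orth (negbTE ji) scaler0.
Qed.

Lemma coordinate_frobenius x z i q : x ^+ q = x + x * z *+ q ->
  coordinate x i ^+ q = coordinate x i + coordinate x i * coordinate z i *+ q.
Proof.
have cX k : coordinate (x ^+ k) i = coordinate x i ^+ k.
  by elim: k => [|k IH]; rewrite ?coordinate1 // !exprS coordinateM IH.
have cN y : coordinate (- y) i = - coordinate y i.
  by apply: coordinate_unique; rewrite mulNr coordinateE scaleNr.
have cMn y k : coordinate (y *+ k) i = coordinate y i *+ k.
  by apply: coordinate_unique; rewrite mulrnAl coordinateE scalerMnl.
move/(congr1 (fun u => coordinate u i)); rewrite cX => ->.
by rewrite -[x * z *+ q]opprK coordinateB cN opprK cMn coordinateM.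
Qed.

Lemma coordinate_zero_or_unit (Y X : smooth_gset P) (f : gmap Y X)
    (tX : gtransitive X) i : gtransitive Y ->
  coordinate (iota (theta_class f tX)) i = 0 \/
  is_unit (coordinate (iota (theta_class f tX)) i).
Proof.
move=> tY; apply: loc_int_zero_or_unit => // q pq qm.
have [z e] := transitive_frobenius olig ind pq qm f tX tY.
exists (coordinate (iota z) i); apply: coordinate_frobenius.
by rewrite loc_frac_exp e loc_fracD loc_fracMn loc_frac_mul.
Qed.

(** Reducing coordinate i of the r generators modulo p gives a vector in F_p^r. If i and j gave the
    same vector, the elements whose i-th and j-th coordinates agree modulo p would form a subring
    that contains the basic classes and 1 / m, hence everything; but E i has coordinates 1 at i and
    0 at j. *)
Lemma card_bound r p :
  generated_by (loc m (Theta_le1 P) : lmodType A) r ->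
  least_prime_not_dividing m p -> (n <= p ^ r)%N.
Proof.
case=> v vgen [pp pm _].
pose F i := [ffun j : 'I_r => loc_residue p (coordinate (jmap (v j)) i)].
have FE i l : F i l = loc_residue p (coordinate (jmap (v l)) i) by rewrite ffunE.
suff Finj : injective F.
  have := leq_card F Finj; rewrite card_ord card_ffun card_Fp //.
  by rewrite card_ord.
move=> i j Fij; apply/eqP/negPn/negP => ij.
pose good (x : R) := loc_residue p (coordinate x i) = loc_residue p (coordinate x j).
have resB (a b : A) : loc_residue p (a - b) = loc_residue p a - loc_residue p b.
  exact: (loc_residue_is_zmod_morphism pp pm).
have resM (a b : A) : loc_residue p (a * b) = loc_residue p a * loc_residue p b.
  exact: (loc_residue_is_monoid_morphism pp pm).2.
have res1 : loc_residue p (1 : A) = 1 := (loc_residue_is_monoid_morphism pp pm).1.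
have gB x y : good x -> good y -> good (x - y).
  by rewrite /good !coordinateB !resB => -> ->.
have gM x y : good x -> good y -> good (x * y).
  by rewrite /good !coordinateM !resM => -> ->.
have g1 : good 1 by rewrite /good !coordinate1.
have g0 : good 0 by rewrite -(subrr 1); apply: gB.
have gD x y : good x -> good y -> good (x + y).
  by move=> gx gy; rewrite -[y]opprK -[- y]sub0r; do 2!apply: (gB) => //.
have gMn x k : good x -> good (x *+ k).
  by move=> gx; elim: k => [|k IH]; rewrite ?mulr0n ?mulrS //; apply: gD.
have gMz x a : good x -> good (x *~ a).
  move=> gx; case: (intP a) => [|k|k]; rewrite ?mulr0z // ?mulrNz -pmulrn; first exact: gMn.
  by rewrite -[- _]sub0r; apply: gB => //; apply: gMn.
have [u um] := loc_inv_exists m (Theta P).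
(* The residues of the coordinates of u = 1 / m are inverse to those of m, which are equal. *)
have gu : good u.
  have um' l : loc_residue p (coordinate u l) * loc_residue p (coordinate (1 *+ m) l) = 1.
    by rewrite -resM -coordinateM mulr_natr um coordinate1.
  rewrite /good -[LHS]mulr1 -(um' j) mulrCA mulrC.
  by rewrite -(gMn 1 m g1) um' mul1r.
have gdiv x : good (x *+ m) -> good x.
  by move=> gx; rewrite -[x]mulr1 -um mulrnAr -mulrnAl; apply: gM.
have gdivX x k : good (x *+ m ^ k) -> good x.
  by elim: k => [|k IH]; rewrite ?mulr1n // expnSr mulrnA => /gdiv/IH.
have gspan k x : prod_span m loc_basic k x -> good x.
  elim=> {k x} // [k b x Bb _ gx|k x y _ gx _ gy|k x _]; last exact: gdiv.
    apply: gM => //; have [k' [c e]] := basic_comb vgen Bb.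
    apply: (@gdivX _ k'); rewrite e; apply: (big_ind good) => // l _; apply: gMz.
    by rewrite /good -!FE Fij.
  exact: gB.
have ei : coordinate (E i) i = 1 by apply: coordinate_unique; rewrite E_orth eqxx scale1r.
have ej : coordinate (E i) j = 0.
  by apply: coordinate_unique; rewrite E_orth (negbTE ij) scale0r.
have [k /gspan] := loc_span (E i); rewrite /good ei ej res1 -(subrr 1) resB subrr.
by move/eqP; rewrite oner_eq0.
Qed.

End Decomposed.
End Assembly.

Theorem theorem3p4 (P : perm_group) (m : nat) :
  oligomorphic P -> (0 < m)%N -> Ind P m -> Gen P m ->
  exists (n : nat)
    (phi : {rmorphism loc m (Theta P) -> {ffun 'I_n -> loc m int}}),
    [/\ bijective phi,
      (forall (Y X : smooth_gset P) (f : gmap Y X)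
          (tY : gtransitive Y) (tX : gtransitive X) (i : 'I_n),
        phi (loc_frac m (theta_class f tX) 0) i = 0 \/
        is_unit (phi (loc_frac m (theta_class f tX) 0) i)) &
      (forall r p : nat,
        generated_by (loc m (Theta_le1 P) : lmodType (loc m int)) r ->
        least_prime_not_dividing m p -> (n <= p ^ r)%N)].
Proof.
move=> olig m_gt0 ind [r [v vgen]].
have [ws wsP] := prod_span_finitely_generated m_gt0 (loc_inv_exists m (Theta P))
  (loc_basic_frobenius olig ind) (fun i => jmap_lin_span (v i)) (basic_comb vgen) (@loc_span P m).
have [n [E [E0 EM E1 Esc]]] := scalar_decomposition m_gt0 (loc_inv_exists m (Theta P))
  (R_torsion_free olig ind) (R_frobenius olig m_gt0 ind) wsP.
exists n, (coordinate_rmorphism olig m_gt0 ind E0 Esc); split.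
- exact: coordinate_bij.
- by move=> Y X f tY tX i; apply: coordinate_zero_or_unit.
by move=> r' p; apply: (card_bound olig m_gt0 ind E0 EM Esc).
Qed.
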